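(* Let $\kappa\ge1$ and $V\in\mathcal{P}_1(\kappa)$. Then, for every integer $n\ge1$, $$E_n(V)^{1/2}\,|\{V\le E_n(V)\}|\simeq_\kappa n,$$ and, for all integers $1\le m\le n$, $$E_n(V)-E_m(V)\simeq_\kappa\frac{E_n(V)}{n}\,(n-m).$$
   Context: For $\kappa\ge1$, $\mathcal{P}_1(\kappa)$ is the class of functions $V:\mathbb{R}\to[0,\infty)$ such that: $V(0)=0$; $V(-x)\le\kappa V(x)$ for all $x\in\mathbb{R}$; and both functions $x\mapsto V(x)$ and $x\mapsto V(-x)$, restricted to $\mathbb{R}^+=(0,\infty)$, are positive, of class $C^1(\mathbb{R}^+)$ and satisfy $\kappa^{-1}W(x)\le xW'(x)\le\kappa W(x)$ for all $x>0$ (with $W$ the function in question). For such $V$, the Schrödinger operator $\mathcal{H}[V]=-\partial_x^2+V(x)$ on $L^2(\mathbb{R})$, initially defined on $C_c^\infty(\mathbb{R})$, is essentially self-adjoint, and its self-adjoint extension has pure point spectrum consisting of a divergent sequence of simple eigenvalues $E_1(V)<E_2(V)<\cdots$. $|A|$ is the Lebesgue measure of $A\subseteq\mathbb{R}$ and $\{V\le E\}=\{x\in\mathbb{R}:V(x)\le E\}$. $A\simeq_\kappa B$ means $C^{-1}B\le A\le CB$ for a constant $C>0$ depending only on $\kappa$ (in particular not on $V$, $n$, $m$). *)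

(* Defs.v *)
From mathcomp Require Import all_boot all_order all_algebra.
From mathcomp Require Import all_classical all_reals all_analysis.
From mathcomp Require Import complex.
Set Implicit Arguments.
Unset Strict Implicit.
Unset Printing Implicit Defensive.
Import Order.TTheory GRing.Theory Num.Theory.
Import numFieldNormedType.Exports.
Local Open Scope ring_scope.
Local Open Scope classical_set_scope.
Local Open Scope card_scope.

Section PotentialClass.
Context {R : realType}.

Definition power_like (kappa : R) (W : R -> R) : Prop :=
  forall x : R, 0 < x ->
    [/\ 0 < W x,
        derivable W x 1,
        {for x, continuous (derive1 W)},
        kappa^-1 * W x <= x * derive1 W x
      & x * derive1 W x <= kappa * W x].

Definition P1 (kappa : R) (V : R -> R) : Prop :=
  [/\ forall x, 0 <= V x,
      V 0 = 0,
      forall x, V (- x) <= kappa * V x,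
      power_like kappa V
    & power_like kappa (fun x => V (- x))].

Definition simeq (C : R) (A B : \bar R) : Prop :=
  ((C^-1)%:E * B <= A)%E /\ (A <= C%:E * B)%E.

End PotentialClass.

Section Schrodinger.
Context {R : realType}.
Local Notation mu := (@lebesgue_measure R).

Definition reF (f : R -> R[i]) : R -> R := fun x => complex.Re (f x).
Definition imF (f : R -> R[i]) : R -> R := fun x => complex.Im (f x).

Definition inL2 (f : R -> R[i]) : Prop :=
  reF f \in Lfun mu 2%:E /\ imF f \in Lfun mu 2%:E.

Definition cvgL2 (u : nat -> R -> R[i]) (f : R -> R[i]) : Prop :=
  Lnorm mu 2%:E (fun x => (Normc.normc (u k x - f x))%:E) @[k --> \oo]
    --> (0 : \bar R).

Definition smooth (g : R -> R) : Prop :=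
  forall (n : nat) (x : R), derivable (derive1n n g) x 1.

Definition Cc_infty (phi : R -> R[i]) : Prop :=
  [/\ smooth (reF phi), smooth (imF phi)
    & compact (closure [set x | phi x != 0])].

Definition cderive2 (phi : R -> R[i]) (x : R) : R[i] :=
  Complex (derive1n 2 (reF phi) x) (derive1n 2 (imF phi) x).

Definition schrodinger (V : R -> R) (phi : R -> R[i]) (x : R) : R[i] :=
  - cderive2 phi x + real_complex R (V x) * phi x.

(* (f, g) lies in the closure, in L^2 x L^2, of the graph of the operator
   [schrodinger V] with domain [Cc_infty].  When this operator is essentially
   self-adjoint, its closure is its unique self-adjoint extension. *)
Definition schrodinger_closure (V : R -> R) (f g : R -> R[i]) : Prop :=
  [/\ inL2 f, inL2 g &
    exists phi : nat -> R -> R[i],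
      [/\ forall k, Cc_infty (phi k),
          cvgL2 phi f
        & cvgL2 (fun k => schrodinger V (phi k)) g]].

(* Only real E are considered: a self-adjoint operator has real eigenvalues. *)
Definition eigenvalue_of (V : R -> R) (E : R) : Prop :=
  exists f : R -> R[i],
    ~ {ae mu, forall x, f x = 0} /\
    schrodinger_closure V f (fun x => real_complex R E * f x).

(* E is the n-th eigenvalue in increasing order, counting from n = 1 (the
   eigenvalues are simple, so multiplicities play no role). *)
Definition is_nth_eigenvalue (V : R -> R) (n : nat) (E : R) : Prop :=
  eigenvalue_of V E /\
  [set E' | eigenvalue_of V E' /\ E' < E] #= `I_n.-1.

(* E_n(V), for n >= 1.  The default value 0, taken when there is no n-th
   eigenvalue, is never an eigenvalue of a nonnegative V. *)
Definition eigen (V : R -> R) (n : nat) : R :=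
  xget 0 [set E | is_nth_eigenvalue V n E].

Definition sublevel_measure (V : R -> R) (E : R) : \bar R :=
  mu [set x | V x <= E].

End Schrodinger.

(* Main.v *)
(* On each half line the equation u'' = (V - E) u has, up to scaling, one
   decaying solution, and E is an eigenvalue iff the solutions u, u~ of the two
   halves match at 0, that is, u(0) u~'(0) + u'(0) u~(0) = 0.  By the Wronskian
   identity in E, the vector (s u(0), u'(0)) rotates as E grows, at the rate
   s |u|^2 / (s^2 u(0)^2 + u'(0)^2) with |u| the L^2 norm on the half line.
   Since u'^2 + (E - V) u^2 is monotone in x, |u|^2 is comparable to
   X (E u(0)^2 + u'(0)^2) / E as soon as sqrt(E) X is bounded below, X being the
   turning point V(X) = E; and there is no matching when sqrt(E) X is small.
   With s = sqrt(E) this bounds the gap between consecutive eigenvalues from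
   above and below by E / F(E), where F(E) = sqrt(E) |{V <= E}|.  Hence
   F(E_{n+1}) - F(E_n) is bounded above and below, which gives F(E_n) ~ n, and
   E_n - E_m ~ (E_n / n) (n - m) because F(l E) lies between sqrt(l) F(E) and
   l^k F(E) for l >= 1. *)

Require Import Defs.
From mathcomp Require Import all_boot all_order all_algebra.
From mathcomp Require Import all_classical all_reals all_analysis.
From mathcomp Require Import complex ring lra measurable_realfun.
Set Implicit Arguments.
Unset Strict Implicit.
Unset Printing Implicit Defensive.
Import Order.TTheory GRing.Theory Num.Theory.
Import numFieldNormedType.Exports.
Local Open Scope classical_set_scope.
Local Open Scope ring_scope.

(** The operator enters only through the closure of its graph on test functions, and eigenvalues are
    identified with matching energies in two separate steps. If matching fails, dividing by the
    Wronskian bounds a test function [f], uniformly on compact sets, by the L^2 norm of [(H - E) f];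
    an L^2 limit whose residual tends to 0 therefore vanishes. If the halves match, the glued
    solution decays exponentially but need not be smooth, [V] being merely continuous at 0; it is
    approximated by polynomials times cutoffs. In place of an angle function, the proof multiplies
    the two half-line vectors as complex numbers and uses that their Wronskians are linear in the
    energy up to a quadratic error; quotients of coordinates can then be differentiated. In each
    window of energies [s] is frozen at the square root of the left end. The enumeration of the
    eigenvalues is itself an outcome: gaps bounded below make the set locally finite, and existence
    within a bounded phase makes it unbounded. A natural number [K >= kappa] replaces [kappa], and
    all constants are fixed from [K] before [V] appears. *)

Section Calculus.
Context {R : realType}.
Implicit Types (f g : R -> R) (x a b : R).

Lemma is_deriveMf f g x a b : is_derive x 1 f a -> is_derive x 1 g b ->
  is_derive x 1 (fun y => f y * g y) (f x * b + g x * a).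
Proof. by move=> ? ?; apply: is_deriveM. Qed.

Lemma is_deriveDf f g x a b : is_derive x 1 f a -> is_derive x 1 g b ->
  is_derive x 1 (fun y => f y + g y) (a + b).
Proof. by move=> ? ?; apply: is_deriveD. Qed.

Lemma is_deriveNf f x a : is_derive x 1 f a -> is_derive x 1 (fun y => - f y) (- a).
Proof. by move=> ?; apply: is_deriveN. Qed.

Lemma is_deriveXf f n x a : is_derive x 1 f a ->
  is_derive x 1 (fun y => f y ^+ n.+1) (n.+1%:R * f x ^+ n * a).
Proof.
move=> fa; elim: n => [|n IH].
  by rewrite (_ : (fun y => _) = f) ?mul1r ?expr0 ?mul1r//; apply/funext => y.
rewrite (_ : (fun y => _) = (fun y => f y * f y ^+ n.+1)); last first.
  by apply/funext => y; rewrite exprS.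
have H := is_deriveMf fa IH.
apply: (is_derive_eq H).
by rewrite [n.+2%:R]mulrSr exprS; ring.
Qed.

Lemma is_deriveVf f x a : f x != 0 -> is_derive x 1 f a ->
  is_derive x 1 (fun y => (f y)^-1) (- a / f x ^+ 2).
Proof.
move=> fx fa; have H := is_deriveV fx fa; apply: (is_derive_eq H).
by rewrite /GRing.scale/=; field.
Qed.

Lemma is_derive_compf f g x a b : is_derive (g x) 1 f a -> is_derive x 1 g b ->
  is_derive x 1 (fun y => f (g y)) (a * b).
Proof. by move=> ? ?; apply: is_derive1_comp. Qed.

Lemma is_derive_cstf (c x : R) : is_derive x 1 (fun=> c) 0.
Proof. exact: is_derive_cst. Qed.

Lemma is_derive_idf x : is_derive x 1 (fun y => y) 1.
Proof. exact: is_derive_id. Qed.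

Lemma is_derive_mull (c x : R) : is_derive x 1 ( *%R c) c.
Proof.
have H := is_deriveMf (is_derive_cstf c x) (is_derive_idf x).
by apply: (is_derive_eq H); rewrite mulr1 mulr0 addr0.
Qed.

Lemma is_derive_cts f x a : is_derive x 1 f a -> {for x, continuous f}.
Proof.
by move=> [fx _]; apply: differentiable_continuous; apply/derivable1_diffP.
Qed.

End Calculus.

Ltac dstep :=
  first
  [ eassumption
  | match goal with H : forall x, is_derive x 1 _ _ |- _ => apply H end
  | match goal with H : forall y x, is_derive x 1 _ _ |- _ => apply H end
  | match goal with |- is_derive _ _ ?F _ =>
    match F with
    | (fun y => ?c) => apply is_derive_cstf
    | (fun y => y) => apply is_derive_idf
    | GRing.mul _ => apply is_derive_mull
    | GRing.opp => apply (is_deriveNf (is_derive_idf _))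
    | expR => apply is_derive_expR
    | GRing.inv => eapply (is_deriveVf (f := fun y => y)); [|apply is_derive_idf]
    | (fun y => GRing.add _ _) => eapply is_deriveDf
    | (fun y => GRing.mul _ _) => eapply is_deriveMf
    | (fun y => GRing.opp _) => eapply is_deriveNf
    | (fun y => GRing.exp _ _) => eapply is_deriveXf
    | (fun y => GRing.inv _) => eapply is_deriveVf
    | (fun y => expR _) => eapply is_derive_compf; [apply is_derive_expR |]
    | (fun y => atan _) => eapply is_derive_compf; [apply is_derive1_atan |]
    | (fun y => ln _) => eapply is_derive_compf; [apply is_derive1_ln |]
    end end ].
Ltac dsolve := eapply is_derive_eq; [repeat dstep | cbv beta].

(** * Monotonicity from the sign of a derivative *)

Section Monotone.
Context {R : realType}.
Implicit Types (f g df : R -> R) (x a b : R).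

Lemma cts_within f a b : (forall x, a <= x <= b -> {for x, continuous f}) ->
  {within `[a, b], continuous f}.
Proof.
move=> fc; apply: continuous_in_subspaceT => x.
by rewrite inE/= in_itv/=; exact: fc.
Qed.

Lemma deriv_ge0_le f df a b : a <= b ->
  (forall x, a <= x <= b -> {for x, continuous f}) ->
  (forall x, a < x < b -> is_derive x 1 f (df x)) ->
  (forall x, a < x < b -> 0 <= df x) -> f a <= f b.
Proof.
rewrite le_eqVlt => /predU1P[->//|ab] /cts_within fc fd df0.
have fd' x : x \in `]a, b[ -> is_derive x 1 f (df x) by rewrite in_itv/=; exact: fd.
have [c] := MVT ab fd' fc.
rewrite in_itv/= => /df0 dfc E; rewrite -subr_ge0 E mulr_ge0// subr_ge0 ltW//.
Qed.

Lemma deriv_le0_le f df a b : a <= b ->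
  (forall x, a <= x <= b -> {for x, continuous f}) ->
  (forall x, a < x < b -> is_derive x 1 f (df x)) ->
  (forall x, a < x < b -> df x <= 0) -> f b <= f a.
Proof.
move=> ab fc fd df0; rewrite -lerN2.
apply: (@deriv_ge0_le (fun y => - f y) (fun y => - df y) _ _ ab) => x xab.
- by apply: continuousN; exact: fc.
- by apply: is_deriveNf; exact: fd.
- by rewrite oppr_ge0 df0.
Qed.

Lemma deriv_gt0_lt f df a b : a < b ->
  (forall x, a <= x <= b -> {for x, continuous f}) ->
  (forall x, a < x < b -> is_derive x 1 f (df x)) ->
  (forall x, a < x < b -> 0 < df x) -> f a < f b.
Proof.
move=> ab /cts_within fc fd df0.
have fd' x : x \in `]a, b[ -> is_derive x 1 f (df x) by rewrite in_itv/=; exact: fd.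
have [c] := MVT ab fd' fc.
rewrite in_itv/= => /df0 dfc E; rewrite -subr_gt0 E mulr_gt0// subr_gt0//.
Qed.

Lemma gderiv_ge0_le f df a b : a <= b ->
  (forall x, a <= x <= b -> is_derive x 1 f (df x)) ->
  (forall x, a <= x <= b -> 0 <= df x) -> f a <= f b.
Proof.
move=> ab fd df0; apply: deriv_ge0_le ab _ _ _ => x xab.
- exact: is_derive_cts (fd x xab).
- by apply: fd; case/andP: xab => /ltW-> /ltW->.
- by apply: df0; case/andP: xab => /ltW-> /ltW->.
Qed.

Lemma gderiv_le0_le f df a b : a <= b ->
  (forall x, a <= x <= b -> is_derive x 1 f (df x)) ->
  (forall x, a <= x <= b -> df x <= 0) -> f b <= f a.
Proof.
move=> ab fd df0; apply: deriv_le0_le ab _ _ _ => x xab.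
- exact: is_derive_cts (fd x xab).
- by apply: fd; case/andP: xab => /ltW-> /ltW->.
- by apply: df0; case/andP: xab => /ltW-> /ltW->.
Qed.

Lemma gderiv_eq0 f x y : (forall x, is_derive x 1 f 0) -> f x = f y.
Proof.
move=> fd; apply/eqP; rewrite eq_le; have [xy|/ltW xy] := leP x y.
  by apply/andP; split; [apply: (@gderiv_ge0_le f (fun=> 0))|
    apply: (@gderiv_le0_le f (fun=> 0))].
by apply/andP; split; [apply: (@gderiv_le0_le f (fun=> 0))|
    apply: (@gderiv_ge0_le f (fun=> 0))].
Qed.

(** The zero is the supremum of the points where [f <= 0]: by continuity neither sign of [f z] is
    compatible with being that supremum. It serves arguments that propagate positivity backwards
    from [b]. *)
Lemma last_zero f a b : a <= b -> (forall x, a <= x <= b -> {for x, continuous f}) ->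
  0 < f b -> ~ (forall x, a <= x <= b -> 0 < f x) ->
  exists z, [/\ a <= z < b, f z = 0 & forall x, z < x <= b -> 0 < f x].
Proof.
move=> ab fc fb nf.
have [x0 [x0ab fx0]] : exists x0, a <= x0 <= b /\ f x0 <= 0.
  apply: contrapT => H; apply: nf => x xab; rewrite ltNge; apply/negP => fx.
  by apply: H; exists x.
pose S := [set x | a <= x <= b /\ f x <= 0].
have Sne : S !=set0 by exists x0.
have Sub : has_ubound S by exists b => y [/andP[]].
pose z := sup S.
have zab : a <= z <= b.
  have xz : x0 <= z by exact: ub_le_sup.
  rewrite (le_trans _ xz) ?(andP x0ab).1//=.
  by apply: ge_sup => // y [/andP[]].
have fpos x : z < x <= b -> 0 < f x.
  move=> /andP[zx xb]; rewrite ltNge; apply/negP => fx.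
  suff : x <= z by rewrite leNgt zx.
  apply: ub_le_sup => //; split => //; rewrite xb andbT.
  by rewrite (le_trans _ (ltW zx))// (andP zab).1.
have fz0 : f z <= 0.
  rewrite leNgt; apply/negP => fz.
  have /(_ z zab)/cvgrPdist_lt/(_ _ fz) := fc.
  case/nbhs_ballP => e/= e0 He.
  have [y [yab fy] yz] : exists2 y, S y & z - e < y.
    by apply: sup_adherent => //; split.
  have yz' : y <= z by exact: ub_le_sup.
  have /He/= : ball z e y.
    by rewrite /ball/= ger0_norm ?subr_ge0//; lra.
  by rewrite ltr_norml => /andP[_]; lra.
have zb : z < b.
  rewrite lt_neqAle (andP zab).2 andbT; apply/eqP => zb.
  by move: fb; rewrite -zb ltNge fz0.
exists z; split => //; first by rewrite (andP zab).1 zb.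
apply/eqP; rewrite eq_le fz0 leNgt; apply/negP => fz.
have /(_ z zab)/cvgrPdist_lt := fc.
move=> /(_ (- f z)); rewrite oppr_gt0 => /(_ fz).
case/nbhs_ballP => e/= e0 He.
pose y := z + Num.min (e / 2) (b - z).
have m0 : 0 < Num.min (e / 2) (b - z) by rewrite lt_min divr_gt0// subr_gt0 zb.
have me : Num.min (e / 2) (b - z) <= e / 2 by rewrite ge_min lexx.
have mb : Num.min (e / 2) (b - z) <= b - z by rewrite ge_min lexx orbT.
have /He/= : ball z e y.
  by rewrite /ball/= distrC ger0_norm /y; lra.
have /fpos : z < y <= b by rewrite /y; lra.
by rewrite ltr_norml => ? /andP[]; lra.
Qed.

Lemma norm_le_of_signs (y c : R) : (forall s, s = 1 \/ s = -1 -> s * y <= c) -> `|y| <= c.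
Proof.
move=> H; have := H 1 (or_introl erefl); have := H (-1) (or_intror erefl).
by rewrite ler_norml; lra.
Qed.

Lemma lipschitz_of_deriv f df (M b : R) : f 0 = 0 -> (forall x, is_derive x 1 f (df x)) ->
  (forall x, - b <= x <= b -> `|df x| <= M) -> forall x, - b <= x <= b -> `|f x| <= M * `|x|.
Proof.
move=> f0 fd HM x xb; rewrite -[f x]subr0 -{1}f0 -[in leRHS](subr0 x).
have fc a c : {within `[a, c], continuous f} by apply: cts_within => y _; exact: is_derive_cts (fd y).
have [x0|/ltW x0] := leP 0 x.
  have [c] := MVT_segment x0 (fun y _ => fd y) (fc _ _).
  by rewrite in_itv/= => hc ->; rewrite normrM ler_wpM2r// HM//; lra.
rewrite distrC [in leRHS]distrC; have [c] := MVT_segment x0 (fun y _ => fd y) (fc _ _).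
by rewrite in_itv/= => hc ->; rewrite normrM ler_wpM2r// HM//; lra.
Qed.

End Monotone.

(** * Primitives, comparison and geometric limits *)

Section Primitive.
Context {R : realType}.
Implicit Types (f g : R -> R) (x a b : R).

(** The integral from [- n] has derivative [f] only on [(- n, n)]. Subtracting its value at 0 makes
    the choices for different [n] agree, so [n] may depend on [x]. *)
Lemma primitive_exists f : continuous f ->
  exists F : R -> R, F 0 = 0 /\ forall x, is_derive x 1 F (f x).
Proof.
move=> fc.
pose G (n x : R) := (\int[@lebesgue_measure R]_(t in [set` Interval (BLeft (- n)) (BRight x)]) f t)%R.
have GD n x : - n < x < n -> is_derive x 1 (G n) (f x).
  move=> /andP[nx xn].
  have [] := @continuous_FTC1 R f (BLeft (- n)) x n xn _ _ (fc x).
  - apply: continuous_compact_integrable; first exact: segment_compact.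
    exact: continuous_subspaceT.
  - by rewrite /Order.lt/=; lra.
  - by move=> d1 d2; split; [exact: d1|rewrite -derive1E; exact: d2].
have GG m n x : 0 < n -> n <= m -> - n < x < n -> G m x - G m 0 = G n x - G n 0.
  move=> n0 nm xn.
  have E a b : - n < a -> b < n -> a <= b -> G m a - G n a = G m b - G n b.
    move=> na bn ab.
    have H y : a <= y <= b -> is_derive y 1 (fun y => G m y - G n y) 0.
      move=> yab; rewrite -(subrr (f y)).
      by apply: is_deriveDf; [|apply: is_deriveNf]; apply: GD; lra.
    apply/eqP; rewrite eq_le; apply/andP; split.
      exact: (@gderiv_ge0_le _ (fun y => G m y - G n y) (fun=> 0)).
    exact: (@gderiv_le0_le _ (fun y => G m y - G n y) (fun=> 0)).
  suff : G m x - G n x = G m 0 - G n 0 by lra.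
  by have [x0|/ltW x0] := leP x 0; [|apply/esym]; apply: E => //; lra.
exists (fun x => G (`|x| + 1) x - G (`|x| + 1) 0); split; first by rewrite subrr.
move=> x; pose N := `|x| + 2.
have xN : - N < x < N.
  by have := ler_norm x; rewrite /N; have := ler_norm (- x); rewrite normrN; lra.
apply: (@near_eq_is_derive _ _ _ (fun y => G N y - G N 0)) => //.
- near=> y.
  have yx : `|x - y| < 1 by near: y; apply: (@cvgr_dist_lt _ _ _ _ _ id).
  have yle : `|y| <= `|x| + `|x - y|.
    by rewrite -[in X in X <= _](subKr x y) -opprB normrN distrC (le_trans (ler_normB _ _))// addrC distrC.
  apply: GG; [by have := normr_ge0 y; lra | by rewrite /N; lra|].
  by have := ler_norm y; have := ler_norm (- y); rewrite normrN; lra.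
- by have HG := GD N x xN; dsolve; rewrite ?oppr0 addr0.
Unshelve. all: by end_near. Qed.

Definition prim f : R -> R :=
  xget (fun=> 0) [set F | F 0 = 0 /\ forall x, is_derive x 1 F (f x)].

Lemma primP f : continuous f -> prim f 0 = 0 /\ forall x, is_derive x 1 (prim f) (f x).
Proof.
move=> /primitive_exists[F HF]; rewrite /prim.
by case: xgetP => [y _ []//|/(_ F)].
Qed.

Lemma deriv_continuous (f df : R -> R) : (forall x, is_derive x 1 f (df x)) -> continuous f.
Proof. by move=> H x; exact: is_derive_cts (H x). Qed.

Lemma continuous_bounded f b : continuous f -> exists2 M, 0 < M & forall x, - b <= x <= b -> `|f x| <= M.
Proof.
move=> fc; have [b0|b0] := ltP b 0.
  by exists 1 => // x ?; lra.
have bb : - b <= b by lra.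
have nc : {within `[- b, b], continuous (fun x => `|f x|)}.
  by apply: continuous_subspaceT => x; apply: cvg_norm; exact: fc.
have [c _ Hc] := EVT_max bb nc.
exists (`|f c| + 1) => [|x xb]; first by rewrite ltr_wpDl.
by rewrite (le_trans (Hc x _)) ?in_itv//= lerDl.
Qed.

(** For either sign [s], [c + s * z] is convex on [[- b, b]] with a critical point at 0, so it is
    minimal there, where its value is [c 0 >= 0]. *)
Lemma second_order_comparison (z z' z'' c c' c'' : R -> R) b :
  (forall x, is_derive x 1 z (z' x)) -> (forall x, is_derive x 1 z' (z'' x)) ->
  (forall x, is_derive x 1 c (c' x)) -> (forall x, is_derive x 1 c' (c'' x)) ->
  z 0 = 0 -> z' 0 = 0 -> 0 <= c 0 -> c' 0 = 0 ->
  (forall x, - b <= x <= b -> `|z'' x| <= c'' x) ->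
  forall x, - b <= x <= b -> `|z x| <= c x.
Proof.
move=> dz dz' dc dc' z0 z'0 c0 c'0 H.
suff K (s : R) : s = 1 \/ s = -1 -> forall x, - b <= x <= b -> 0 <= c x + s * z x.
  move=> x xb; rewrite ler_norml.
  by have := K 1 (or_introl erefl) x xb; have := K (-1) (or_intror erefl) x xb; lra.
move=> s1.
have d1 x : is_derive x 1 (fun y => c y + s * z y) (c' x + s * z' x).
  by dsolve; ring.
have d2 x : is_derive x 1 (fun y => c' y + s * z' y) (c'' x + s * z'' x).
  by dsolve; ring.
have p2 x : - b <= x <= b -> 0 <= c'' x + s * z'' x.
  by move=> /H; rewrite ler_norml; case: s1 => ->; lra.
have e1 : c' 0 + s * z' 0 = 0 by rewrite c'0 z'0; lra.
have e0 : c 0 + s * z 0 = c 0 by rewrite z0; lra.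
move=> x xb; rewrite (le_trans c0)// -e0.
have [x0|/ltW x0] := leP 0 x.
- apply: (gderiv_ge0_le x0 (fun y _ => d1 y)) => y yx; rewrite -e1.
  apply: (gderiv_ge0_le _ (fun y _ => d2 y)) => [|t ty]; first by lra.
  by apply: p2; lra.
- apply: (gderiv_le0_le x0 (fun y _ => d1 y)) => y yx; rewrite -e1.
  apply: (gderiv_ge0_le _ (fun y _ => d2 y)) => [|t ty]; first by lra.
  by apply: p2; lra.
Qed.

(** The sequences [y n - 2 * B / 2 ^+ n] and [y n + 2 * B / 2 ^+ n] are monotone in opposite
    directions and enclose the limit, which yields the rate as well. *)
Lemma geometric_limit (y : nat -> R) B :
  (forall n, `|y n.+1 - y n| <= B / 2 ^+ n) ->
  exists l, forall n, `|l - y n| <= 2 * B / 2 ^+ n.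
Proof.
move=> H.
pose t n := y n - 2 * B / 2 ^+ n; pose s n := y n + 2 * B / 2 ^+ n.
have p2 n : (0 : R) < 2 ^+ n by rewrite exprn_gt0.
have E n : 2 * B / 2 ^+ n.+1 = B / 2 ^+ n.
  by rewrite exprS; field; rewrite gt_eqF.
have B0 : 0 <= B by have := H 0%N; rewrite expr0 divr1; apply: le_trans.
have nt n : t n <= t n.+1.
  by rewrite /t E; have := H n; rewrite ler_norml -mulrA; lra.
have ns n : s n.+1 <= s n.
  by rewrite /s E; have := H n; rewrite ler_norml -mulrA; lra.
have tmono : {homo t : m n / (m <= n)%N >-> m <= n} by apply: homo_leq => //; exact: le_trans.
have smono : {homo s : m n / (m <= n)%N >-> n <= m} by apply: homo_leq => // a b c ab bc; exact: le_trans bc ab.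
have ts m n : t m <= s n.
  apply: (@le_trans _ _ (t (maxn m n))); first by apply: tmono; rewrite leq_maxl.
  apply: (@le_trans _ _ (s (maxn m n))); last by apply: smono; rewrite leq_maxr.
  set k := maxn m n; have : 0 <= 2 * B / 2 ^+ k by rewrite divr_ge0 ?mulr_ge0// ltW.
  by rewrite /t /s; lra.
exists (sup (range t)) => n.
have tl : t n <= sup (range t) by apply: ub_le_sup; [exists (s 0%N) => _ [m _ <-]; exact: ts|exists n].
have ls : sup (range t) <= s n by apply: ge_sup; [exists (t 0%N); exists 0%N|move=> _ [m _ <-]; exact: ts].
by rewrite ler_norml; move: tl ls; rewrite /t /s; lra.
Qed.

End Primitive.

(** * Linear initial value problems on the whole line *)

Section InitialValueProblem.
Context {R : realType}.
Implicit Types (f g u v q : R -> R) (x a b : R).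

Lemma eq_le_refl a b : a = b -> a <= b.
Proof. by move=> ->. Qed.

Lemma half_power_small (B e : R) : 0 < e -> exists n, B / 2 ^+ n < e.
Proof.
move=> e0; have [B0|B0] := leP B 0.
  by exists 0%N; rewrite expr0 divr1 (le_lt_trans B0).
exists (Num.bound (B / e)); rewrite ltr_pdivrMr ?exprn_gt0// mulrC -ltr_pdivrMr//.
apply: (@lt_trans _ _ (Num.bound (B / e))%:R); first exact/archi_boundP/divr_ge0/ltW/e0/ltW.
by rewrite -natrX ltr_nat ltn_expl.
Qed.

Lemma geometric_limit_unique (y : nat -> R) B B' l l' :
  (forall n, `|l - y n| <= 2 * B / 2 ^+ n) -> (forall n, `|l' - y n| <= 2 * B' / 2 ^+ n) ->
  l = l'.
Proof.
move=> H H'; apply/eqP; rewrite -subr_eq0 -normr_le0; apply/ler_addgt0Pr => e e0.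
have [n Hn] := half_power_small (2 * B + 2 * B') e0.
rewrite add0r (le_trans _ (ltW Hn))// mulrDl.
rewrite (_ : l - l' = (l - y n) - (l' - y n)); last by ring.
by rewrite (le_trans (ler_normB _ _))// lerD.
Qed.

Lemma dist_limit_continuous (y : nat -> R -> R) (Y : R -> R) :
  (forall n, continuous (y n)) ->
  (forall b, exists B, forall n x, - b <= x <= b -> `|Y x - y n x| <= 2 * B / 2 ^+ n) ->
  continuous Y.
Proof.
move=> yc H x; have [B HB] := H (`|x| + 1).
apply/cvgrPdist_le => e e0; have e3 : 0 < e / 3 by rewrite divr_gt0.
have [n Hn] := half_power_small (2 * B) e3.
have near_x : \forall t \near x, `|x - t| < 1.
  by have /cvgrPdist_lt := @cvg_id _ (nbhs x); apply.
have near_y : \forall t \near x, `|y n x - y n t| < e / 3.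
  by have /cvgrPdist_lt := yc n x; apply.
near=> t.
have xt : `|x - t| < 1 by near: t.
have yt : `|y n x - y n t| < e / 3 by near: t.
have xb : - (`|x| + 1) <= x <= `|x| + 1.
  by have := ler_norm x; have := ler_norm (- x); rewrite normrN; lra.
have tb : - (`|x| + 1) <= t <= `|x| + 1.
  by move: xt; rewrite ltr_norml; have := ler_norm x; have := ler_norm (- x); rewrite normrN; lra.
have := HB n x xb; have := HB n t tb; rewrite !ler_norml; move: yt; rewrite ltr_norml.
by lra.
Unshelve. all: by end_near. Qed.

(** Picard iteration. Two integrations divide [cosh (K x)] by [K ^+ 2]; with [K ^+ 2 >= 2 * M],
    where [M] bounds [|q|] on [[- b, b]], each step halves the error measured against [cosh (K x)],
    whatever the size of [b]. *)
Lemma ivp_exists0 q a d : continuous q -> exists u v,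
  [/\ u 0 = a, v 0 = d, forall x, is_derive x 1 u (v x) & forall x, is_derive x 1 v (q x * u x)].
Proof.
move=> qc.
pose w f := prim (fun x => q x * f x).
pose step f x := a + d * x + prim (w f) x.
have wP f : continuous f -> w f 0 = 0 /\ forall x, is_derive x 1 (w f) (q x * f x).
  by move=> fc; apply: primP => x; apply: continuousM; [exact: qc|exact: fc].
have stepP f : continuous f -> step f 0 = a /\ forall x, is_derive x 1 (step f) (d + w f x).
  move=> /wP[_ wd]; have [p0 pd] := primP (deriv_continuous wd).
  split; first by rewrite /step p0; ring.
  by move=> x; rewrite /step; dsolve; ring.
pose y n := iter n step (fun x => a + d * x).
have y0d x : is_derive x 1 (y 0%N) d by rewrite /y/=; dsolve; ring.
have yS n : y n.+1 = step (y n) by [].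
clearbody y.
have yc n : continuous (y n).
  elim: n => [|n IH]; first exact: (@deriv_continuous _ _ (fun=> d)).
  by rewrite yS; have [_] := stepP _ IH; exact: deriv_continuous.
have dy n x : is_derive x 1 (y n.+1) (d + w (y n) x).
  by rewrite yS; exact: (stepP _ (yc n)).2.
have y_at0 n : y n.+1 0 = a by rewrite yS; exact: (stepP _ (yc n)).1.
pose ch K x : R := (expR (K * x) + expR (- (K * x))) / 2.
pose sh K x : R := (expR (K * x) - expR (- (K * x))) / 2.
have chd K x : is_derive x 1 (ch K) (K * sh K x) by rewrite /ch /sh; dsolve; ring.
have shd K x : is_derive x 1 (sh K) (K * ch K x) by rewrite /ch /sh; dsolve; ring.
have ch1 K x : 1 <= ch K x.
  rewrite /ch expRN; set e := expR _; have e0 : 0 < e := expR_gt0 _.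
  rewrite ler_pdivlMr// mul1r -subr_ge0 (_ : _ - _ = (e - 1) ^+ 2 / e) ?divr_ge0 ?sqr_ge0 ?(ltW e0)//.
  by field; rewrite gt_eqF.
have step_bound b : exists B, forall n x, - b <= x <= b -> `|y n.+1 x - y n x| <= B / 2 ^+ n.
  have [M M0 qM] := continuous_bounded b qc.
  have [C C0 yC] : exists2 C, 0 < C & forall x, - b <= x <= b -> `|y 1%N x - y 0%N x| <= C.
    apply: (@continuous_bounded _ (fun x => y 1%N x - y 0%N x)) => x.
    by apply: continuousB; exact: yc.
  pose K := 1 + 2 * M.
  have KM : M <= K ^+ 2 / 2 by rewrite /K; nra.
  have key n x : - b <= x <= b -> `|y n.+1 x - y n x| <= C / 2 ^+ n * ch K x.
    elim: n x => [|n IH] x xb.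
      by rewrite expr0 divr1 (le_trans (yC x xb))// ler_peMr// ltW.
    have d1 := dy n.+1; have d0 := dy n.
    have [w1 e1] := wP _ (yc n.+1); have [w0 e0] := wP _ (yc n).
    have p2 : 0 < 2 ^+ n.+1 :> R by rewrite exprn_gt0.
    pose A := C / 2 ^+ n.+1.
    have Z1 (t : R) : is_derive t 1 (fun x => y n.+2 x - y n.+1 x) (w (y n.+1) t - w (y n) t).
      by dsolve; ring.
    have Z2 (t : R) : is_derive t 1 (fun x => w (y n.+1) x - w (y n) x) (q t * (y n.+1 t - y n t)).
      by dsolve; ring.
    have Z3 (t : R) : is_derive t 1 (fun x => A * ch K x) (A * (K * sh K t)).
      by dsolve; ring.
    have Z4 (t : R) : is_derive t 1 (fun x => A * (K * sh K x)) (A * (K * (K * ch K t))).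
      by dsolve; ring.
    apply: (second_order_comparison Z1 Z2 Z3 Z4 _ _ _ _ _ xb).
    - by rewrite !y_at0 subrr.
    - by rewrite w1 w0 subrr.
    - by apply: mulr_ge0; [apply/ltW/divr_gt0|exact: le_trans ler01 (ch1 K 0)].
    - by rewrite /sh mulr0 oppr0 subrr mul0r mulr0 mulr0.
    - move=> t tb; rewrite normrM.
      have h1 := IH t tb; have h2 := qM t tb; have h3 := ch1 K t.
      apply: (@le_trans _ _ ((K ^+ 2 / 2) * (C / 2 ^+ n * ch K t))).
        by apply: ler_pM => //; exact: le_trans KM.
      by apply: eq_le_refl; rewrite /A [2 ^+ n.+1]exprS; field; rewrite gt_eqF ?exprn_gt0.
  exists (C * ((expR (K * b) + expR (K * b)) / 2)) => n x xb.
  rewrite (le_trans (key n x xb))// mulrAC ler_wpM2r ?invr_ge0 ?exprn_ge0//.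
  have K0 : 0 < K by rewrite /K; lra.
  by rewrite ler_wpM2l ?(ltW C0)// /ch ler_pM2r ?invr_gt0// lerD ?ler_expR//; nra.
have [Y YP] : exists Y : R -> R, forall b, exists B, forall n x, - b <= x <= b -> `|Y x - y n x| <= 2 * B / 2 ^+ n.
  have lx x : exists l, exists B, forall n, `|l - y n x| <= 2 * B / 2 ^+ n.
    have [B HB] := step_bound `|x|.
    have [|l Hl] := @geometric_limit R (fun n => y n x) B; last by exists l, B.
    by move=> n; apply: HB; have := ler_norm x; have := ler_norm (- x); rewrite normrN; lra.
  exists (fun x => sval (cid (lx x))) => b; have [B HB] := step_bound b.
  exists B => n x xb; case: cid => l /= [B' Hl].
  have [l' Hl'] := @geometric_limit R (fun n => y n x) B (fun n => HB n x xb).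
  by rewrite (geometric_limit_unique Hl Hl').
have Yc : continuous Y := dist_limit_continuous yc YP.
have [S0 dS] := stepP _ Yc; have [W0 dW] := wP _ Yc.
(* Comparison with a multiple of [x ^+ 2 / 2] shows that [step Y] is a geometric limit of the same
   sequence [y n.+1] as [Y], so both limits agree. *)
have YE : step Y = Y.
  apply/funext => x; have [B HB] := YP `|x|; have [M M0 qM] := continuous_bounded `|x| qc.
  have xx : - `|x| <= x <= `|x| by have := ler_norm x; have := ler_norm (- x); rewrite normrN; lra.
  have key n : `|step Y x - y n.+1 x| <= (M * (2 * B / 2 ^+ n)) * (x ^+ 2 / 2).
    have d0 := dy n; have [w0 e0] := wP _ (yc n).
    pose A := M * (2 * B / 2 ^+ n).
    have Z1 (t : R) : is_derive t 1 (fun x => step Y x - y n.+1 x) (w Y t - w (y n) t).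
      by dsolve; ring.
    have Z2 (t : R) : is_derive t 1 (fun x => w Y x - w (y n) x) (q t * (Y t - y n t)).
      by dsolve; ring.
    have Z3 (t : R) : is_derive t 1 (fun x => A * (x ^+ 2 / 2)) (A * t).
      by dsolve; field.
    have Z4 (t : R) : is_derive t 1 (fun x => A * x) A.
      by dsolve; ring.
    apply: (second_order_comparison Z1 Z2 Z3 Z4 _ _ _ _ _ xx).
    - by rewrite y_at0 S0 subrr.
    - by rewrite W0 w0 subrr.
    - by rewrite expr0n/= mul0r mulr0.
    - by rewrite mulr0.
    - by move=> t tb; rewrite normrM ler_pM// ?qM ?HB.
  apply: (@geometric_limit_unique (fun n => y n.+1 x) (M * B * (x ^+ 2 / 2)) B) => n.
    apply: (le_trans (key n)); apply: eq_le_refl; field.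
    by rewrite gt_eqF ?exprn_gt0.
  apply: (le_trans (HB n.+1 x xx)).
  have B0 : 0 <= 2 * B by have := HB 0%N x xx; rewrite expr0 divr1; apply: le_trans.
  by rewrite ler_wpM2l// lef_pV2 ?posrE ?exprn_gt0// exprS ler_peMl ?exprn_ge0// ler1n.
exists Y, (fun x => d + w Y x); split.
- by rewrite -YE.
- by rewrite W0 addr0.
- by move=> x; rewrite -{1}YE.
- by move=> x; dsolve; ring.
Qed.

Lemma ivp_exists q b a d : continuous q -> exists u v,
  [/\ u b = a, v b = d, forall x, is_derive x 1 u (v x) & forall x, is_derive x 1 v (q x * u x)].
Proof.
move=> qc; have [|u [v [u0 v0 du dv]]] := @ivp_exists0 (fun x => q (x + b)) a d.
  by move=> x; apply: continuous_comp; [apply: continuousD; [exact: cvg_id|exact: cvg_cst]|exact: qc].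
exists (fun x => u (x - b)), (fun x => v (x - b)); rewrite subrr; split => // x.
- by eapply is_derive_eq; [eapply is_derive_compf; [exact: du|repeat dstep] | cbv beta; ring].
- by eapply is_derive_eq; [eapply is_derive_compf; [exact: dv|repeat dstep] | cbv beta; rewrite subrK; ring].
Qed.

End InitialValueProblem.

(** * Solutions of u'' = q u *)

Section SecondOrderSolutions.
Context {R : realType}.
Implicit Types (f g u v w z q h c s : R -> R) (x y a b X t : R).

Definition solves q u v :=
  (forall x, is_derive x 1 u (v x)) /\ (forall x, is_derive x 1 v (q x * u x)).

Lemma solves_lin q u v u' v' (l m : R) : solves q u v -> solves q u' v' ->
  solves q (fun x => l * u x + m * u' x) (fun x => l * v x + m * v' x).
Proof. by move=> [? ?] [? ?]; split => x; dsolve; ring. Qed.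

(** Adding the constant [H ^+ 2] to [w ^+ 2 + z ^+ 2] absorbs the forcing: the sum has derivative at
    most [2 + M] times itself. *)
Lemma gronwall_forward w z q h (M H a b : R) : a <= b -> 0 <= M ->
  (forall x, is_derive x 1 w (z x)) -> (forall x, is_derive x 1 z (q x * w x + h x)) ->
  (forall x, a <= x <= b -> `|q x| <= M) -> (forall x, a <= x <= b -> `|h x| <= H) ->
  w b ^+ 2 + z b ^+ 2 + H ^+ 2 <= expR ((2 + M) * (b - a)) * (w a ^+ 2 + z a ^+ 2 + H ^+ 2).
Proof.
move=> ab M0 dw dz qM hH.
pose G x := (w x ^+ 2 + z x ^+ 2 + H ^+ 2) * expR (- ((2 + M) * (x - a))).
have dG x : is_derive x 1 G ((2 * w x * z x + 2 * z x * (q x * w x + h x)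
   - (2 + M) * (w x ^+ 2 + z x ^+ 2 + H ^+ 2)) * expR (- ((2 + M) * (x - a)))).
  by rewrite /G; dsolve; ring.
have : G b <= G a.
  apply: (gderiv_le0_le ab (fun x _ => dG x)) => x xab.
  rewrite pmulr_lle0 ?expR_gt0//.
  have := qM x xab; have := hH x xab; rewrite !ler_norml => h1 q1.
  have h2 : h x ^+ 2 <= H ^+ 2 by nra.
  have q2 : 2 * z x * (q x * w x) <= M * (w x ^+ 2 + z x ^+ 2).
    have E1 := sqr_ge0 (z x + w x); have E2 := sqr_ge0 (z x - w x).
    rewrite -subr_ge0 (_ : _ - _ = (M - q x) / 2 * (z x + w x) ^+ 2 + (M + q x) / 2 * (z x - w x) ^+ 2); last by field.
    by rewrite addr_ge0// mulr_ge0//; lra.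
  have E3 := sqr_ge0 (z x - w x); have E4 := sqr_ge0 (z x - h x).
  have E5 := sqr_ge0 (w x); have E6 : 0 <= M * H ^+ 2 by rewrite mulr_ge0 ?sqr_ge0.
  have E7 := sqr_ge0 H; nra.
rewrite /G subrr mulr0 oppr0 expR0 mulr1 expRN => Hb.
by rewrite mulrC -ler_pdivrMr ?expR_gt0.
Qed.

Lemma is_derive_reflect f x a : is_derive (- x) 1 f a -> is_derive x 1 (fun y => f (- y)) (- a).
Proof.
move=> fa; have H := is_derive_compf fa (is_deriveNf (is_derive_idf x)).
by apply: (is_derive_eq H); ring.
Qed.

Lemma solves_reflect q u v : solves q u v ->
  solves (fun x => q (- x)) (fun x => u (- x)) (fun x => - v (- x)).
Proof.
move=> [du dv]; split => x.
- exact: is_derive_reflect.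
- by have H := is_deriveNf (is_derive_reflect (dv (- x))); apply: (is_derive_eq H); ring.
Qed.

Lemma gronwall_backward w z q h (M H a b : R) : a <= b -> 0 <= M ->
  (forall x, is_derive x 1 w (z x)) -> (forall x, is_derive x 1 z (q x * w x + h x)) ->
  (forall x, a <= x <= b -> `|q x| <= M) -> (forall x, a <= x <= b -> `|h x| <= H) ->
  w a ^+ 2 + z a ^+ 2 + H ^+ 2 <= expR ((2 + M) * (b - a)) * (w b ^+ 2 + z b ^+ 2 + H ^+ 2).
Proof.
move=> ab M0 dw dz qM hH.
have dw' x : is_derive x 1 (fun x => w (- x)) (- z (- x)).
  exact: is_derive_reflect.
have dz' x : is_derive x 1 (fun x => - z (- x)) (q (- x) * w (- x) + h (- x)).
  by have H1 := is_deriveNf (is_derive_reflect (dz (- x))); apply: (is_derive_eq H1); ring.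
have := @gronwall_forward _ _ (fun x => q (- x)) (fun x => h (- x)) M H (- b) (- a) _ M0 dw' dz'.
rewrite !opprK !sqrrN (addrC (- a)) => ->//; first by rewrite lerN2.
  by move=> x xab; apply: qM; lra.
by move=> x xab; apply: hH; lra.
Qed.

Lemma solves_unique q u v b : continuous q -> solves q u v -> u b = 0 -> v b = 0 ->
  forall x, u x = 0 /\ v x = 0.
Proof.
move=> qc [du dv] ub vb x.
have [M M0 qM] := continuous_bounded (`|b| + `|x|) qc.
have dv' t : is_derive t 1 v (q t * u t + 0) by rewrite addr0; exact: dv.
have [b1 x1] := (lexx `|b|, lexx `|x|); rewrite !ler_norml in b1 x1.
suff h : u x ^+ 2 + v x ^+ 2 <= 0.
  have u2 := sqr_ge0 (u x); have v2 := sqr_ge0 (v x).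
  by split; apply/eqP; rewrite -sqrf_eq0 eq_le ?u2 ?v2 andbT; lra.
have [bx|/ltW xb] := leP b x.
- have := @gronwall_forward u v q (fun=> 0) M 0 b x bx (ltW M0) du dv'.
  by rewrite ub vb !expr0n/= !addr0 mulr0; apply => t tx; [apply: qM; lra|rewrite normr0].
- have := @gronwall_backward u v q (fun=> 0) M 0 x b xb (ltW M0) du dv'.
  by rewrite ub vb !expr0n/= !addr0 mulr0; apply => t tx; [apply: qM; lra|rewrite normr0].
Qed.

(* If [q >= 0] then [u v] is nondecreasing, hence [u ^+ 2] is minimal at a
   critical point of [u]. *)
Lemma solves_ge1 q u v X x : (forall y, X <= y -> 0 <= q y) -> solves q u v ->
  X <= x -> u x = 1 -> v x = 0 -> forall y, X <= y -> 1 <= u y /\ (x <= y -> 0 <= v y).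
Proof.
move=> q0 [du dv] Xx ux vx.
have duv y : is_derive y 1 (fun y => u y * v y) (v y ^+ 2 + q y * u y ^+ 2).
  by dsolve; ring.
have duv0 y : X <= y -> 0 <= v y ^+ 2 + q y * u y ^+ 2.
  by move=> Xy; rewrite addr_ge0 ?sqr_ge0// mulr_ge0 ?q0 ?sqr_ge0.
have duu y : is_derive y 1 (fun y => u y ^+ 2) (2 * (u y * v y)).
  by dsolve; ring.
have uv_ge y : x <= y -> 0 <= u y * v y.
  move=> xy; rewrite -[X in X <= _](mulr0 (u x)) -vx.
  apply: (gderiv_ge0_le xy (fun t _ => duv t)) => t /andP[xt _].
  by apply: duv0; exact: le_trans xt.
have uv_le y : X <= y -> y <= x -> u y * v y <= 0.
  move=> Xy yx; rewrite -[X in _ <= X](mulr0 (u x)) -vx.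
  apply: (gderiv_ge0_le yx (fun t _ => duv t)) => t /andP[xt _].
  by apply: duv0; exact: le_trans xt.
have uu y : X <= y -> 1 <= u y ^+ 2.
  move=> Xy; rewrite -[X in X <= _](expr1n R 2) -ux.
  have [xy|/ltW yx] := leP x y.
    apply: (gderiv_ge0_le xy (fun t _ => duu t)) => t /andP[xt _].
    by rewrite mulr_ge0// uv_ge.
  apply: (gderiv_le0_le yx (fun t _ => duu t)) => t /andP[yt tx].
  by rewrite mulr_ge0_le0// uv_le// (le_trans Xy).
have upos y : X <= y -> 0 < u y.
  move=> Xy; rewrite ltNge; apply/negP => uy.
  have uc : continuous u := deriv_continuous du.
  have [t [Xt ut]] : exists t, X <= t /\ u t = 0.
    have [xy|/ltW yx] := leP x y.
      have [|t] := @IVT _ u x y 0 xy (continuous_subspaceT uc).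
        by rewrite ux ge_min uy orbT le_max ler01.
      by rewrite in_itv/= => /andP[xt _] ?; exists t; split => //; lra.
    have [|t] := @IVT _ u y x 0 yx (continuous_subspaceT uc).
      by rewrite ux ge_min uy le_max ler01 orbT.
    by rewrite in_itv/= => /andP[xt _] ?; exists t; split => //; lra.
  by have := uu t Xt; rewrite ut expr0n/= ler10.
move=> y Xy; split; last by move=> xy; have := uv_ge y xy; rewrite pmulr_rge0// upos.
by have := uu y Xy; have := upos y Xy; nra.
Qed.

Lemma wronskian_const q u v u' v' x y : solves q u v -> solves q u' v' ->
  u x * v' x - v x * u' x = u y * v' y - v y * u' y.
Proof.
move=> [du dv] [du' dv'].
by apply: (@gderiv_eq0 _ (fun x => u x * v' x - v x * u' x)) => t; dsolve; ring.
Qed.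

(** With [c] and [s] the solutions of data [(1, 0)] and [(0, 1)] at [X], the solution is [c - l * s]
    for [l] the infimum of [c / s] on the right of [X]. Then [u >= 0] says [l <= c / s], and
    [v <= 0] says [c' / s' <= l]. *)
Lemma decaying_exists q X b : continuous q -> (forall y, X <= y -> 0 <= q y) ->
  X <= b -> (forall y, b <= y -> 0 < q y) ->
  exists u v, solves q u v /\ (forall x, X <= x -> 0 < u x /\ v x < 0).
Proof.
move=> qc q0 Xb qb.
have [c [c' [cX c'X dc dc']]] := ivp_exists X 1 0 qc.
have [s [s' [sX s'X ds ds']]] := ivp_exists X 0 1 qc.
have Sc : solves q c c' by [].
have Ss : solves q s s' by [].
have cP y : X <= y -> 1 <= c y /\ 0 <= c' y.
  by move=> Xy; have [c1 c2] := solves_ge1 q0 Sc (lexx X) cX c'X Xy; split => //; exact: c2.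
have W y : c y * s' y - c' y * s y = 1.
  by rewrite (wronskian_const y X Sc Ss) cX c'X sX s'X; ring.
have s0 y : X < y -> 0 < s y.
  move=> Xy; have cy x : X <= x -> 0 < c x by move=> /cP[? _]; lra.
  have : s X / c X < s y / c y.
    have D x : X <= x -> is_derive x 1 (fun x => s x / c x) ((c x ^+ 2)^-1).
      move=> Xx; have cx : c x != 0 by rewrite gt_eqF// cy.
      dsolve => //; rewrite -[RHS]mul1r -[X in _ = X * _](W x); field.
      by rewrite cx.
    apply: (@deriv_gt0_lt _ (fun x => s x / c x) (fun x => (c x ^+ 2)^-1) _ _ Xy) => x /andP[Xx _].
    - exact: is_derive_cts (D x Xx).
    - exact: D (ltW Xx).
    - by rewrite invr_gt0 exprn_gt0// cy// ltW.
  by rewrite sX mul0r pmulr_lgt0// invr_gt0 cy// ltW.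
have s'0 y : X <= y -> 0 < s' y.
  move=> Xy; have [c1 c2] := cP y Xy; have := W y.
  have : 0 <= s y by move: Xy; rewrite le_eqVlt => /predU1P[<-|/s0/ltW//]; rewrite sX.
  move=> sy Wy; have : 0 < c y * s' y by have := mulr_ge0 c2 sy; lra.
  by rewrite pmulr_rgt0//; lra.
(* The combination [s' x * c - c' x * s] has value 1 and derivative 0 at [x], so it stays at least 1
   on the whole of [[X, oo)]. *)
have key x y : X <= x -> X < y -> c' x / s' x <= c y / s y.
  move=> Xx Xy.
  have S3 := solves_lin (s' x) (- c' x) Sc Ss.
  have [] := solves_ge1 q0 S3 Xx _ _ (ltW Xy).
  - by rewrite -[RHS](W x); ring.
  - by ring.
  move=> H _; rewrite ler_pdivrMr ?s'0// mulrAC ler_pdivlMr ?s0//; lra.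
pose T := [set c y / s y | y in [set y | X < y]].
have Tlb : has_lbound T by exists (c' X / s' X) => _ [y Xy <-]; exact: key.
have Tne : T !=set0 by exists (c (X + 1) / s (X + 1)), (X + 1) => //=; lra.
pose l := inf T.
have lc x : X < x -> l <= c x / s x by move=> Xx; apply: ge_inf => //; exists x.
have lc' x : X <= x -> c' x / s' x <= l.
  by move=> Xx; apply: lb_le_inf => // _ [y Xy <-]; exact: key.
pose u x := 1 * c x + (- l) * s x; pose v x := 1 * c' x + (- l) * s' x.
have Su : solves q u v by exact: solves_lin.
have [du dv] := Su.
have u_ge0 x : X <= x -> 0 <= u x.
  rewrite le_eqVlt => /predU1P[<-|Xx]; first by rewrite /u cX sX; lra.
  by have := lc x Xx; rewrite ler_pdivlMr ?s0// /u; lra.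
have v_le0 x : X <= x -> v x <= 0.
  by move=> Xx; have := lc' x Xx; rewrite ler_pdivrMr ?s'0// /v; lra.
have udec x y : X <= x -> x <= y -> u y <= u x.
  move=> Xx xy; apply: (gderiv_le0_le xy (fun t _ => du t)) => t /andP[xt _].
  by apply: v_le0; lra.
have u_gt0 x : X <= x -> 0 < u x.
  move=> Xx; rewrite lt_neqAle u_ge0// andbT eq_sym; apply/negP => /eqP ux.
  have uy y : x <= y -> u y = 0.
    by move=> xy; apply/eqP; rewrite eq_le u_ge0 ?(le_trans Xx)// andbT -ux udec.
  have vy y : x <= y -> v y < 0.
    move=> xy; have Wu : u y * s' y - v y * s y = 1.
      by rewrite (wronskian_const y X Su Ss) /u /v cX c'X sX s'X; ring.
    rewrite lt_neqAle v_le0 ?(le_trans Xx)// andbT; apply/negP => /eqP vy.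
    by move: Wu; rewrite vy uy//; lra.
  have : - u x < - u (x + 1).
    have du' t : is_derive t 1 (fun t => - u t) (- v t) by dsolve.
    apply: (deriv_gt0_lt _ (fun t _ => is_derive_cts (du' t)) (fun t _ => du' t)); first by lra.
    by move=> t /andP[xt _]; rewrite oppr_gt0 vy// ltW.
  by rewrite ux uy; lra.
exists u, v; split=> // x Xx; split; first exact: u_gt0.
rewrite lt_neqAle v_le0// andbT; apply/negP => /eqP vx.
(* If [v x = 0], then [v] is nondecreasing from [x] on and strictly increasing beyond [b], where
   [q > 0]; it would become positive. *)
pose y := Num.max x b.
have [xy by_] : x <= y /\ b <= y by rewrite !le_max !lexx orbT.
have v_y : v x <= v y.
  apply: (gderiv_ge0_le xy (fun t _ => dv t)) => t /andP[xt _].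
  by apply: mulr_ge0; [apply: q0; lra|apply: u_ge0; lra].
have : v y < v (y + 1).
  apply: (deriv_gt0_lt _ (fun t _ => is_derive_cts (dv t)) (fun t _ => dv t)); first by lra.
  by move=> t /andP[yt _]; apply: mulr_gt0; [apply: qb; lra|apply: u_gt0; lra].
by have := v_le0 (y + 1); lra.
Qed.

(** Otherwise [v + k * u] is positive at some point; since [(v + k * u) * expR (- k x)] is
    nondecreasing, [v + k * u] then grows exponentially, although [v < 0] and [u] is bounded by its
    value at that point. *)
Lemma decaying_log_derivative q u v b (k : R) : 0 < k -> solves q u v ->
  (forall x, b <= x -> k ^+ 2 <= q x) -> (forall x, b <= x -> 0 < u x /\ v x < 0) ->
  forall x, b <= x -> v x <= - k * u x.
Proof.
move=> k0 [du dv] qk uv x bx; rewrite leNgt; apply/negP => H.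
pose g y := (v y + k * u y) * expR (- (k * y)).
have dg y : is_derive y 1 g ((q y - k ^+ 2) * u y * expR (- (k * y))).
  by rewrite /g; dsolve; ring.
have gx : 0 < g x by rewrite /g mulr_gt0 ?expR_gt0//; lra.
have ge y : x <= y -> g x <= g y.
  move=> xy; apply: (gderiv_ge0_le xy (fun t _ => dg t)) => t /andP[xt _].
  have bt : b <= t by lra.
  by rewrite !mulr_ge0 ?expR_ge0// ?subr_ge0 ?qk// ltW// (uv t bt).1.
have udec y : x <= y -> u y <= u x.
  move=> xy; apply: (gderiv_le0_le xy (fun t _ => du t)) => t /andP[xt _].
  by apply/ltW; apply: (uv t _).2; lra.
have ux : 0 < u x := (uv x bx).1.
pose y := `|x| + u x / g x.
have xy : x <= y.
  by have := ler_norm x; have : 0 < u x / g x by [exact: divr_gt0]; rewrite /y; lra.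
have h1 : g x * expR (k * y) <= v y + k * u y.
  have := ge y xy; rewrite {2}/g expRN => h1.
  by rewrite -ler_pdivlMr ?expR_gt0.
have h2 : 1 + k * y <= expR (k * y) by exact: expR_ge1Dx.
have vy : v y < 0 by apply: (uv y _).2; lra.
have h3 : g x * (k * y) <= g x * expR (k * y) by rewrite ler_pM2l//; lra.
have h4 : k * u x <= g x * (k * y).
  have -> : k * u x = g x * (k * (u x / g x)) by field; rewrite gt_eqF.
  by rewrite ler_pM2l// ler_pM2l// /y lerDr.
have h5 : k * u y <= k * u x by rewrite ler_pM2l// udec.
by lra.
Qed.

Lemma decaying_exp_bound u v b (k : R) : (forall x, is_derive x 1 u (v x)) ->
  (forall x, b <= x -> v x <= - k * u x) ->
  forall x, b <= x -> u x <= u b * expR (- (k * (x - b))).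
Proof.
move=> du H x bx.
have dg y : is_derive y 1 (fun y => u y * expR (k * (y - b))) ((v y + k * u y) * expR (k * (y - b))).
  by dsolve; ring.
have : u x * expR (k * (x - b)) <= u b * expR (k * (b - b)).
  apply: (gderiv_le0_le bx (fun t _ => dg t)) => t /andP[bt _].
  by rewrite pmulr_lle0 ?expR_gt0//; have := H t bt; lra.
by rewrite subrr mulr0 expR0 mulr1 expRN -ler_pdivlMr ?expR_gt0.
Qed.

(** Such a [J] stands for the integral of [u ^+ 2] from 0; half-line L^2 norms are treated as
    suprema of these primitives. *)
Lemma sqr_primitive_exists u v : (forall x, is_derive x 1 u (v x)) ->
  exists J : R -> R, J 0 = 0 /\ forall x, is_derive x 1 J (u x ^+ 2).
Proof. by move=> du; apply: primitive_exists => x; exact: (is_derive_cts (is_deriveXf 1 (du x))). Qed.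

Lemma sqr_primitive_le u (J : R -> R) x y : (forall x, is_derive x 1 J (u x ^+ 2)) -> x <= y -> J x <= J y.
Proof. by move=> dJ xy; apply: (gderiv_ge0_le xy (fun t _ => dJ t)) => t _; exact: sqr_ge0. Qed.

End SecondOrderSolutions.

(** * Potentials on a half line and their decaying solutions *)

Section HalfLinePotential.
Context {R : realType}.
Implicit Types (u v J V : R -> R) (x y b X t E : R) (K : nat).

(** Satisfied by both [V] and its reflection. [K] is a natural number so that the scaling laws
    involve ordinary powers; [V] is differentiable only off 0, where its derivative may blow up. *)
Definition half_line_potential K V := [/\ (0 < K)%N, continuous V, V 0 = 0 &
  forall x, 0 < x -> [/\ 0 < V x, is_derive x 1 V (derive1 V x),
    V x <= K%:R * (x * derive1 V x) & x * derive1 V x <= K%:R * V x]].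

(** The logarithmic derivative of [W] is at least [1 / (K x)]; the power [K] avoids a fractional
    exponent of [x]. Only points of [(0, oo)] occur, so that the bound is available before
    continuity at 0 is known. *)
Lemma power_ratio_le K (W : R -> R) (x y : R) : (0 < K)%N -> (forall t, 0 < t -> [/\ 0 < W t, is_derive t 1 W (derive1 W t),
    W t <= K%:R * (t * derive1 W t) & t * derive1 W t <= K%:R * W t]) ->
  0 < x -> x <= y -> W x ^+ K / x <= W y ^+ K / y.
Proof.
case: K => // k _ WP x0 xy.
have D t : 0 < t -> is_derive t 1 (fun t => W t ^+ k.+1 / t) (W t ^+ k * (k.+1%:R * (t * derive1 W t) - W t) / t ^+ 2).
  move=> t0; have [_ dW _ _] := WP t t0; dsolve; first by rewrite gt_eqF.
  by rewrite !exprS; field; rewrite gt_eqF.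
apply: (gderiv_ge0_le xy (fun t ht => D t _)) => t /andP[xt _]; first exact: lt_le_trans xt.
have [Wt _ H _] := WP t (lt_le_trans x0 xt).
by rewrite divr_ge0 ?sqr_ge0// mulr_ge0 ?exprn_ge0 ?subr_ge0// ltW.
Qed.

Section Potential.
Context {K : nat} {V : R -> R} (PV : half_line_potential K V).

Let K0 : (0 : R) < K%:R. Proof. by case: PV => K0 _ _ _; rewrite ltr0n. Qed.
Let Vc : continuous V. Proof. by case: PV. Qed.
Let V0 : V 0 = 0. Proof. by case: PV. Qed.
Let VP x : 0 < x -> [/\ 0 < V x, is_derive x 1 V (derive1 V x),
    V x <= K%:R * (x * derive1 V x) & x * derive1 V x <= K%:R * V x].
Proof. by case: PV => _ _ _ H; exact: H. Qed.

Let le_exprK (l : R) : 1 <= l -> l <= l ^+ K.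
Proof.
by case: PV => + _ _ _; case: K => // n _ l1; rewrite exprS ler_peMr ?exprn_ege1// (le_trans ler01).
Qed.

Lemma potential_deriv_gt0 x : 0 < x -> 0 < derive1 V x.
Proof.
move=> x0; have [Vx _ + _] := VP x0.
by move=> /(lt_le_trans Vx); rewrite pmulr_rgt0// pmulr_rgt0.
Qed.

Lemma potential_lt x y : 0 <= x -> x < y -> V x < V y.
Proof.
move=> x0 xy; apply: (@deriv_gt0_lt _ V (derive1 V) _ _ xy) => [t _|t /andP[xt _]|t /andP[xt _]].
- exact: Vc.
- have t0 : 0 < t by lra.
  by have [] := VP t0.
- by apply: potential_deriv_gt0; lra.
Qed.

Lemma potential_le x y : 0 <= x -> x <= y -> V x <= V y.
Proof. by move=> x0; rewrite le_eqVlt => /predU1P[->//|xy]; exact/ltW/potential_lt. Qed.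

Lemma potential_ge0 x : 0 <= x -> 0 <= V x.
Proof. by move=> x0; rewrite -V0 potential_le. Qed.

Lemma potential_le_inv x y : 0 <= x -> 0 <= y -> V x <= V y -> x <= y.
Proof. by move=> x0 y0; apply: contraTT; rewrite -!ltNge => yx; rewrite potential_lt. Qed.

Lemma potential_scale_le (l x : R) : 1 <= l -> 0 < x -> V (l * x) <= l ^+ K * V x.
Proof.
case: PV => + _ _ _; case: K K0 VP => [//|k] k0 VP' _ l1 x0.
have D y : 0 < y -> is_derive y 1 (fun y => V y / y ^+ k.+1) ((y * derive1 V y - k.+1%:R * V y) / y ^+ k.+2).
  move=> y0; have [_ dV _ _] := VP' y y0; dsolve.
    by rewrite gt_eqF// exprn_gt0.
  by rewrite !exprS; field; rewrite expf_neq0 gt_eqF.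
have xl : x <= l * x by rewrite ler_peMl// ltW.
have l0 : 0 < l by lra.
have : V (l * x) / (l * x) ^+ k.+1 <= V x / x ^+ k.+1.
  apply: (gderiv_le0_le xl (fun t ht => D t _)) => t /andP[xt _]; first by lra.
  rewrite pmulr_lle0 ?invr_gt0 ?exprn_gt0; [|by lra..].
  by have [_ _ _] := VP' t (lt_le_trans x0 xt); rewrite subr_le0.
rewrite exprMn invfM mulrA ler_pM2r ?invr_gt0 ?exprn_gt0// ler_pdivrMr ?exprn_gt0//.
by rewrite (mulrC (V x)).
Qed.

Lemma potential_scale_ge (l x : R) : 1 <= l -> 0 < x -> l * V x <= V (l ^+ K * x).
Proof.
move=> l1 x0; have l0 : 0 < l := lt_le_trans ltr01 l1; have Kn : (0 < K)%N by case: PV.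
have lx0 : 0 < l ^+ K * x by rewrite mulr_gt0// exprn_gt0.
have xl : x <= l ^+ K * x by rewrite ler_peMl ?exprn_ege1// ltW.
have := power_ratio_le Kn VP x0 xl; rewrite invfM mulrA ler_pM2r ?invr_gt0// ler_pdivlMr ?exprn_gt0//.
have [Vx _ _ _] := VP x0; have [Vlx _ _ _] := VP lx0.
by rewrite mulrC -exprMn ler_pXn2r// ?nnegrE ?mulr_ge0// ltW.
Qed.

Lemma turning_point_exists E : 0 < E -> exists X, 0 < X /\ V X = E.
Proof.
move=> E0; have [V1 _ _ _] := VP ltr01.
pose l := 1 + E / V 1.
have l1 : 1 <= l by rewrite lerDl divr_ge0// ltW.
have lK : 0 <= l ^+ K * 1 by rewrite mulr1 exprn_ge0//; lra.
have [|X] := @IVT _ V 0 (l ^+ K * 1) E lK (continuous_subspaceT Vc).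
  rewrite V0 ge_min (ltW E0)/= le_max; apply/orP; right.
  apply: le_trans (potential_scale_ge l1 ltr01).
  by rewrite /l mulrDl mul1r divfK ?gt_eqF// lerDr ltW.
rewrite in_itv/= => /andP[X0 _] VX; exists X; split => //.
by rewrite lt_neqAle X0 andbT; apply/eqP => XE; move: E0; rewrite -VX -XE V0 ltxx.
Qed.

(** Decay is encoded by signs on the region [E <= V], which is the whole half line if [E <= 0].
    Exponential decay follows from these signs and the growth of [V]. No normalisation is
    imposed. *)
Definition decaying_solution E u v := solves (fun x => V x - E) u v /\
  forall x, 0 <= x -> E <= V x -> 0 < u x /\ v x < 0.

Lemma shifted_potential_continuous E : continuous (fun x => V x - E).
Proof. by move=> x; apply: continuousB; [exact: Vc|exact: cvg_cst]. Qed.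

Lemma decaying_solution_exists E : exists u v, decaying_solution E u v.
Proof.
have qc := @shifted_potential_continuous E.
have [E0|E0] := leP E 0.
  have [u [v [S uv]]] : exists u v, solves (fun x => V x - E) u v /\ forall x, 0 <= x -> 0 < u x /\ v x < 0.
    apply: (@decaying_exists _ _ 0 1) => // y y0.
      by have := potential_ge0 y0; lra.
    by have y0' : 0 < y by [lra]; have [? _ _ _] := VP y0'; lra.
  by exists u, v; split => // x x0 _; exact: uv.
have [X [X0 VX]] := turning_point_exists E0.
have [u [v [S uv]]] : exists u v, solves (fun x => V x - E) u v /\ forall x, X <= x -> 0 < u x /\ v x < 0.
  apply: (@decaying_exists _ _ X (X + 1)) => [//|y Xy||y Xy]; last 2 first.
  - by lra.
  - by have := @potential_lt X y; rewrite VX subr_gt0; apply; lra.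
  - by rewrite subr_ge0 -VX potential_le// ltW.
exists u, v; split => // x x0 Ex; apply: uv; apply: potential_le_inv => //; last by rewrite VX.
exact: ltW.
Qed.

(** * The energy of a decaying solution and its L^2 norm *)

Section Energy.
Context {E X k : R} {u v : R -> R}.
Hypotheses (k0 : 0 < k) (kE : k ^+ 2 = E) (X0 : 0 < X) (VX : V X = E).
Hypothesis S : decaying_solution E u v.

Let energy x := v x ^+ 2 + (E - V x) * u x ^+ 2.
Let E0 : 0 < E. Proof. by rewrite -kE exprn_gt0. Qed.
Let du x : is_derive x 1 u (v x). Proof. by case: S => -[]. Qed.
Let dv x : is_derive x 1 v ((V x - E) * u x). Proof. by case: S => -[]. Qed.
Let uv x : X <= x -> 0 < u x /\ v x < 0.
Proof.
move=> Xx; case: S => _; apply; first by apply: le_trans Xx; exact: ltW.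
by rewrite -VX potential_le// ltW.
Qed.

Let u_anti x y : X <= x -> x <= y -> u y <= u x.
Proof.
move=> Xx xy; apply: (gderiv_le0_le xy (fun t _ => du t)) => t /andP[xt _].
by have [_ /ltW] := uv (le_trans Xx xt).
Qed.

Let dE x : 0 < x -> is_derive x 1 energy (- derive1 V x * u x ^+ 2).
Proof. by move=> /VP[_ dV _ _]; rewrite /energy; dsolve; ring. Qed.

Let cE : continuous energy.
Proof.
move=> x.
have h1 : {for x, continuous (fun x => v x ^+ 2)}.
  exact: (is_derive_cts (is_deriveXf 1 (dv x))).
have h2 : {for x, continuous (fun x => u x ^+ 2)}.
  exact: (is_derive_cts (is_deriveXf 1 (du x))).
have h3 := @shifted_potential_continuous E x.
have h4 : {for x, continuous (fun x => v x ^+ 2 - (V x - E) * u x ^+ 2)}.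
  by apply: continuousB => //; apply: continuousM.
rewrite (_ : energy = fun x => v x ^+ 2 - (V x - E) * u x ^+ 2)//.
by apply/funext => y; rewrite /energy; ring.
Qed.

Let energy_dec x y : 0 <= x -> x <= y -> energy y <= energy x.
Proof.
move=> x0 xy; apply: (@deriv_le0_le _ energy (fun x => - derive1 V x * u x ^+ 2) _ _ xy) => [t _|t /andP[xt _]|t /andP[xt _]].
- exact: cE.
- by apply: dE; lra.
- by rewrite mulNr oppr_le0 mulr_ge0 ?sqr_ge0// ltW// potential_deriv_gt0//; lra.
Qed.

(* A negative energy would make [u v] grow linearly. *)
Lemma energy_ge0 x : 0 <= x -> 0 <= energy x.
Proof.
move=> x0; rewrite leNgt; apply/negP => ex.
pose y := Num.max x X; have [xy Xy] : x <= y /\ X <= y by rewrite !le_max !lexx orbT.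
have ey t : y <= t -> energy t <= energy x by move=> yt; apply: energy_dec; lra.
have duv t : is_derive t 1 (fun t => u t * v t + energy x * t) (v t ^+ 2 + (V t - E) * u t ^+ 2 + energy x).
  by dsolve; ring.
have [uy vy] := uv Xy.
pose z := y - (u y * v y) / - energy x.
have ne : 0 < - energy x by lra.
have yz : y <= z by rewrite lerDl oppr_ge0 pmulr_lle0 ?invr_gt0// ltW// pmulr_rlt0.
have : u y * v y + energy x * y <= u z * v z + energy x * z.
  apply: (gderiv_ge0_le yz (fun t _ => duv t)) => t /andP[yt _].
  by have := ey t yt; rewrite /energy; have := sqr_ge0 (v t); nra.
have [uz vz] : 0 < u z /\ v z < 0 by apply: uv; lra.
have -> : energy x * z = energy x * y + u y * v y by rewrite /z; field; lra.
by have : u z * v z < 0 by [rewrite pmulr_rlt0]; lra.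
Qed.

Section Primitive.
Context {J : R -> R}.
Hypotheses (J0 : J 0 = 0) (dJ : forall x, is_derive x 1 J (u x ^+ 2)).

Let J_le x y : x <= y -> J x <= J y. Proof. exact: sqr_primitive_le. Qed.

(** By scaling, [V <= E / 4] up to [e * X] and [V >= 2 * E] from [L * X] on: these points bound the
    neighbourhood of 0 and the tail. *)
Context {e L : R}.
Hypotheses (eE : e = 4 ^- K) (LE : L = 2 ^+ K).

Let e0 : 0 < e. Proof. by rewrite eE invr_gt0 exprn_gt0. Qed.
Let e1 : e <= 1 / 4.
Proof. by rewrite eE mul1r lef_pV2 ?posrE ?exprn_gt0// le_exprK// ler1n. Qed.
Let L2 : 2 <= L. Proof. by rewrite LE le_exprK// ler1n. Qed.
Let eX0 : 0 < e * X. Proof. exact: mulr_gt0. Qed.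
Let eXX : e * X <= X.
Proof. by apply: ler_piMl; [exact: ltW|apply: le_trans e1 _; lra]. Qed.
Let XLX : 2 * X <= L * X. Proof. by rewrite ler_pM2r. Qed.
Let VeX : V (e * X) <= E / 4.
Proof.
have h4 : (4 : R) ^+ K != 0 by rewrite expf_neq0.
rewrite ler_pdivlMr// mulrC -VX; apply: le_trans (potential_scale_ge _ eX0) _.
  by rewrite ler1n.
by rewrite mulrA eE divff// mul1r.
Qed.
Let VeX_ge : e ^+ K * E <= V (e * X).
Proof.
have h := @potential_scale_le (4 ^+ K) (e * X) _ eX0.
have h4 : (4 : R) ^+ K != 0 by rewrite expf_neq0.
move: h; rewrite mulrA {1}eE divff// mul1r VX exprn_ege1 ?ler1n// => /(_ isT) h.
by rewrite {1}eE exprVn mulrC ler_pdivrMr ?exprn_gt0// mulrC.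
Qed.
Let VLX : 2 * E <= V (L * X).
Proof. by rewrite -VX LE; apply: potential_scale_ge; rewrite ?ler1n. Qed.

Let u_sq_le x : 0 <= x <= e * X -> u x ^+ 2 <= 4 / 3 * energy 0 / E.
Proof.
move=> /andP[x0 xX]; rewrite ler_pdivlMr//.
have h1 : energy x <= energy 0 by exact: energy_dec.
have h2 : V x <= E / 4 by apply: le_trans VeX; exact: potential_le.
move: h1; rewrite {1}/energy; have := sqr_ge0 (v x); have := sqr_ge0 (u x).
by nra.
Qed.

(** Three zones. Up to [e * X] the energy controls [u ^+ 2] directly. Between [e * X] and [L * X],
    [u ^+ 2] is minus the derivative of the energy divided by [V'], and [V'] is at least of order
    [E / X]. In the tail [v <= - k * u], so the remaining integral is at most
    [u (L * X) ^+ 2 / (2 * k)], and [c0 <= k * X] trades [1 / k] for [X]. *)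
Lemma norm_upper_bound (c0 : R) : 0 < c0 -> c0 <= k * X -> forall x, 0 <= x ->
  J x <= (4 / 3 + K%:R * L / e ^+ K * (1 + (2 * c0)^-1)) * (X * energy 0 / E).
Proof.
move=> c00 c0k x x0.
have [L2' eX0' eXX' XLX' VLX'] := And5 L2 eX0 eXX XLX VLX; have [X0' E0' k0'] := And3 X0 E0 k0.
have A0 : 0 <= energy 0 := energy_ge0 (lexx 0).
(* [D * (X / E)] bounds [1 / V'] on the middle zone: there [V' >= V / (K x)], [V >= e ^+ K * E] and
   [x <= L * X]. *)
pose D := K%:R * L / e ^+ K.
have L0 : 0 < L by lra.
have D0 : 0 < D by rewrite divr_gt0 ?mulr_gt0 ?exprn_gt0.
have h1 : J (e * X) <= 4 / 3 * (X * energy 0 / E).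
  have dg t : is_derive t 1 (fun t => J t - 4 / 3 * energy 0 / E * t) (u t ^+ 2 - 4 / 3 * energy 0 / E).
    by dsolve; ring.
  have := gderiv_le0_le (ltW eX0) (fun t _ => dg t).
  rewrite J0 mulr0 subr0 subr_le0 => H; apply: le_trans (H _) _.
    by move=> t ht; rewrite subr_le0 u_sq_le.
  rewrite [leRHS](_ : _ = 4 / 3 * energy 0 / E * X); last by ring.
  by rewrite ler_wpM2l// divr_ge0 ?mulr_ge0// ltW.
have h2 y z : e * X <= y -> y <= z -> z <= L * X -> J z - J y <= D * (X * energy 0 / E).
  move=> ey yz zL.
  have dg t : 0 < t -> is_derive t 1 (fun t => J t + D * (X / E) * energy t)
      (u t ^+ 2 - D * (X / E) * derive1 V t * u t ^+ 2).
    by move=> /dE ?; dsolve; ring.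
  have : J z + D * (X / E) * energy z <= J y + D * (X / E) * energy y.
    apply: (gderiv_le0_le yz (fun t ht => dg t _)) => t /andP[yt tz]; first by lra.
    have t0 : 0 < t by lra.
    rewrite subr_le0 ler_peMl ?sqr_ge0//.
    have [Vt _ VK _] := VP t0.
    have VV : e ^+ K * E <= V t by apply: le_trans VeX_ge _; apply: potential_le; lra.
    have hh : V t <= K%:R * (L * X * derive1 V t).
      apply: le_trans VK _; rewrite ler_pM2l// ler_pM2r ?potential_deriv_gt0//; lra.
    have -> : D * (X / E) * derive1 V t = K%:R * (L * X * derive1 V t) / (e ^+ K * E).
      by rewrite /D; field; rewrite expf_neq0 gt_eqF.
    rewrite ler_pdivlMr ?mulr_gt0 ?exprn_gt0// mul1r; exact: le_trans hh.
  have ez : 0 <= energy z by apply: energy_ge0; lra.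
  have eny : energy y <= energy 0 by apply: energy_dec; lra.
  have DX : 0 < D * (X / E) by rewrite mulr_gt0// divr_gt0.
  rewrite [X in _ -> _ <= X](_ : _ = D * (X / E) * energy 0); last by ring.
  have : D * (X / E) * energy y <= D * (X / E) * energy 0 by rewrite ler_pM2l.
  have : 0 <= D * (X / E) * energy z by rewrite mulr_ge0// ltW.
  by lra.
have [uL vL] : 0 < u (L * X) /\ v (L * X) < 0 by apply: uv; lra.
(* [u] decreases beyond [X <= L * X - X], so [u ^+ 2] is at least [u (L * X) ^+ 2] on the last
   stretch of length [X], which belongs to the middle zone. *)
have h3 : u (L * X) ^+ 2 * X <= D * (X * energy 0 / E).
  apply: le_trans (h2 (L * X - X) (L * X) _ _ (lexx _)); [|lra..].
  have dg t : is_derive t 1 (fun t => J t - u (L * X) ^+ 2 * t) (u t ^+ 2 - u (L * X) ^+ 2).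
    by dsolve; ring.
  suff : J (L * X - X) - u (L * X) ^+ 2 * (L * X - X) <= J (L * X) - u (L * X) ^+ 2 * (L * X) by lra.
  apply: (gderiv_ge0_le _ (fun t _ => dg t)); first by lra.
  move=> t /andP[Lt tL]; have Xt : X <= t by lra.
  by rewrite subr_ge0 ler_pXn2r ?nnegrE ?(ltW uL) ?(ltW (uv Xt).1)// u_anti.
have h4 y : L * X <= y -> J y - J (L * X) <= u (L * X) ^+ 2 / (2 * k).
  move=> Ly.
  have dg t : is_derive t 1 (fun t => J t + u t ^+ 2 / (2 * k)) (u t ^+ 2 + u t * v t / k).
    by dsolve; field; rewrite gt_eqF.
  have vk t : L * X <= t -> v t <= - k * u t.
    apply: (@decaying_log_derivative _ (fun x => V x - E) u v (L * X) k k0 (proj1 S)) => s Ls.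
      have : V (L * X) <= V s by apply: potential_le => //; lra.
      by rewrite kE; lra.
    by apply: uv; lra.
  have : J y + u y ^+ 2 / (2 * k) <= J (L * X) + u (L * X) ^+ 2 / (2 * k).
    apply: (gderiv_le0_le Ly (fun t _ => dg t)) => t /andP[Lt _].
    have [ut _] : 0 < u t /\ v t < 0 by apply: uv; lra.
    have -> : u t ^+ 2 + u t * v t / k = u t / k * (v t - - k * u t) by field; rewrite gt_eqF.
    by rewrite pmulr_rle0 ?divr_gt0// subr_le0 vk.
  have : 0 <= u y ^+ 2 / (2 * k) by rewrite divr_ge0 ?sqr_ge0// mulr_ge0// ltW.
  by lra.
have h5 : u (L * X) ^+ 2 / (2 * k) <= D * (2 * c0)^-1 * (X * energy 0 / E).
  have -> : u (L * X) ^+ 2 / (2 * k) = (u (L * X) ^+ 2 * X) * (2 * (k * X))^-1.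
    by field; rewrite !gt_eqF.
  rewrite [leRHS]mulrAC; apply: ler_pM => //.
  - by rewrite mulr_ge0 ?sqr_ge0// ltW.
  - by rewrite invr_ge0 mulr_ge0// mulr_ge0// ltW.
  - by rewrite lef_pV2 ?posrE ?mulr_gt0//; lra.
pose y := Num.max x (L * X); have [xy Ly] : x <= y /\ L * X <= y by rewrite !le_max !lexx orbT.
have := J_le xy; have := h4 y Ly; have := h2 (e * X) (L * X) (lexx _) _ (lexx _).
rewrite -/D => H; have {}H := H (ltac:(lra)).
move: h1 H h5; set B := X * energy 0 / E; set i := (2 * c0)^-1 => h1 H h5 h6 h7.
by rewrite [leRHS](_ : _ = 4 / 3 * B + D * B + D * i * B); [lra|ring].
Qed.

(** The energy is followed from 0 to [3 * X]. Up to [e * X], where [V'] may be unbounded, it loses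
    at most a third, because [u ^+ 2 <= 4 / 3 * energy 0 / E] and [V] rises by at most [E / 4]. From
    there on [V' <= M], so the loss is at most [M * J (3 * X)]. What is left at [3 * X] is at most
    [v (3 * X) ^+ 2], which convexity bounds by [(u (2 * X) / X) ^+ 2], hence by [J (3 * X)]. *)
Lemma norm_lower_bound (c0 : R) : 0 < c0 -> c0 <= k * X ->
  energy 0 <= 3 / 2 * (K%:R * 3 ^+ K / e + (c0 ^+ 2)^-1) * (E / X * J (3 * X)).
Proof.
move=> c00 c0k.
have [L2' eX0' eXX' XLX' VLX'] := And5 L2 eX0 eXX XLX VLX; have [X0' E0' k0'] := And3 X0 E0 k0.
have A0 : 0 <= energy 0 := energy_ge0 (lexx 0).
have h1 : 2 / 3 * energy 0 <= energy (e * X).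
  pose c := 4 / 3 * energy 0 / E.
  have c_ge0 : 0 <= c by rewrite divr_ge0 ?mulr_ge0// ltW.
  have : energy 0 + c * V 0 <= energy (e * X) + c * V (e * X).
    have D t : 0 < t -> is_derive t 1 (fun t => energy t + c * V t) (derive1 V t * (c - u t ^+ 2)).
      by move=> t0; have ? := dE t0; have [_ ? _ _] := VP t0; dsolve; ring.
    apply: (@deriv_ge0_le _ (fun t => energy t + c * V t) (fun t => derive1 V t * (c - u t ^+ 2)) _ _ (ltW eX0)) => t ht.
    - by apply: continuousD; [exact: cE|apply: continuousM; [exact: cvg_cst|exact: Vc]].
    - by apply: D; case/andP: ht.
    - rewrite mulr_ge0// ?subr_ge0 ?u_sq_le//; last by case/andP: ht => /ltW-> /ltW->.
      by apply/ltW/potential_deriv_gt0; case/andP: ht.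
  have : c * V (e * X) <= c * (E / 4) by rewrite ler_wpM2l.
  have -> : c * (E / 4) = energy 0 / 3 by rewrite /c; field; rewrite gt_eqF.
  by rewrite V0 mulr0; lra.
pose M := K%:R * 3 ^+ K / e * (E / X).
have h2 : energy (e * X) <= energy (3 * X) + M * J (3 * X).
  have ex3 : e * X <= 3 * X by lra.
  have D t : 0 < t -> is_derive t 1 (fun t => energy t + M * J t) ((M - derive1 V t) * u t ^+ 2).
    by move=> /dE ?; dsolve; ring.
  have : energy (e * X) + M * J (e * X) <= energy (3 * X) + M * J (3 * X).
    apply: (gderiv_ge0_le ex3 (fun t ht => D t _)) => t /andP[et t3]; first by lra.
    have t0 : 0 < t by lra.
    rewrite mulr_ge0 ?sqr_ge0// subr_ge0.
    have [Vt _ _ VK] := VP t0.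
    have VV : V t <= 3 ^+ K * E.
      rewrite -VX; apply: le_trans (potential_scale_le _ X0); rewrite ?ler1n//.
      by apply: potential_le; lra.
    rewrite /M [leRHS](_ : _ = K%:R * (3 ^+ K * E) / (e * X)); last by field; rewrite !gt_eqF.
    rewrite ler_pdivlMr// mulrC; apply: (@le_trans _ _ (t * derive1 V t)).
      by rewrite ler_pM2r// potential_deriv_gt0.
    by apply: le_trans VK _; rewrite ler_pM2l.
  have : 0 <= M * J (e * X).
    rewrite mulr_ge0//; last by rewrite -J0; apply: J_le; exact: ltW.
    by rewrite !mulr_ge0 ?invr_ge0 ?exprn_ge0// ltW.
  by lra.
have [u2 v2] : 0 < u (2 * X) /\ v (2 * X) < 0 by apply: uv; lra.
have [u3 v3] : 0 < u (3 * X) /\ v (3 * X) < 0 by apply: uv; lra.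
have h3 : - v (3 * X) * X <= u (2 * X).
  have D t : is_derive t 1 (fun t => u t - v (3 * X) * t) (v t - v (3 * X)) by dsolve; ring.
  have : u (3 * X) - v (3 * X) * (3 * X) <= u (2 * X) - v (3 * X) * (2 * X).
    apply: (gderiv_le0_le _ (fun t _ => D t)) => [|t /andP[t2 t3]]; first by lra.
    rewrite subr_le0; apply: (gderiv_ge0_le t3 (fun t _ => dv t)) => s /andP[ts _].
    have Xs : X <= s by lra.
    by rewrite mulr_ge0 ?(ltW (uv Xs).1)// subr_ge0 -VX; apply: potential_le => //; exact: ltW.
  by lra.
have h4 : u (2 * X) ^+ 2 * X <= J (3 * X).
  have D t : is_derive t 1 (fun t => J t - u (2 * X) ^+ 2 * t) (u t ^+ 2 - u (2 * X) ^+ 2).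
    by dsolve; ring.
  have : J X - u (2 * X) ^+ 2 * X <= J (2 * X) - u (2 * X) ^+ 2 * (2 * X).
    apply: (gderiv_ge0_le _ (fun t _ => D t)) => [|t /andP[t1 t2]]; first by lra.
    by rewrite subr_ge0 ler_pXn2r ?nnegrE ?(ltW u2) ?(ltW (uv t1).1)// u_anti.
  have : J 0 <= J X by exact/J_le/ltW.
  have : J (2 * X) <= J (3 * X) by apply: J_le; lra.
  by rewrite J0; lra.
have J3 : 0 <= J (3 * X) by rewrite -J0; apply: J_le; lra.
have h5 : energy (3 * X) <= (c0 ^+ 2)^-1 * (E / X) * J (3 * X).
  apply: (@le_trans _ _ (v (3 * X) ^+ 2)).
    rewrite /energy gerDl mulr_le0_ge0 ?sqr_ge0// subr_le0 -VX.
    by apply: potential_le; lra.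
  have vv : v (3 * X) ^+ 2 * X ^+ 2 <= u (2 * X) ^+ 2.
    have vX : 0 <= - v (3 * X) * X by rewrite mulr_ge0//; lra.
    by rewrite -exprMn -sqrrN -mulNr ler_pXn2r ?nnegrE ?(ltW u2).
  have cc : c0 ^+ 2 <= E * X ^+ 2.
    by rewrite -kE -exprMn ler_pXn2r ?nnegrE ?mulr_ge0// ltW.
  rewrite -mulrA ler_pdivlMl ?exprn_gt0//.
  apply: (@le_trans _ _ (E * X ^+ 2 * v (3 * X) ^+ 2)); first by rewrite ler_wpM2r ?sqr_ge0.
  have -> : E * X ^+ 2 * v (3 * X) ^+ 2 = E * (v (3 * X) ^+ 2 * X ^+ 2) by ring.
  rewrite -[leRHS]mulrA ler_pM2l// ler_pdivlMl// mulrC; apply: le_trans h4.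
  by rewrite ler_pM2r.
rewrite [leRHS](_ : _ = 3 / 2 * (M * J (3 * X) + (c0 ^+ 2)^-1 * (E / X) * J (3 * X))).
  by lra.
by rewrite /M; ring.
Qed.

End Primitive.

(* [w] is the Wronskian of [u] with the barrier [p], for which
   [p'' = - E <= - E * p]. *)
Lemma no_node_below_small_energy : 4 * k * (2 ^+ K * X) <= 1 -> 0 < u 0 /\ v 0 < 0.
Proof.
set Y := 2 ^+ K * X => kY; have [X0' E0' k0'] := And3 X0 E0 k0.
have L2 : 2 <= 2 ^+ K :> R by rewrite le_exprK// ler1n.
have XY : X < Y by rewrite /Y -subr_gt0 -{2}[X]mul1r -mulrBl mulr_gt0//; lra.
have VY : 2 * E <= V Y by rewrite -VX; apply: potential_scale_ge; rewrite ?ler1n.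
(* On [[0, Y]] one has [k * x <= 1 / 4], so [p] stays between 1/2 and 1. The slope [- k / 4] at 0
   turns [w 0 <= 0] into [v 0 < 0], and it is small enough for [w Y <= 0]. *)
pose p x := 1 - k * x / 4 - E * x ^+ 2 / 2.
pose p' x := - (k / 4) - E * x.
have dp x : is_derive x 1 p (p' x) by rewrite /p /p'; dsolve; field.
have dp' x : is_derive x 1 p' (- E) by rewrite /p'; dsolve; ring.
have pP x : 0 <= x <= Y -> 1 / 2 <= p x <= 1.
  move=> /andP[x0 xY]; rewrite /p -kE -exprMn.
  have h1 : 0 <= k * x <= 1 / 4.
    have a1 : k * x <= k * Y by rewrite ler_pM2l.
    have a2 : 0 <= k * x by apply: mulr_ge0; first exact: ltW.
    by lra.
  by nra.
pose w x := v x * p x - u x * p' x.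
have dw x : is_derive x 1 w (u x * (V x * p x + E * (1 - p x))) by rewrite /w; dsolve; ring.
have [uY vY] := uv (ltW XY).
have Y0 : 0 <= Y by lra.
have wY : w Y <= 0.
  have vk : v Y <= - k * u Y.
    apply: (@decaying_log_derivative _ (fun x => V x - E) u v Y k k0 (proj1 S)) => // s Ys.
      have : V Y <= V s by exact: potential_le.
      by rewrite kE; lra.
    by apply: uv; lra.
  have /andP[p2 p1] : 1 / 2 <= p Y <= 1 by apply: pP; rewrite Y0 lexx.
  have h : v Y * p Y <= - k * u Y * p Y by rewrite ler_wpM2r//; lra.
  have -> : w Y = v Y * p Y + u Y * (k * (1 / 4 + k * Y)) by rewrite /w /p' -kE; field.
  apply: le_trans (_ : - k * u Y * p Y + u Y * (k * (1 / 4 + k * Y)) <= 0); first by rewrite lerD2r.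
  have -> : - k * u Y * p Y + u Y * (k * (1 / 4 + k * Y)) = (k * u Y) * (1 / 4 + k * Y - p Y) by ring.
  by rewrite pmulr_rle0 ?mulr_gt0//; lra.
have w_le z : 0 <= z -> z <= Y -> (forall x, z < x <= Y -> 0 < u x) -> forall y, z <= y <= Y -> w y <= 0.
  move=> z0 zY uz y /andP[zy yY]; apply: le_trans wY.
  apply: (@deriv_ge0_le _ w (fun x => u x * (V x * p x + E * (1 - p x))) _ _ yY) => [t _|t /andP[yt tY]].
  - exact: is_derive_cts (dw t).
  - have /andP[p2 p1] : 1 / 2 <= p t <= 1 by apply: pP; lra.
    have ut : 0 < u t by apply: uz; lra.
    have Vt : 0 <= V t by apply: potential_ge0; lra.
    rewrite mulr_ge0 ?(ltW ut)// addr_ge0// mulr_ge0//; [lra|exact: ltW|lra].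
(* Beyond the last zero [z] of [u] one has [w <= 0], so [u / p] is nonincreasing on [[z, Y]],
   although it is 0 at [z] and positive at [Y]. *)
have u_pos x : 0 <= x <= Y -> 0 < u x.
  move: x; apply: contrapT => /(last_zero Y0 (fun x _ => is_derive_cts (du x)) uY)[z [/andP[z0 zY] uz upos]].
  have D x : 0 <= x <= Y -> is_derive x 1 (fun x => u x / p x) (w x / p x ^+ 2).
    move=> /pP/andP[p2 _]; have p0 : p x != 0 by rewrite gt_eqF//; lra.
    by dsolve => //; rewrite /w; field.
  have : u Y / p Y <= u z / p z.
    apply: (gderiv_le0_le (ltW zY) (fun x hx => D x _)) => x /andP[zx xY]; first by lra.
    rewrite pmulr_lle0; first by apply: (w_le z) => //; [exact: ltW|rewrite zx xY].
    have /andP[p2 _] : 1 / 2 <= p x <= 1 by apply: pP; lra.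
    by rewrite invr_gt0 exprn_gt0//; lra.
  rewrite uz mul0r; apply/negP; rewrite -ltNge divr_gt0//.
  by have /andP[] : 1 / 2 <= p Y <= 1 by [apply: pP; rewrite Y0 lexx]; lra.
have u0 : 0 < u 0 by apply: u_pos; rewrite lexx Y0.
split => //.
have : w 0 <= 0.
  apply: (w_le 0) => //; last by rewrite lexx Y0.
  by move=> x /andP[x0 xY]; apply: u_pos; rewrite xY ltW.
rewrite /w /p /p' expr0n/= !mulr0 !mul0r !subr0 mulr1 mulrN opprK.
have : 0 < u 0 * (k / 4) by rewrite mulr_gt0// divr_gt0.
by lra.
Qed.

End Energy.
End Potential.
End HalfLinePotential.

(** * Dependence of the decaying solution on the energy *)

Section SpectralDependence.
Context {R : realType}.
Implicit Types (u v w z J V : R -> R) (x y t : R).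

(* The curve [(x, y)] turns counterclockwise around the origin with angular
   velocity [c / (x ^+ 2 + y ^+ 2)]. *)
Definition rotating (l r : R) (x y c : R -> R) := forall E, l <= E <= r -> exists M, 0 <= M /\
  forall E1, l <= E1 <= r ->
   [/\ `|x E1 - x E| <= M * `|E1 - E|, `|y E1 - y E| <= M * `|E1 - E| &
      `|x E * y E1 - y E * x E1 - (E1 - E) * c E| <= M * (E1 - E) ^+ 2].

Lemma le0_of_exp_decay (a C c : R) : (forall x, c <= x -> a <= C * expR (- (x - c))) -> a <= 0.
Proof.
move=> H; rewrite leNgt; apply/negP => a0.
have := H c (lexx c); rewrite subrr oppr0 expR0 mulr1 => aC.
have C0 : 0 < C by lra.
have xc : c <= c + C / a by rewrite lerDl divr_ge0// ltW.
have := H _ xc; rewrite (_ : c + C / a - c = C / a); last by ring.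
rewrite expRN ler_pdivlMr ?expR_gt0// => h.
have : a * (1 + C / a) <= a * expR (C / a) by rewrite ler_pM2l// expR_ge1Dx.
by rewrite mulrDr mulrCA divff ?gt_eqF// !mulr1; lra.
Qed.

Context {K : nat} {V : R -> R} (PV : half_line_potential K V).

Lemma decaying_solution_scale (E : R) u v (c : R) : 0 < c -> decaying_solution (V := V) E u v ->
  decaying_solution (V := V) E (fun x => c * u x) (fun x => c * v x).
Proof.
move=> c0 [[du dv] uv]; split; first by split => x; dsolve; ring.
by move=> x x0 Ex; have [ux vx] := uv x x0 Ex; rewrite pmulr_rgt0// pmulr_rlt0.
Qed.

Section Tail.
Context {E b : R} {u v : R -> R}.
Hypotheses (b0 : 0 <= b) (bE : E + 1 <= V b).
Hypotheses (S : decaying_solution (V := V) E u v) (ub : u b = 1).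

Lemma tail_sign x : b <= x -> 0 < u x /\ v x < 0.
Proof.
move=> bx; have b0' := b0; have bE' := bE; case: S => _; apply; first by lra.
by have := potential_le PV b0 bx; lra.
Qed.

Lemma tail_exp_bound x : b <= x -> u x <= expR (- (x - b)).
Proof.
move=> bx; case: S => S1 _; have [du dv] := S1; have bE' := bE.
have H := @decaying_log_derivative _ _ u v b 1 ltr01 S1.
rewrite -[leRHS]mul1r -ub -[x - b]mul1r.
apply: (decaying_exp_bound du) bx => y by_; apply: H => //; last exact: tail_sign.
by move=> t bt; rewrite expr1n; have := potential_le PV b0 bt; lra.
Qed.

(** [u] is convex in the tail, so [- v x <= u (x - 1) - u x]; this is why the base point moves from
    [b] to [b + 1]. *)
Lemma tail_deriv_bound x : b + 1 <= x -> - v x <= expR (- (x - (b + 1))).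
Proof.
move=> bx; case: S => -[du dv] _; have bE' := bE.
have bx1 : b <= x - 1 by lra.
have := tail_exp_bound bx1; rewrite (_ : x - 1 - b = x - (b + 1)); last by ring.
apply: le_trans.
have D t : is_derive t 1 (fun t => u t - v x * t) (v t - v x) by dsolve; ring.
have [ux vx] : 0 < u x /\ v x < 0 by apply: tail_sign; lra.
have : u x - v x * x <= u (x - 1) - v x * (x - 1).
  apply: (gderiv_le0_le _ (fun t _ => D t)) => [|t /andP[t1 t2]]; first by lra.
  rewrite subr_le0; apply: (gderiv_ge0_le t2 (fun t _ => dv t)) => s /andP[ts _].
  have bs : b <= s by lra.
  have [us _] := tail_sign bs.
  by rewrite mulr_ge0 ?(ltW us)//; have := potential_le PV b0 bs; lra.
by lra.
Qed.

Lemma tail_le1 x : b <= x -> u x <= 1.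
Proof. by move=> bx; apply: le_trans (tail_exp_bound bx) _; rewrite -expR0 ler_expR oppr_le0 subr_ge0. Qed.

Lemma tail_norm x : b + 1 <= x -> `|u x| <= 1 /\ `|v x| <= expR (- (x - (b + 1))).
Proof.
move=> bx; have bx' : b <= x by apply: le_trans bx; rewrite lerDl.
have [ux vx] := tail_sign bx'.
by rewrite (gtr0_norm ux) (ltr0_norm vx) tail_le1// tail_deriv_bound.
Qed.

Lemma norm_tail J x y : (forall x, is_derive x 1 J (u x ^+ 2)) -> b <= x -> x <= y ->
  J y + expR (- (y - b)) <= J x + expR (- (x - b)).
Proof.
move=> dJ bx xy.
have D t : is_derive t 1 (fun t => J t + expR (- (t - b))) (u t ^+ 2 - expR (- (t - b))).
  by dsolve; ring.
apply: (gderiv_le0_le xy (fun t _ => D t)) => t /andP[xt _].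
have bt : b <= t := le_trans bx xt.
have [ut _] := tail_sign bt; rewrite subr_le0 expr2 -[leRHS]mulr1.
by apply: ler_pM; rewrite ?(ltW ut)// ?tail_exp_bound ?tail_le1.
Qed.

End Tail.

Lemma decaying_primitive_bounded E u v J : decaying_solution (V := V) E u v ->
  (forall x, is_derive x 1 J (u x ^+ 2)) -> exists j, forall x, J x <= j.
Proof.
move=> S dJ; have [b [b0 Vb]] : exists b, 0 < b /\ V b = `|E| + 1.
  by apply: (turning_point_exists PV); rewrite ltr_wpDl.
have bE : E + 1 <= V b by rewrite Vb lerD2r ler_norm.
have [ub0 _] : 0 < u b /\ v b < 0 by case: S => _; apply; [exact: ltW|lra].
have ib : 0 < (u b)^-1 by rewrite invr_gt0.
have U1 : (u b)^-1 * u b = 1 by rewrite mulVf// gt_eqF.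
have dJ1 x : is_derive x 1 (fun x => (u b)^-1 ^+ 2 * J x) (((u b)^-1 * u x) ^+ 2) by dsolve; ring.
exists (J b + u b ^+ 2) => y; have [yb|/ltW by_] := leP y b.
  by rewrite (le_trans (sqr_primitive_le dJ yb))// lerDl sqr_ge0.
have := norm_tail (ltW b0) bE (decaying_solution_scale ib S) U1 dJ1 (lexx b) by_.
rewrite subrr oppr0 expR0; have := expR_gt0 (- (y - b)) => e0 h.
have : (u b)^-1 ^+ 2 * J y <= (u b)^-1 ^+ 2 * (J b + u b ^+ 2).
  by rewrite mulrDr -exprMn U1 expr1n; lra.
by rewrite ler_pM2l// exprn_gt0.
Qed.

Section Compare.
Context {Emin Emax b : R}.
Hypotheses (b0 : 0 <= b) (bE : Emax + 1 <= V b).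
Context {E : R} {u v J : R -> R} {Ji : R}.
Hypotheses (hE : Emin <= E <= Emax) (S : decaying_solution (V := V) E u v) (ub : u b = 1).
Hypotheses (J0 : J 0 = 0) (dJ : forall x, is_derive x 1 J (u x ^+ 2)).
Hypothesis JJi : forall x, 0 <= x -> J x <= Ji.
Hypothesis Jsup : forall c, (forall x, 0 <= x -> J x <= c) -> Ji <= c.

Let bE0 : E + 1 <= V b.
Proof. by case/andP: hE => _ h; apply: le_trans bE; rewrite lerD2r. Qed.

Lemma J_tail x : b <= x -> Ji - J x <= expR (- (x - b)).
Proof.
move=> bx; rewrite lerBlDr; apply: Jsup => y y0.
have [yx|/ltW xy] := leP y x.
  by rewrite ler_wpDl ?expR_ge0// (sqr_primitive_le dJ).
have := norm_tail b0 bE0 S ub dJ bx xy; have := expR_gt0 (- (y - b)); lra.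
Qed.

Section TwoEnergies.
Context {E1 : R} {u1 v1 : R -> R}.
Hypotheses (hE1 : Emin <= E1 <= Emax) (S1 : decaying_solution (V := V) E1 u1 v1) (ub1 : u1 b = 1).

Let bE1 : E1 + 1 <= V b.
Proof. by case/andP: hE1 => _ h; apply: le_trans bE; rewrite lerD2r. Qed.
Let du x : is_derive x 1 u (v x). Proof. by case: S => -[]. Qed.
Let dv x : is_derive x 1 v ((V x - E) * u x). Proof. by case: S => -[]. Qed.
Let du1 x : is_derive x 1 u1 (v1 x). Proof. by case: S1 => -[]. Qed.
Let dv1 x : is_derive x 1 v1 ((V x - E1) * u1 x). Proof. by case: S1 => -[]. Qed.

Let d := E1 - E.
Let w x := u1 x - u x.
Let z x := v1 x - v x.
Let W x := u x * v1 x - v x * u1 x.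
Let ex x : R := expR (- (x - (b + 1))).

Let dw x : is_derive x 1 w (z x). Proof. by rewrite /w /z; dsolve. Qed.
Let dz x : is_derive x 1 z ((V x - E1) * w x + (- d * u x)).
Proof. by rewrite /z /w /d; dsolve; ring. Qed.
Let dW x : is_derive x 1 W (- d * (u x * u1 x)). Proof. by rewrite /W /d; dsolve; ring. Qed.
Let d_sqr : `|d| ^+ 2 = d ^+ 2. Proof. by rewrite real_normK ?num_real. Qed.
Let wb : w b = 0. Proof. by rewrite /w ub ub1 subrr. Qed.

Let W_tail x : b + 1 <= x -> `|W x| <= 2 * ex x.
Proof.
move=> bx; have [h1 h2] := tail_norm b0 bE0 S ub bx; have [h3 h4] := tail_norm b0 bE1 S1 ub1 bx.
rewrite (le_trans (ler_normB _ _))// !normrM mulr2n mulrDl !mul1r lerD//.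
  by rewrite -[leRHS]mul1r ler_pM.
by rewrite -[leRHS]mulr1 ler_pM.
Qed.

Let wz_tail x : b + 1 <= x -> w x * z x <= 4 * ex x.
Proof.
move=> bx; have [h1 h2] := tail_norm b0 bE0 S ub bx; have [h3 h4] := tail_norm b0 bE1 S1 ub1 bx.
have nw : `|w x| <= 2 by rewrite (le_trans (ler_normB _ _))// mulr2n lerD.
have nz : `|z x| <= 2 * ex x by rewrite (le_trans (ler_normB _ _))// mulr2n mulrDl !mul1r lerD.
rewrite (le_trans (ler_norm _))// normrM [leRHS](_ : _ = 2 * (2 * ex x)); last by ring.
exact: ler_pM.
Qed.

(** As [u] and [u1] are both 1 at [b], [z b] is their Wronskian there, which equals [d] times the
    integral of [u * u1] over the tail because the Wronskian tends to 0 at infinity. That integral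
    is at most 1. *)
Let zb : `|z b| <= `|d|.
Proof.
have zW : z b = W b by rewrite /z /W ub ub1; ring.
have key (s : R) : `|s| = 1 -> - (s * W b) <= `|d|.
  move=> s1; rewrite -subr_le0; apply: (@le0_of_exp_decay _ 2 (b + 1)) => x bx.
  have bx' : b <= x by apply: le_trans bx; rewrite lerDl.
  have D t : is_derive t 1 (fun t => s * W t + `|d| * expR (- (t - b)))
      (- (s * d) * (u t * u1 t) - `|d| * expR (- (t - b))) by dsolve; ring.
  have : s * W x + `|d| * expR (- (x - b)) <= s * W b + `|d| * expR (- (b - b)).
    apply: (gderiv_le0_le bx' (fun t _ => D t)) => t /andP[bt _].
    have [h1 _] := tail_sign b0 bE0 S bt; have [h2 _] := tail_sign b0 bE1 S1 bt.
    have uu : 0 <= u t * u1 t by rewrite mulr_ge0 ?ltW.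
    rewrite subr_le0 (le_trans (ler_norm _))// normrM normrN normrM s1 mul1r ler_wpM2l//.
    rewrite ger0_norm// -[leRHS]mulr1 ler_pM ?(ltW h1) ?(ltW h2)//.
      exact: (tail_exp_bound b0 bE0 S ub bt).
    exact: (tail_le1 b0 bE1 S1 ub1 bt).
  rewrite subrr oppr0 expR0 mulr1 => h.
  have p3 : 0 <= `|d| * expR (- (x - b)) by rewrite mulr_ge0// expR_ge0.
  have : - (s * W x) <= 2 * ex x.
    by rewrite (le_trans (ler_norm _))// normrN normrM s1 mul1r W_tail.
  by rewrite /ex; move: h p3; lra.
have := key 1 (normr1 _); have := key (-1) (normrN1 _).
by rewrite zW ler_norml; lra.
Qed.

Context {U : R}.
Hypothesis (uU : forall x, - b <= x <= b -> `|u x| <= U).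
Let M1 := V b + `|Emin| + `|Emax|.
(** Gronwall bounds squares; the final [+ 1] gives [M2 >= 1], so that [M2] also bounds the square
    root of the factor. *)
Let M2 := expR ((2 + M1) * (b - 0)) * (1 + U ^+ 2) + 1.

(** The difference [w] solves the equation at energy [E1] with forcing [- d * u] and data [w b = 0],
    [|z b| <= |d|]; Gronwall carries these data from [b] back to 0. *)
Lemma solution_lipschitz x : 0 <= x <= b -> `|u1 x - u x| <= M2 * `|E1 - E| /\ `|v1 x - v x| <= M2 * `|E1 - E|.
Proof.
move=> /andP[x0 xb]; rewrite -/(w x) -/(z x) -/d.
have M10 : 0 <= M1 by rewrite !addr_ge0 ?(potential_ge0 PV).
have e0 : 0 <= expR ((2 + M1) * (b - 0)) * (1 + U ^+ 2) by rewrite mulr_ge0 ?expR_ge0// addr_ge0 ?sqr_ge0.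
have qM t : x <= t <= b -> `|V t - E1| <= M1.
  move=> /andP[xt tb]; have Vt : V t <= V b by apply: (potential_le PV) => //; exact: le_trans xt.
  have Vt0 : 0 <= V t by apply: (potential_ge0 PV); exact: le_trans xt.
  have := ler_norm (- Emin); have := ler_norm Emax.
  have := normr_ge0 Emin; have := normr_ge0 Emax.
  by rewrite !normrN /M1 ler_norml; move: hE1 Vt Vt0; lra.
have hH t : x <= t <= b -> `|- d * u t| <= `|d| * U.
  by move=> tb; rewrite normrM normrN ler_wpM2l// uU//; move: x0 tb; lra.
have := gronwall_backward xb M10 dw dz qM hH; rewrite wb expr0n/= add0r => H.
have wz : w x ^+ 2 + z x ^+ 2 <= (M2 * `|d|) ^+ 2.
  apply: (@le_trans _ _ (w x ^+ 2 + z x ^+ 2 + (`|d| * U) ^+ 2)); first by rewrite lerDl sqr_ge0.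
  apply: le_trans H _.
  have zz : z b ^+ 2 <= `|d| ^+ 2 by rewrite -(real_normK (num_real (z b))) ler_pXn2r ?nnegrE.
  apply: (@le_trans _ _ (expR ((2 + M1) * (b - 0)) * (`|d| ^+ 2 * (1 + U ^+ 2)))).
    apply: ler_pM; [exact: expR_ge0|by rewrite addr_ge0 ?sqr_ge0| |].
      by rewrite ler_expR ler_wpM2l ?lerD2l ?lerN2// addr_ge0.
    by rewrite mulrDr mulr1 exprMn lerD2r.
  rewrite exprMn [leRHS]mulrC mulrCA ler_wpM2l ?sqr_ge0//.
  apply: (@le_trans _ _ M2); first by rewrite lerDl.
  by rewrite expr2 ler_peMl// ?lerDr// addr_ge0.
have M20 : 0 <= M2 * `|d| by rewrite mulr_ge0// addr_ge0.
have root (t : R) : t ^+ 2 <= (M2 * `|d|) ^+ 2 -> `|t| <= M2 * `|d|.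
  by move=> h; rewrite -(@ler_pXn2r _ 2%N) ?nnegrE// real_normK ?num_real.
by split; apply: root; apply: le_trans wz; rewrite ?lerDl ?lerDr sqr_ge0.
Qed.

(** The Wronskian minus its part linear in [d]. Its derivative [- d * (u * w)] is of second order,
    since [w] is of order [d]. *)
Let Z x := W x - d * (Ji - J x).

(** The tail reaches to infinity, where Gronwall gives nothing uniform. Instead [w * z] is added:
    its derivative contains [z ^+ 2 + (V - E1) * w ^+ 2] with [V - E1 >= 1], and together with
    [d ^+ 2 * u ^+ 2] this absorbs every product [d * u * w]. *)
Let Zb (s : R) : `|s| = 1 -> s * Z b <= d ^+ 2 * Ji.
Proof.
move=> s1; rewrite -subr_le0; apply: (@le0_of_exp_decay _ (6 + `|d|) (b + 1)) => x bx.
have bx' : b <= x by apply: le_trans bx; rewrite lerDl.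
have D t : is_derive t 1 (fun t => s * Z t + d ^+ 2 * J t + w t * z t)
   (- (s * d) * (u t * w t) + d ^+ 2 * u t ^+ 2 + (z t ^+ 2 + (V t - E1) * w t ^+ 2 - d * u t * w t)).
  by rewrite /Z; dsolve; rewrite /w; ring.
have : s * Z b + d ^+ 2 * J b + w b * z b <= s * Z x + d ^+ 2 * J x + w x * z x.
  apply: (gderiv_ge0_le bx' (fun t _ => D t)) => t /andP[bt _].
  have Vt : 1 <= V t - E1.
    by rewrite lerBrDr addrC (le_trans bE1)// (potential_le PV).
  have w2 : w t ^+ 2 <= (V t - E1) * w t ^+ 2 by rewrite ler_peMl ?sqr_ge0.
  have e1 := sqr_ge0 (z t); have e2 := sqr_ge0 (d * u t - w t); have e3 := sqr_ge0 (d * u t).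
  have e4 : s * (d * u t * w t) <= `|d * u t * w t|.
    by rewrite (le_trans (ler_norm _))// normrM s1 mul1r.
  have e5 : `|d * u t * w t| <= ((d * u t) ^+ 2 + w t ^+ 2) / 2.
    have := sqr_ge0 (d * u t + w t); move: e2; rewrite ler_norml; nra.
  have := ler_norm (d * u t * w t); move: w2 e1 e4 e5; nra.
rewrite wb mul0r addr0.
have Jb : 0 <= d ^+ 2 * J b by rewrite mulr_ge0 ?sqr_ge0// -J0 (sqr_primitive_le dJ).
have x0 : 0 <= x := le_trans b0 bx'.
have Jx : d ^+ 2 * J x <= d ^+ 2 * Ji by rewrite ler_wpM2l ?sqr_ge0// JJi.
have JT : `|d * (Ji - J x)| <= `|d| * ex x.
  rewrite normrM ler_wpM2l// ger0_norm ?subr_ge0 ?JJi//.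
  by apply: le_trans (J_tail bx') _; rewrite ler_expR lerN2 lerD2l lerN2 lerDl.
have sZ : s * Z x <= 2 * ex x + `|d| * ex x.
  rewrite (le_trans (ler_norm _))// normrM s1 mul1r (le_trans (ler_normB _ _))// lerD//.
  exact: W_tail.
have := wz_tail bx; rewrite -/(ex x); move: Jb Jx sZ; lra.
Qed.

Lemma wronskian_quadratic : 0 <= U ->
  `|u 0 * v1 0 - v 0 * u1 0 - (E1 - E) * Ji| <= (U * M2 * b + Ji) * (E1 - E) ^+ 2.
Proof.
move=> U0; have -> : u 0 * v1 0 - v 0 * u1 0 - (E1 - E) * Ji = Z 0 by rewrite /Z /W /d J0 subr0.
have Z0 (s : R) : `|s| = 1 -> s * Z 0 <= s * Z b + U * M2 * b * d ^+ 2.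
  move=> s1.
  have D t : is_derive t 1 (fun t => s * Z t + U * M2 * d ^+ 2 * t)
     (- (s * d) * (u t * w t) + U * M2 * d ^+ 2).
    by rewrite /Z; dsolve; rewrite /w; ring.
  have : s * Z 0 + U * M2 * d ^+ 2 * 0 <= s * Z b + U * M2 * d ^+ 2 * b.
    apply: (gderiv_ge0_le b0 (fun t _ => D t)) => t tb.
    rewrite mulNr addrC subr_ge0 (le_trans (ler_norm _))// !normrM s1 mul1r -d_sqr.
    have -> : U * M2 * `|d| ^+ 2 = `|d| * (U * (M2 * `|d|)) by ring.
    rewrite ler_wpM2l// ler_pM//; last by have [] := solution_lipschitz tb.
    by apply: uU; case/andP: tb => t0 ->; rewrite andbT (le_trans _ t0)// oppr_le0.
  by rewrite mulr0 addr0 mulrAC.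
have := Zb (normr1 _); have := Zb (normrN1 _).
have := Z0 1 (normr1 _); have := Z0 (-1) (normrN1 _).
rewrite -/d mulrDl (mulrC Ji) ler_norml; lra.
Qed.

End TwoEnergies.

Lemma spectral_lipschitz : exists M, 0 <= M /\ forall E1 u1 v1, Emin <= E1 <= Emax ->
  decaying_solution (V := V) E1 u1 v1 -> u1 b = 1 ->
  [/\ `|u1 0 - u 0| <= M * `|E1 - E|, `|v1 0 - v 0| <= M * `|E1 - E| &
      `|u 0 * v1 0 - v 0 * u1 0 - (E1 - E) * Ji| <= M * (E1 - E) ^+ 2].
Proof.
have [du _] : solves (fun x => V x - E) u v by case: S.
have [U U0 uU] := continuous_bounded b (deriv_continuous du).
set M2 := expR ((2 + (V b + `|Emin| + `|Emax|)) * (b - 0)) * (1 + U ^+ 2) + 1.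
have M20 : 0 <= M2 by rewrite addr_ge0// mulr_ge0 ?expR_ge0// addr_ge0 ?sqr_ge0.
have Ji0 : 0 <= Ji by rewrite -J0 JJi.
have P0 : 0 <= U * M2 * b + Ji by rewrite addr_ge0// !mulr_ge0// ltW.
exists (M2 + (U * M2 * b + Ji)); split=> [|E1 u1 v1 hE1 S1 ub1]; first exact: addr_ge0.
have [|h1 h2] := solution_lipschitz hE1 S1 ub1 uU (x := 0); first by rewrite lexx.
have h3 := wronskian_quadratic hE1 S1 ub1 uU (ltW U0).
by split; [apply: le_trans h1 _|apply: le_trans h2 _|apply: le_trans h3 _];
  rewrite ler_wpM2r ?sqr_ge0 ?lerDl ?lerDr.
Qed.

End Compare.

(** For [J] the primitive of [u ^+ 2] vanishing at 0, [j] is the squared L^2 norm of [u] on the half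
    line. *)
Definition norm_limit J (j : R) := (forall x, 0 <= x -> J x <= j) /\
  (forall c, (forall x, 0 <= x -> J x <= c) -> j <= c).

Definition spectral_data (E a d j : R) := exists u v J,
  [/\ decaying_solution (V := V) E u v, u 0 = a, v 0 = d,
      J 0 = 0 /\ (forall x, is_derive x 1 J (u x ^+ 2)) & norm_limit J j].

(** One point [b] beyond the turning points of the whole window serves to normalise every solution
    by [u b = 1], which makes solutions of nearby energies comparable. The angular quantity is then
    the squared norm [j]. *)
Lemma spectral_family (Emin Emax : R) : exists a d j,
  (forall E, Emin <= E <= Emax -> spectral_data E (a E) (d E) (j E)) /\ rotating Emin Emax a d j.
Proof.
have [b [b1 Vb]] : exists b, 0 < b /\ V b = `|Emax| + 1.
  by apply: (turning_point_exists PV); rewrite ltr_wpDl.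
have b0 := ltW b1.
have bE : Emax + 1 <= V b by rewrite Vb lerD2r ler_norm.
have step E : exists p : (R -> R) * (R -> R) * (R -> R) * R, Emin <= E <= Emax ->
    [/\ decaying_solution (V := V) E p.1.1.1 p.1.1.2, p.1.1.1 b = 1,
     p.1.2 0 = 0 /\ (forall x, is_derive x 1 p.1.2 (p.1.1.1 x ^+ 2)) & norm_limit p.1.2 p.2].
  have [hE|] := boolP (Emin <= E <= Emax); last first.
    by exists ((fun=> 0), (fun=> 0), (fun=> 0), 0).
  have [u0 [v0 S0]] := decaying_solution_exists PV E.
  have [ub0 _] : 0 < u0 b /\ v0 b < 0 by case: S0 => _; apply => //; lra.
  have ib : 0 < (u0 b)^-1 by rewrite invr_gt0.
  have S := decaying_solution_scale ib S0.
  set u := (fun x => (u0 b)^-1 * u0 x) in S *; set v := (fun x => (u0 b)^-1 * v0 x) in S *.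
  have ub : u b = 1 by rewrite /u mulVf// gt_eqF.
  have [du dv] : solves (fun x => V x - E) u v by case: S.
  have [J [J0 dJ]] := sqr_primitive_exists du.
  pose T := [set J x | x in [set x | 0 <= x]].
  have Tb : has_ubound T.
    by have [j Hj] := decaying_primitive_bounded S dJ; exists j => _ [y _ <-]; exact: Hj.
  exists (u, v, J, sup T) => _; split => //; split => [x x0|c Hc].
    by apply: ub_le_sup => //; exists x.
  by apply: ge_sup; [exists (J 0), 0 => /=|move=> _ [x x0 <-]; exact: Hc].
pose P E := sval (cid (step E)).
have HP E := svalP (cid (step E)).
exists (fun E => (P E).1.1.1 0), (fun E => (P E).1.1.2 0), (fun E => (P E).2); split => E hE;
  have [S ub [J0 dJ] jl] := HP E hE; rewrite -/(P E) in S ub J0 dJ jl.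
  by exists (P E).1.1.1, (P E).1.1.2, (P E).1.2.
have [M [M0 HM]] := spectral_lipschitz b0 bE hE S ub J0 dJ jl.1 jl.2.
exists M; split => // E1 hE1; have [S1 ub1 _ _] := HP E1 hE1.
exact: HM E1 _ _ hE1 S1 ub1.
Qed.

End SpectralDependence.

(** * Rotating curves in the plane *)

Section RotatingCurves.
Context {R : realType}.
Implicit Types (x y c f : R -> R) (l r E s rho : R).

Lemma rotating_scale l r x y c s : rotating l r x y c ->
  rotating l r (fun E => s * x E) y (fun E => s * c E).
Proof.
move=> H E hE; have [M [M0 HM]] := H E hE; exists ((`|s| + 1) * M); split.
  by rewrite mulr_ge0// addr_ge0.
move=> E1 hE1; have [h1 h2 h3] := HM E1 hE1; split.
- rewrite -mulrBr normrM -mulrA; apply: ler_pM => //; first by rewrite lerDl.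
- by apply: le_trans h2 _; rewrite ler_wpM2r// ler_peMl// lerDr.
- rewrite (_ : _ - _ = s * (x E * y E1 - y E * x E1 - (E1 - E) * c E)); last by ring.
  by rewrite normrM -mulrA; apply: ler_pM => //; rewrite lerDl.
Qed.

(** The new curve is the product of the complex numbers [x + i y] and [x' + i y']; arguments add, so
    angular velocities do. *)
Lemma rotating_mul l r x y c x' y' c' : rotating l r x y c -> rotating l r x' y' c' ->
  rotating l r (fun E => x E * x' E - y E * y' E) (fun E => x E * y' E + y E * x' E)
    (fun E => c E * (x' E ^+ 2 + y' E ^+ 2) + c' E * (x E ^+ 2 + y E ^+ 2)).
Proof.
move=> H H' E hE; have [M [M0 HM]] := H E hE; have [M' [M'0 HM']] := H' E hE.
pose B := r - l; have B0 : 0 <= B by rewrite /B; lra.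
pose N := `|x E| + `|y E|; pose N' := `|x' E| + `|y' E|.
have N0 : 0 <= N by rewrite addr_ge0.
have N'0 : 0 <= N' by rewrite addr_ge0.
pose A1 := (N * M' + M * (N' + M' * B)).
pose A2 := (`|c E| + M * B) * (N' * M') + M * (x' E ^+ 2 + y' E ^+ 2)
    + ((`|c' E| + M' * B) * (N * M) + M' * (x E ^+ 2 + y E ^+ 2)).
have A10 : 0 <= A1 by rewrite addr_ge0// mulr_ge0// addr_ge0// mulr_ge0.
have A20 : 0 <= A2 by repeat first [done | exact: sqr_ge0 | apply: addr_ge0 | apply: mulr_ge0].
exists (2 * A1 + 2 * A2); split; first by lra.
move=> E1 hE1; have [h1 h2 h3] := HM E1 hE1; have [h1' h2' h3'] := HM' E1 hE1.
have dB : `|E1 - E| <= B by rewrite ler_norml /B; lra.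
have d2 : (E1 - E) ^+ 2 = `|E1 - E| ^+ 2 by rewrite real_normK ?num_real.
rewrite d2 in h3 h3' *.
move: h1 h2 h3 h1' h2' h3'; set d := E1 - E in dB *; set D := `|d| in dB *.
have D0 : 0 <= D by exact: normr_ge0.
move=> h1 h2 h3 h1' h2' h3'.
have prod (p p1 q q1 : R) : `|p| <= N -> `|q| <= N' -> `|p1 - p| <= M * D -> `|q1 - q| <= M' * D ->
    `|p1 * q1 - p * q| <= A1 * D.
  move=> hp hq hp1 hq1.
  have -> : p1 * q1 - p * q = p * (q1 - q) + (p1 - p) * (q + (q1 - q)) by ring.
  rewrite (_ : A1 * D = N * (M' * D) + (M * D) * (N' + M' * B)); last by rewrite /A1; ring.
  apply: le_trans (ler_normD _ _) _; apply: lerD; rewrite normrM; apply: ler_pM => //.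
  apply: le_trans (ler_normD _ _) _; apply: lerD => //; apply: le_trans hq1 _.
  by rewrite ler_wpM2l.
have nx : `|x E| <= N by rewrite lerDl.
have ny : `|y E| <= N by rewrite lerDr.
have nx' : `|x' E| <= N' by rewrite lerDl.
have ny' : `|y' E| <= N' by rewrite lerDr.
have AA : 2 * A1 * D <= (2 * A1 + 2 * A2) * D by rewrite ler_wpM2r//; lra.
split.
- apply: le_trans AA; rewrite -mulrA mulr_natl mulr2n.
  rewrite (_ : _ - _ = (x E1 * x' E1 - x E * x' E) - (y E1 * y' E1 - y E * y' E)); last by ring.
  by apply: le_trans (ler_normB _ _) _; apply: lerD; apply: prod.
- apply: le_trans AA; rewrite -mulrA mulr_natl mulr2n.
  rewrite (_ : _ - _ = (x E1 * y' E1 - x E * y' E) + (y E1 * x' E1 - y E * x' E)); last by ring.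
  by apply: le_trans (ler_normD _ _) _; apply: lerD; apply: prod.
(* With [X = x + i y], the product of [X(E1)] and the conjugate of [X(E)] is [|X(E)|^2 + e + i k].
   The Wronskian of the product curve is the imaginary part of two such numbers multiplied, which
   gives the identity below. *)
pose k := x E * y E1 - y E * x E1; pose k' := x' E * y' E1 - y' E * x' E1.
pose e := x E * (x E1 - x E) + y E * (y E1 - y E).
pose e' := x' E * (x' E1 - x' E) + y' E * (y' E1 - y' E).
have hk : `|k| <= (`|c E| + M * B) * D.
  have -> : k = d * c E + (k - d * c E) by ring.
  apply: le_trans (ler_normD _ _) _; rewrite [leRHS]mulrDl normrM mulrC lerD2l.
  apply: le_trans h3 _; rewrite expr2 -mulrA; rewrite ler_wpM2l//; by rewrite ler_wpM2r.
have hk' : `|k'| <= (`|c' E| + M' * B) * D.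
  have -> : k' = d * c' E + (k' - d * c' E) by ring.
  apply: le_trans (ler_normD _ _) _; rewrite [leRHS]mulrDl normrM mulrC lerD2l.
  apply: le_trans h3' _; rewrite expr2 -mulrA; rewrite ler_wpM2l//; by rewrite ler_wpM2r.
have he : `|e| <= N * M * D.
  apply: le_trans (ler_normD _ _) _; rewrite !normrM /N -mulrA [leRHS]mulrDl.
  by apply: lerD; rewrite ler_wpM2l.
have he' : `|e'| <= N' * M' * D.
  apply: le_trans (ler_normD _ _) _; rewrite !normrM /N' -mulrA [leRHS]mulrDl.
  by apply: lerD; rewrite ler_wpM2l.
have -> : (x E * x' E - y E * y' E) * (x E1 * y' E1 + y E1 * x' E1) -
      (x E * y' E + y E * x' E) * (x E1 * x' E1 - y E1 * y' E1) -
      d * (c E * (x' E ^+ 2 + y' E ^+ 2) + c' E * (x E ^+ 2 + y E ^+ 2))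
   = (k * e' + (k - d * c E) * (x' E ^+ 2 + y' E ^+ 2)) + (k' * e + (k' - d * c' E) * (x E ^+ 2 + y E ^+ 2)).
  by rewrite /k /k' /e /e'; ring.
apply: (@le_trans _ _ (A2 * D ^+ 2)); last by rewrite ler_wpM2r ?exprn_ge0//; lra.
have key (p q t n P Q T : R) : `|p| <= P * D -> `|q| <= Q * D -> `|t| <= T * D ^+ 2 -> 0 <= n ->
    `|p * q + t * n| <= (P * Q + T * n) * D ^+ 2.
  move=> hp hq ht n0; apply: le_trans (ler_normD _ _) _; rewrite [leRHS]mulrDl !normrM; apply: lerD.
    by rewrite (_ : P * Q * D ^+ 2 = (P * D) * (Q * D)); [apply: ler_pM|ring].
  by rewrite (ger0_norm n0) mulrAC ler_wpM2r.
rewrite /A2 [leRHS]mulrDl; apply: le_trans (ler_normD _ _) _; apply: lerD.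
  by apply: key => //; rewrite addr_ge0 ?sqr_ge0.
by apply: key => //; rewrite addr_ge0 ?sqr_ge0.
Qed.

(** Multiplication by [- i], used to read the derivative of [y / x] off that of [x / y]. *)
Lemma rotating_quarter l r x y c : rotating l r x y c -> rotating l r y (fun E => - x E) c.
Proof.
move=> H E hE; have [M [M0 HM]] := H E hE; exists M; split => // E1 hE1.
have [h1 h2 h3] := HM E1 hE1; split => //.
  by rewrite -opprD normrN.
by rewrite (_ : _ - _ = x E * y E1 - y E * x E1 - (E1 - E) * c E)//; ring.
Qed.

Lemma is_derive_of_quadratic f E (D M e : R) : 0 < e ->
  (forall h, `|h| < e -> `|f (E + h) - f E - h * D| <= M * h ^+ 2) -> is_derive E 1 f D.
Proof.
move=> e0 H.
have M0 : 0 <= M.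
  have := H (e / 2); rewrite ger0_norm; last by lra.
  move=> /(_ ltac:(lra)) /(le_trans (normr_ge0 _)).
  by rewrite pmulr_lge0// exprn_gt0//; lra.
suff L : h^-1 *: (f (h *: 1 + E) - f E) @[h --> 0^'] --> D.
  split; first by apply/cvg_ex; exists D.
  by apply/cvg_lim.
apply/cvgrPdist_le => eps eps0.
have e1 : 0 < Num.min e (eps / (M + 1)) by rewrite lt_min e0 divr_gt0//; lra.
near=> h.
have h0 : h != 0 by near: h; exact: nbhs_dnbhs_neq.
have he : `|h| < Num.min e (eps / (M + 1)).
  by near: h; apply: dnbhs0_lt.
have /andP[he1 he2] : (`|h| < e) && (`|h| < eps / (M + 1)) by rewrite -lt_min.
rewrite /GRing.scale/= mulr1 (addrC h).
have -> : D - h^-1 * (f (E + h) - f E) = - (f (E + h) - f E - h * D) / h by field.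
rewrite normrM normrN normfV ler_pdivrMr ?normr_gt0//.
apply: le_trans (H h he1) _; rewrite -[h ^+ 2]real_normK ?num_real// expr2 mulrA ler_wpM2r//.
move: he2; rewrite ltr_pdivlMr; last by lra.
by rewrite mulrDr mulr1 mulrC; have := normr_ge0 h; lra.
Unshelve. all: by end_near. Qed.

Lemma rotating_continuous l r x y c E : rotating l r x y c -> l < E < r ->
  {for E, continuous x} /\ {for E, continuous y}.
Proof.
move=> H hE; have [|M [M0 HM]] := H E; first by lra.
suff key (g : R -> R) : (forall E1, l <= E1 <= r -> `|g E1 - g E| <= M * `|E1 - E|) -> {for E, continuous g}.
  by split; apply: key => E1 /HM[].
move=> hg; apply/cvgrPdist_le => e e0; near=> E1.
have h1 : l <= E1 <= r.
  have h : `|E - E1| < Num.min (E - l) (r - E).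
    near: E1; have /cvgrPdist_lt := @cvg_id _ (nbhs E); apply.
    by rewrite lt_min; apply/andP; split; lra.
  by move: h; rewrite lt_min => /andP[]; rewrite !ltr_norml; lra.
have h2 : `|E - E1| < e / (M + 1).
  by near: E1; have /cvgrPdist_lt := @cvg_id _ (nbhs E); apply; rewrite divr_gt0//; lra.
rewrite distrC; apply: le_trans (hg E1 h1) _; rewrite distrC.
move: h2; rewrite ltr_pdivlMr; last by lra.
by rewrite mulrDr mulr1 mulrC; have := normr_ge0 (E - E1); lra.
Unshelve. all: by end_near. Qed.

(** The numerator of a difference quotient of [x / y] is a Wronskian of the curve at two parameters,
    known up to a quadratic error. The radius [e] keeps the second denominator at least half as
    large as [|y E|]. *)
Lemma rotating_ratio_derive l r x y c E : rotating l r x y c -> l < E < r -> y E != 0 ->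
  is_derive E 1 (fun E => x E / y E) (- c E / y E ^+ 2).
Proof.
move=> H hE yE; have [|M [M0 HM]] := H E; first by lra.
have ny : 0 < `|y E| by rewrite normr_gt0.
pose e := Num.min (Num.min (E - l) (r - E)) (`|y E| / (2 * (M + 1))).
have e0 : 0 < e by rewrite !lt_min !divr_gt0//; lra.
apply: (@is_derive_of_quadratic _ _ _ ((M * `|y E| + `|c E| * M) * (y E ^+ 2 * (`|y E| / 2))^-1) e) => // h.
rewrite !lt_min => /andP[/andP[h1 h2] h3].
have hE1 : l <= E + h <= r by move: h1 h2; rewrite !ltr_norml; lra.
have [_ Hy Hc] := HM _ hE1; move: Hy Hc.
rewrite (_ : E + h - E = h); last by ring.
set x1 := x (E + h); set y1 := y (E + h) => Hy Hc.
have y1b : `|y E| / 2 <= `|y1|.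
  have : `|y E| <= `|y1| + `|y1 - y E|.
    by rewrite -{1}(subKr y1 (y E)) (le_trans (ler_normB _ _)).
  move: h3; rewrite ltr_pdivlMr; last by lra.
  have : M * `|h| <= (M + 1) * `|h| by rewrite ler_wpM2r//; lra.
  by rewrite mulrCA [_ * (M + 1)]mulrC; lra.
have y1n : y1 != 0 by rewrite -normr_gt0; lra.
have -> : x1 / y1 - x E / y E - h * (- c E / y E ^+ 2) =
   (- (x E * y1 - y E * x1 - h * c E) * y E + h * c E * (y1 - y E)) / (y E ^+ 2 * y1).
  by field; rewrite yE y1n.
rewrite normrM normfV [leRHS]mulrAC; apply: ler_pM => //.
- apply: le_trans (ler_normD _ _) _; rewrite [leRHS]mulrDl !normrM normrN; apply: lerD.
    by rewrite mulrAC ler_wpM2r.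
  rewrite -[h ^+ 2]real_normK ?num_real// (_ : `|c E| * M * `|h| ^+ 2 = `|h| * `|c E| * (M * `|h|)); last by ring.
  by rewrite ler_wpM2l// mulr_ge0.
- rewrite lef_pV2 ?posrE ?normr_gt0 ?mulf_neq0 ?expf_neq0//; last first.
    by rewrite mulr_gt0 ?exprn_even_gt0//; lra.
  by rewrite normrM ger0_norm ?sqr_ge0// ler_wpM2l ?sqr_ge0.
Qed.

(* [atan (x / y) + k * ln E] is nonincreasing as long as [y] does not vanish. *)
Lemma rotating_zero_exists l r x y c (k e1 e2 : R) : rotating l r x y c ->
  0 < e1 -> l < e1 -> e1 <= e2 -> e2 < r ->
  (forall E, e1 <= E <= e2 -> k / E * (x E ^+ 2 + y E ^+ 2) <= c E) ->
  pi <= k * (ln e2 - ln e1) -> exists E, e1 <= E <= e2 /\ y E = 0.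
Proof.
move=> H e10 le1 e12 e2r Hc Hpi; apply: contrapT => nz.
have y0 E : e1 <= E <= e2 -> y E != 0.
  by move=> hE; apply/eqP => yE; apply: nz; exists E.
pose g E := atan (x E / y E) + k * ln E.
have D E : e1 <= E <= e2 -> is_derive E 1 g (- c E / (x E ^+ 2 + y E ^+ 2) + k / E).
  move=> hE; have yE := y0 E hE.
  have [lEr E0] : l < E < r /\ 0 < E by lra.
  have dxy := rotating_ratio_derive H lEr yE.
  have xy : x E ^+ 2 + y E ^+ 2 != 0.
    by rewrite gt_eqF// ltr_wpDl ?sqr_ge0// exprn_even_gt0.
  have h1 := @is_derive_compf _ atan (fun E => x E / y E) _ _ _ (is_derive1_atan (x E / y E)) dxy.
  have h2 := is_deriveMf (is_derive_cstf k E) (is_derive1_ln E0).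
  apply: (is_derive_eq (is_deriveDf h1 h2)); field.
  by rewrite gt_eqF//= yE xy.
have : g e2 <= g e1.
  apply: (gderiv_le0_le e12 D) => E hE.
  have xy : 0 < x E ^+ 2 + y E ^+ 2 by rewrite ltr_wpDl ?sqr_ge0// exprn_even_gt0//= y0.
  by rewrite mulNr addrC subr_le0 ler_pdivlMr// Hc.
rewrite /g; have := atan_ltpi2 (x e1 / y e1); have := atan_gtNpi2 (x e2 / y e2).
by move: Hpi; rewrite mulrBr; lra.
Qed.

(* [y / x] starts from [0] at [e1], increases at rate at most [2 * rho] while
   [|y| <= |x|], and must reach [1] before [y] can vanish again. *)
Lemma rotating_zero_gap l r x y c (rho e1 e2 : R) : rotating l r x y c ->
  l < e1 -> e1 < e2 -> e2 < r ->
  (forall E, e1 <= E <= e2 -> 0 < x E ^+ 2 + y E ^+ 2) ->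
  (forall E, e1 <= E <= e2 -> 0 < c E <= rho * (x E ^+ 2 + y E ^+ 2)) ->
  y e1 = 0 -> y e2 = 0 -> 1 / 2 <= rho * (e2 - e1).
Proof.
move=> H le1 e12 e2r xy0 Hc y1 y2; rewrite leNgt; apply/negP => rho1.
have D E : e1 <= E <= e2 -> x E != 0 -> is_derive E 1 (fun E => y E / x E) (c E / x E ^+ 2).
  move=> hE xE; have hE' : l < E < r by lra.
  have xE' : - x E != 0 by rewrite oppr_eq0.
  have h := is_deriveNf (rotating_ratio_derive (rotating_quarter H) hE' xE').
  rewrite (_ : (fun E => y E / x E) = (fun E => - (y E / - x E))); last first.
    by apply/funext => F; rewrite invrN mulrN opprK.
  by apply: (is_derive_eq h); rewrite sqrrN mulNr opprK.
have nz0 E : e1 <= E <= e2 -> y E = 0 -> x E != 0.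
  by move=> /xy0 + yE; rewrite yE expr0n addr0; apply: contraTneq => ->; rewrite expr0n ltxx.
have r0 : 0 < rho.
  have /andP[c0 c1] := Hc e1 ltac:(lra).
  by have := lt_le_trans c0 c1; rewrite pmulr_lgt0// xy0//; lra.
have x1 : x e1 != 0 by apply: nz0 => //; lra.
(* The parameter is reversed so that the last zero of [f] before [- e1] becomes the first parameter
   after [e1] where [|y| = |x|]. *)
pose f t := x (- t) ^+ 2 - y (- t) ^+ 2.
have fc t : - e2 <= t <= - e1 -> {for t, continuous f}.
  move=> ht; have [cx cy] : {for - t, continuous x} /\ {for - t, continuous y} by apply: rotating_continuous H _; lra.
  have sq (g : R -> R) : {for - t, continuous g} -> {for t, continuous (fun t => g (- t) ^+ 2)}.
    move=> gc; have gc' : {for t, continuous (fun t => g (- t))}.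
      by apply: continuous_comp => //; exact: continuousN.
    by rewrite (_ : (fun _ => _) = fun t => g (- t) * g (- t))//; apply: continuousM.
  by apply: (continuousB (sq _ cx) (sq _ cy)).
have f1 : 0 < f (- e1) by rewrite /f opprK y1 expr0n subr0 exprn_even_gt0.
have e12' : - e2 <= - e1 by lra.
have mono E : e1 <= E -> E <= e2 -> (forall t, e1 <= t <= E -> x t != 0) -> 0 <= y E / x E.
  move=> eE Ee xn; have -> : 0 = y e1 / x e1 by rewrite y1 mul0r.
  apply: (gderiv_ge0_le eE (fun t ht => D t _ (xn t ht))) => t ht; first by lra.
  by have /Hc/andP[c0 _] : e1 <= t <= e2 by [lra]; rewrite divr_ge0 ?sqr_ge0// ltW.
have [|z [/andP[z2 z1] fz fpos]] := last_zero e12' fc f1.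
  move=> fp; have xn E : e1 <= E <= e2 -> x E != 0.
    move=> hE; have := fp (- E) ltac:(lra); rewrite /f opprK; apply: contraTneq => ->.
    by rewrite expr0n sub0r oppr_gt0 -leNgt sqr_ge0.
  have : y e1 / x e1 < y e2 / x e2.
    apply: (@deriv_gt0_lt _ (fun E => y E / x E) (fun E => c E / x E ^+ 2) _ _ e12) => E hE.
    - by apply: is_derive_cts (D E hE (xn E hE)).
    - by apply: D => //; [|apply: xn]; lra.
    - have /Hc/andP[c0 _] : e1 <= E <= e2 by lra.
      by rewrite divr_gt0// exprn_even_gt0//= xn//; lra.
  by rewrite y1 y2 !mul0r ltxx.
pose s := - z; have [s1 s2] : e1 <= s /\ s <= e2 by rewrite /s; lra.
have yx E : e1 <= E <= s -> y E ^+ 2 <= x E ^+ 2.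
  rewrite /s => /andP[eE]; rewrite le_eqVlt => /predU1P[->|Es]; rewrite -subr_ge0.
    by rewrite -fz.
  by have := fpos (- E) ltac:(lra); rewrite /f opprK => /ltW.
have xn E : e1 <= E <= s -> x E != 0.
  move=> hE; have := xy0 E ltac:(lra); apply: contraTneq => x0; have := yx E hE.
  by rewrite x0 expr0n/= add0r -leNgt.
have rs : y s / x s = 1.
  apply/eqP; rewrite -(@eqrXn2 _ 2%N)// ?mono// expr1n expr_div_n.
  have /eqP : x s ^+ 2 = y s ^+ 2 by apply/eqP; rewrite -subr_eq0 -fz /f.
  by move=> /eqP <-; rewrite divff// expf_neq0// xn// s1 lexx.
have : y s / x s - 2 * rho * s <= y e1 / x e1 - 2 * rho * e1.
  apply: (@gderiv_le0_le _ (fun E => y E / x E - 2 * rho * E) (fun E => c E / x E ^+ 2 - 2 * rho) _ _ s1) => t ht.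
    exact: is_deriveDf (D t ltac:(lra) (xn t ht)) (is_deriveNf (is_derive_mull _ t)).
  have x2 : 0 < x t ^+ 2 by rewrite exprn_even_gt0//= xn.
  have /andP[c0 c1] := Hc t ltac:(lra); have := yx t ht.
  rewrite subr_le0 ler_pdivrMr// => h; apply: le_trans c1 _; rewrite -mulrA mulrCA ler_pM2l//; lra.
have : rho * (s - e1) <= rho * (e2 - e1) by rewrite ler_pM2l// lerB.
by rewrite rs y1 mul0r; lra.
Qed.

End RotatingCurves.

(** * Turning points and half phases *)

Section TurningPoint.
Context {R : realType}.
Implicit Types (V : R -> R) (x E : R) (K : nat).

Definition turning_point V E : R := xget 0 [set X | 0 < X /\ V X = E].

(** One half line's share of [sqrt(E) |{V <= E}|]: the sublevel set is the interval between the two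
    turning points. *)
Definition half_phase V E := Num.sqrt E * turning_point V E.

Context {K : nat} {V : R -> R} (PV : half_line_potential K V).

Lemma turning_pointP E : 0 < E -> 0 < turning_point V E /\ V (turning_point V E) = E.
Proof.
by move=> /(turning_point_exists PV)[X HX]; rewrite /turning_point; case: xgetP => [y _|/(_ X)].
Qed.

Lemma turning_point_le E E' : 0 < E -> E <= E' -> turning_point V E <= turning_point V E'.
Proof.
move=> E0 EE'; have [X0 XE] := turning_pointP E0.
have [X0' XE'] := turning_pointP (lt_le_trans E0 EE').
by apply: (potential_le_inv PV); rewrite ?XE ?XE'// ltW.
Qed.

Lemma turning_point_scale E l : 0 < E -> 1 <= l -> turning_point V (l * E) <= l ^+ K * turning_point V E.
Proof.
move=> E0 l1; have [X0 XE] := turning_pointP E0.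
have lE0 : 0 < l * E by rewrite mulr_gt0//; lra.
have [X0' XE'] := turning_pointP lE0.
have l0 : 0 < l by lra.
apply: (potential_le_inv PV); [exact: ltW|by rewrite mulr_ge0 ?exprn_ge0// ltW|].
by rewrite XE' -{1}XE; apply: (potential_scale_ge PV).
Qed.

Lemma half_phase_le E E' : 0 < E -> E <= E' -> half_phase V E <= half_phase V E'.
Proof.
move=> E0 EE'; have [X0 _] := turning_pointP E0.
by apply: ler_pM; rewrite ?sqrtr_ge0 ?(ltW X0) ?ler_wsqrtr ?turning_point_le.
Qed.

End TurningPoint.

(** * Two-sided bounds for the rate of rotation *)

Section SpectralRate.
Context {R : realType}.

(** The norm estimates in terms of Cauchy data at 0, with one [C] for all potentials sharing [K];
    this uniformity is the source of the dependence on [kappa] alone. *)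
Definition spectral_rates K (c0 C : R) := forall V E a d j, half_line_potential K V -> 0 < E ->
  c0 <= half_phase V E -> spectral_data (V := V) E a d j ->
  [/\ j <= C * (turning_point V E / E) * (d ^+ 2 + E * a ^+ 2),
    d ^+ 2 + E * a ^+ 2 <= C * (E / turning_point V E) * j,
    0 < d ^+ 2 + E * a ^+ 2 & 0 < j].

Lemma spectral_rate_bounds K (c0 : R) : 0 < c0 -> exists C, 0 < C /\ spectral_rates K c0 C.
Proof.
move=> c00; pose e : R := 4 ^- K; pose L : R := 2 ^+ K.
have e0 : 0 < e by rewrite invr_gt0 exprn_gt0.
have L0 : 0 < L by rewrite exprn_gt0.
pose C1 := 4 / 3 + K%:R * L / e ^+ K * (1 + (2 * c0)^-1).
pose C2 := 3 / 2 * (K%:R * 3 ^+ K / e + (c0 ^+ 2)^-1).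
have C10 : 0 < C1.
  rewrite ltr_wpDr ?divr_gt0// mulr_ge0 ?divr_ge0 ?mulr_ge0 ?exprn_ge0 ?(ltW e0) ?(ltW L0)//.
  by rewrite addr_ge0// invr_ge0 mulr_ge0// ltW.
have C20 : 0 < C2.
  rewrite mulr_gt0 ?divr_gt0// ltr_wpDl ?invr_gt0 ?exprn_gt0//.
  by rewrite divr_ge0 ?mulr_ge0 ?exprn_ge0// ltW.
exists (C1 + C2); split; first by rewrite addr_gt0.
move=> V E a d j PV E0 c0k [u [v [J [S ua vd [J0 dJ] [JJ Jsup]]]]].
have [X0 VX] := turning_pointP PV E0; rewrite /half_phase in c0k.
have k0 : 0 < Num.sqrt E by rewrite sqrtr_gt0.
have kE : Num.sqrt E ^+ 2 = E by rewrite sqr_sqrtr// ltW.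
set X := turning_point V E in c0k X0 VX *.
have V0 : V 0 = 0 by case: PV.
have eE : v 0 ^+ 2 + (E - V 0) * u 0 ^+ 2 = d ^+ 2 + E * a ^+ 2 by rewrite V0 subr0 ua vd.
have h1 := norm_upper_bound PV k0 kE X0 VX S J0 dJ (erefl e) (erefl L) c00 c0k.
have h2 := norm_lower_bound PV k0 kE X0 VX S J0 dJ (erefl e) (erefl L) c00 c0k.
rewrite eE -/C1 in h1; rewrite eE -/C2 in h2.
set A := d ^+ 2 + E * a ^+ 2 in h1 h2 *.
(* Vanishing data at 0 would make [u] identically 0, against [u X > 0]. *)
have A0 : 0 < A.
  have h1' := sqr_ge0 d; have h2' : 0 <= E * a ^+ 2 by rewrite mulr_ge0 ?sqr_ge0// ltW.
  rewrite lt_neqAle eq_sym addr_ge0// andbT; apply/negP.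
  rewrite paddr_eq0// sqrf_eq0 mulf_eq0 sqrf_eq0 (gt_eqF E0)/=.
  move=> /andP[/eqP d0 /eqP a0].
  have [uX _] : 0 < u X /\ v X < 0 by case: S => _; apply; [exact: ltW|rewrite VX].
  have := solves_unique (@shifted_potential_continuous _ _ _ PV E) (proj1 S) (b := 0) _ _ X.
  by rewrite ua vd a0 d0 => /(_ erefl erefl)[uX0 _]; rewrite uX0 ltxx in uX.
have EX : 0 < E / X by rewrite divr_gt0.
have X3 : 0 <= 3 * X by rewrite mulr_ge0// ltW.
have h3 : A <= C2 * (E / X) * j.
  by apply: le_trans h2 _; rewrite -[leRHS]mulrA ler_pM2l// ler_pM2l// JJ.
have j0 : 0 < j by have := lt_le_trans A0 h3; rewrite pmulr_rgt0// mulr_gt0.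
split => //.
- apply: Jsup => x x0; apply: le_trans (h1 x x0) _.
  rewrite [leRHS](_ : _ = (C1 + C2) * (X * A / E)); last by ring.
  by rewrite ler_wpM2r ?lerDl ?(ltW C20)// divr_ge0 ?mulr_ge0// ltW.
- apply: le_trans h3 _; rewrite ler_wpM2r ?(ltW j0)// ler_wpM2r ?(ltW EX)// lerDr.
  exact: ltW.
Qed.

End SpectralRate.

(** * Matching the two half lines *)

Section TwoSided.
Context {R : realType}.
Implicit Types (V W : R -> R) (x E : R) (K : nat).

(** The second solution lives on the reflected half line, hence the plus sign in its Wronskian. This
    form, for all decaying pairs, is what an eigenvalue implies; [matched], for some pair, is what
    implies an eigenvalue. *)
Definition matching V W E := forall u v u' v',
  decaying_solution (V := V) E u v -> decaying_solution (V := W) E u' v' ->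
  u 0 * v' 0 + v 0 * u' 0 = 0.

Context {K : nat} {V W : R -> R}.
Hypotheses (PV : half_line_potential K V) (PW : half_line_potential K W).
Hypotheses (VW : forall x, 0 <= x -> V x <= K%:R * W x)
  (WV : forall x, 0 <= x -> W x <= K%:R * V x).

Let K1 : 1 <= K%:R :> R. Proof. by case: PV => + _ _ _; rewrite ler1n. Qed.

Lemma turning_point_compare (E : R) : 0 < E ->
  turning_point V E <= K%:R ^+ K * turning_point W E /\
  turning_point W E <= K%:R ^+ K * turning_point V E.
Proof.
move=> E0; have [X0 VX] := turning_pointP PV E0; have [Y0 WY] := turning_pointP PW E0.
have Q0 : 0 < K%:R ^+ K :> R by rewrite exprn_gt0//; have := K1; lra.
split.
- apply: (potential_le_inv PV); [exact: ltW|by rewrite mulr_ge0// ltW|].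
  apply: le_trans (potential_scale_ge PV K1 Y0).
  by rewrite VX; have := WV (ltW Y0); rewrite WY.
- apply: (potential_le_inv PW); [exact: ltW|by rewrite mulr_ge0// ltW|].
  apply: le_trans (potential_scale_ge PW K1 X0).
  by rewrite WY; have := VW (ltW X0); rewrite VX.
Qed.

(** At a matching energy the halves cannot both have [u 0 > 0 > v 0], as both products would be
    negative. For [E <= 0] both do. For [E > 0] the absence of nodes at small phase makes one half
    phase exceed [1 / (4 * 2 ^+ K)], and comparing turning points costs [K ^+ K] for the other. *)
Lemma matching_phase_bound (E : R) : matching V W E -> 0 < E /\
  (4 * 2 ^+ K * K%:R ^+ K)^-1 <= half_phase V E /\ (4 * 2 ^+ K * K%:R ^+ K)^-1 <= half_phase W E.
Proof.
move=> m.
have [u [v S]] := decaying_solution_exists PV E; have [u' [v' S']] := decaying_solution_exists PW E.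
have mE := m _ _ _ _ S S'.
have contra : ~ ((0 < u 0 /\ v 0 < 0) /\ (0 < u' 0 /\ v' 0 < 0)).
  move=> [[u0 v0] [u'0 v'0]].
  have h1 : u 0 * v' 0 < 0 by rewrite pmulr_rlt0.
  have h2 : v 0 * u' 0 < 0 by rewrite pmulr_llt0.
  by lra.
have E0 : 0 < E.
  rewrite ltNge; apply/negP => E0; apply: contra; split.
    by case: S => _; apply => //; case: PV => _ _ ->.
  by case: S' => _; apply => //; case: PW => _ _ ->.
split => //.
have [X0 VX] := turning_pointP PV E0; have [Y0 WY] := turning_pointP PW E0.
have [XY YX] := turning_point_compare E0.
rewrite /half_phase; set X := turning_point V E in X0 VX XY YX *; set Y := turning_point W E in Y0 WY XY YX *.
set k := Num.sqrt E.
have k0 : 0 < k by rewrite sqrtr_gt0.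
have kE : k ^+ 2 = E by rewrite sqr_sqrtr// ltW.
have K1' := K1.
have Q1 : 1 <= K%:R ^+ K :> R by rewrite exprn_ege1.
have Q0 : 0 < K%:R ^+ K :> R by lra.
have p0 : 0 < 2 ^+ K :> R by rewrite exprn_gt0.
set P := 2 ^+ K in p0 *; set Q := K%:R ^+ K in XY YX Q0 Q1 *.
have key : 1 < 4 * P * (k * X) \/ 1 < 4 * P * (k * Y).
  have [h1|h1] := leP (4 * P * (k * X)) 1; last by left.
  right; rewrite ltNge; apply/negP => h2; apply: contra; split.
    by apply: (no_node_below_small_energy PV k0 kE X0 VX S); rewrite -/P; lra.
  by apply: (no_node_below_small_energy PW k0 kE Y0 WY S'); rewrite -/P; lra.
have D0 : 0 < 4 * P * Q by rewrite mulr_gt0// mulr_gt0.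
have kXY : k * X <= Q * (k * Y) by rewrite mulrCA ler_pM2l.
have kYX : k * Y <= Q * (k * X) by rewrite mulrCA ler_pM2l.
have g Z : 0 < Z -> 1 < 4 * P * Z \/ 1 < 4 * P * (Q * Z) -> (4 * P * Q)^-1 <= Z.
  move=> Z0 h; rewrite -[_^-1]mul1r ler_pdivrMr//.
  case: h => h; last by rewrite mulrC -!mulrA mulrA; move: h; rewrite -!mulrA mulrA; lra.
  have : Z * (4 * P * 1) <= Z * (4 * P * Q) by rewrite ler_pM2l// ler_pM2l// mulr_gt0.
  by lra.
have c4 Z Z' : Z <= Z' -> 4 * P * Z <= 4 * P * Z' by move=> ?; rewrite ler_pM2l// mulr_gt0.
have cX := c4 _ _ kXY; have cY := c4 _ _ kYX.
by split; apply: g; rewrite ?mulr_gt0//; case: key; [left|right|right|left]; lra.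
Qed.

Let family l r s (a d j a' d' j' : R -> R) : rotating l r a d j -> rotating l r a' d' j' ->
  rotating l r (fun E => s * a E * (s * a' E) - d E * d' E)
   (fun E => s * a E * d' E + d E * (s * a' E))
   (fun E => s * j E * ((s * a' E) ^+ 2 + d' E ^+ 2) + s * j' E * ((s * a E) ^+ 2 + d E ^+ 2)).
Proof. by move=> H H'; apply: rotating_mul; exact: rotating_scale. Qed.

Let product_norm (p q p' q' : R) : (p * p' - q * q') ^+ 2 + (p * q' + q * p') ^+ 2 = (p ^+ 2 + q ^+ 2) * (p' ^+ 2 + q' ^+ 2).
Proof. by ring. Qed.

Definition matched E := exists u v u' v', [/\ decaying_solution (V := V) E u v,
  decaying_solution (V := W) E u' v' & u 0 * v' 0 + v 0 * u' 0 = 0].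

(** The [V] factor alone turns at rate at least [N / (C * E)], because its turning point is at least
    the one at [e1]; the [W] factor turns the same way. Integrating in [ln E] up to the chosen end
    gives an angle [pi]. *)
Lemma matched_exists (c0 C : R) : spectral_rates K c0 C -> 0 < C -> 0 < c0 ->
  forall e1, 0 < e1 -> c0 <= half_phase V e1 ->
    exists E, e1 <= E <= e1 * expR (pi * C / half_phase V e1) /\ matched E.
Proof.
move=> rate C0 c00 e1 e10 c0e1.
set N := half_phase V e1 in c0e1 *.
have N0 : 0 < N by lra.
set e2 := e1 * expR _.
have t0 : 0 < pi * C / N by rewrite divr_gt0// mulr_gt0// pi_gt0.
have e12 : e1 <= e2 by rewrite ler_peMr ?(ltW e10)// -expR0 ler_expR ltW.
(* The window exceeds [[e1, e2]] on both sides so that the curves can be differentiated at the end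
   points. *)
have [a [d [j [H ro]]]] := spectral_family PV (e1 / 2) (2 * e2).
have [a' [d' [j' [H' ro']]]] := spectral_family PW (e1 / 2) (2 * e2).
pose s := Num.sqrt e1.
have s0 : 0 < s by rewrite sqrtr_gt0.
have sE : s ^+ 2 = e1 by rewrite sqr_sqrtr// ltW.
have rot := family s ro ro'.
have [||||E [hE yE]] := rotating_zero_exists rot e10 _ e12 _ (k := N / C); first by lra.
- by lra.
- move=> E hE; have hE' : e1 / 2 <= E <= 2 * e2 by lra.
  have E0 : 0 < E by lra.
  have [X0 _] := turning_pointP PV E0.
  have c0E : c0 <= half_phase V E.
    by apply: le_trans c0e1 _; apply: (half_phase_le PV) => //; lra.
  have [_ h2 _ j0] := rate _ _ _ _ _ PV E0 c0E (H E hE').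
  have j'0 : 0 <= j' E.
    by have [u [v [J [_ _ _ [J0 _] [JJ _]]]]] := H' E hE'; rewrite -J0 JJ.
  rewrite product_norm.
  set n := (s * a E) ^+ 2 + d E ^+ 2; set n' := (s * a' E) ^+ 2 + d' E ^+ 2.
  have n_ge0 : 0 <= n by rewrite addr_ge0 ?sqr_ge0.
  have n'_ge0 : 0 <= n' by rewrite addr_ge0 ?sqr_ge0.
  apply: (@le_trans _ _ (s * j E * n')); last first.
    by rewrite lerDl mulr_ge0// mulr_ge0// ltW.
  rewrite mulrA ler_wpM2r//.
  have nA : n <= d E ^+ 2 + E * a E ^+ 2.
    by rewrite /n exprMn sE addrC lerD2l ler_wpM2r ?sqr_ge0//; lra.
  have [X10 _] := turning_pointP PV e10.
  have XX : turning_point V e1 <= turning_point V E by apply: (turning_point_le PV) => //; lra.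
  have h3 : n <= C * (E / turning_point V e1) * j E.
    apply: le_trans nA _; apply: le_trans h2 _.
    by rewrite ler_pM2r// ler_pM2l// ler_pM2l// lef_pV2.
  apply: (@le_trans _ _ (N / C / E * (C * (E / turning_point V e1) * j E))).
    by rewrite ler_wpM2l// divr_ge0 ?divr_ge0// ltW.
  apply: eq_le_refl; rewrite /N /half_phase -/s; field.
  by rewrite !gt_eqF.
- rewrite /e2 lnM ?posrE ?expR_gt0// expRK addrC addKr.
  by apply: eq_le_refl; field; rewrite !gt_eqF.
exists E; split => //.
have hE' : e1 / 2 <= E <= 2 * e2 by lra.
have [u [v [J [S ua vd _ _]]]] := H E hE'.
have [u' [v' [J' [S' ua' vd' _ _]]]] := H' E hE'.
exists u, v, u', v'; split => //; rewrite ua vd ua' vd'.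
by apply: (mulfI (lt0r_neq0 s0)); rewrite mulr0 -[RHS]yE; ring.
Qed.

(** On [[e1, 2 * e1]] freezing the weight and the turning points at [e1] costs bounded factors, so
    the angular velocity is at most a constant [rho]. A far larger [e2] needs a different, trivial
    argument. *)
Lemma matching_gap (c0 C : R) : spectral_rates K c0 C -> 0 < C -> 0 < c0 ->
  forall e1 e2, 0 < e1 -> c0 <= half_phase V e1 -> c0 <= half_phase W e1 ->
    e1 < e2 -> e2 <= 2 * e1 -> matching V W e1 -> matching V W e2 ->
    e1 <= 4 * C * 2 ^+ K * (half_phase V e1 + half_phase W e1) * (e2 - e1).
Proof.
move=> rate C0 c00 e1 e2 e10 c0V c0W e12 e212 m1 m2.
have [a [d [j [H ro]]]] := spectral_family PV (e1 / 2) (2 * e2).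
have [a' [d' [j' [H' ro']]]] := spectral_family PW (e1 / 2) (2 * e2).
pose s := Num.sqrt e1.
have s0 : 0 < s by rewrite sqrtr_gt0.
have sE : s ^+ 2 = e1 by rewrite sqr_sqrtr// ltW.
have rot := family s ro ro'.
have p0 : 0 < 2 ^+ K :> R by rewrite exprn_gt0.
(* The factor 2 compares [E * a ^+ 2] with [e1 * a ^+ 2]; [2 ^+ K] compares the turning points at
   [E] and [e1]. *)
pose G X := 2 * C * 2 ^+ K * X / e1.
have half V' (PV' : half_line_potential K V') E b c i : c0 <= half_phase V' e1 ->
    spectral_data (V := V') E b c i -> e1 <= E <= e2 ->
    [/\ 0 < (s * b) ^+ 2 + c ^+ 2, 0 < i & i <= G (turning_point V' e1) * ((s * b) ^+ 2 + c ^+ 2)].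
  move=> c0V' HS hE.
  have E0 : 0 < E by lra.
  have [X0 _] := turning_pointP PV' E0.
  have c0E : c0 <= half_phase V' E.
    by apply: le_trans c0V' _; apply: (half_phase_le PV') => //; lra.
  have [h1 _ A0 i0] := rate _ _ _ _ _ PV' E0 c0E HS.
  have nA : c ^+ 2 + E * b ^+ 2 <= 2 * ((s * b) ^+ 2 + c ^+ 2).
    rewrite exprMn sE; have := sqr_ge0 c.
    have : E * b ^+ 2 <= 2 * e1 * b ^+ 2 by rewrite ler_wpM2r ?sqr_ge0//; lra.
    by lra.
  split; [by lra|by []|].
  have [X10 _] := turning_pointP PV' e10.
  have XE : turning_point V' E <= 2 ^+ K * turning_point V' e1.
    apply: le_trans (turning_point_scale PV' e10 _); last by rewrite ler1n.
    by apply: (turning_point_le PV') => //; lra.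
  apply: le_trans h1 _.
  apply: (@le_trans _ _ (C * (2 ^+ K * turning_point V' e1 / e1) * (2 * ((s * b) ^+ 2 + c ^+ 2)))).
    apply: ler_pM => //; [by rewrite mulr_ge0 ?divr_ge0// ltW|exact: ltW|].
    rewrite ler_pM2l//; apply: ler_pM => //; [exact: ltW|by rewrite invr_ge0 ltW|].
    by rewrite lef_pV2 ?posrE//; lra.
  by apply: eq_le_refl; rewrite /G; ring.
have hV E : e1 <= E <= e2 -> spectral_data (V := V) E (a E) (d E) (j E).
  by move=> hE; apply: H; lra.
have hW E : e1 <= E <= e2 -> spectral_data (V := W) E (a' E) (d' E) (j' E).
  by move=> hE; apply: H'; lra.
pose rho := s * (G (turning_point V e1) + G (turning_point W e1)).
have zero E : e1 <= E <= e2 -> matching V W E -> s * a E * d' E + d E * (s * a' E) = 0.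
  move=> hE mE; have [u [v [J [S <- <- _ _]]]] := hV E hE.
  have [u' [v' [J' [S' <- <- _ _]]]] := hW E hE.
  have := mE _ _ _ _ S S' => h.
  by rewrite -[RHS](mulr0 s) -[X in _ = s * X]h; ring.
have h : 1 / 2 <= rho * (e2 - e1).
  have le1 : e1 / 2 < e1 by lra.
  have re2 : e2 < 2 * e2 by lra.
  apply: (rotating_zero_gap rot le1 e12 re2).
  - move=> E hE; rewrite product_norm.
    have [n0 _ _] := half _ PV _ _ _ _ c0V (hV E hE) hE.
    have [n'0 _ _] := half _ PW _ _ _ _ c0W (hW E hE) hE.
    by rewrite mulr_gt0.
  - move=> E hE; rewrite product_norm.
    have [n0 j0 hj] := half _ PV _ _ _ _ c0V (hV E hE) hE.
    have [n'0 j'0 hj'] := half _ PW _ _ _ _ c0W (hW E hE) hE.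
    move: n0 n'0 hj hj'; set n := (s * a E) ^+ 2 + d E ^+ 2; set n' := (s * a' E) ^+ 2 + d' E ^+ 2.
    move=> n0 n'0 hj hj'.
    apply/andP; split; first by rewrite addr_gt0// mulr_gt0// mulr_gt0.
    rewrite [leRHS](_ : _ = s * (G (turning_point V e1) * n) * n' + s * (G (turning_point W e1) * n') * n); last by rewrite /rho; ring.
    by apply: lerD; rewrite ler_pM2r// ler_pM2l.
  - by apply: zero => //; lra.
  - by apply: zero => //; lra.
have -> : 4 * C * 2 ^+ K * (half_phase V e1 + half_phase W e1) * (e2 - e1) = 2 * e1 * (rho * (e2 - e1)).
  by rewrite /rho /G /half_phase -/s; field; rewrite gt_eqF.
have : 2 * e1 * (1 / 2) <= 2 * e1 * (rho * (e2 - e1)) by rewrite ler_pM2l//; lra.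
by lra.
Qed.

End TwoSided.

(** * A Green function bound for test functions *)

Section Green.
Context {R : realType}.
Implicit Types (u v V W f g r : R -> R) (x y t E : R) (K : nat).

Definition compactly_supported f := exists b : R, forall x, b <= `|x| -> f x = 0.

Lemma deriv_zero_outside f f' b : (forall x, b < `|x| -> f x = 0) ->
  (forall x, is_derive x 1 f (f' x)) -> forall x, b < `|x| -> f' x = 0.
Proof.
move=> f0 df x bx.
have h : is_derive x 1 f 0.
  apply: (@near_eq_is_derive _ _ _ (fun=> 0)) => //.
  by near=> y; rewrite f0//; near: y; apply: (cvgr_norm_gt x).
by have [_ <-] := df x; have [_ ->] := h.
Unshelve. all: by end_near. Qed.

Section Half.
Context {K : nat} {V : R -> R} (PV : half_line_potential K V).
Context {E : R} {u v : R -> R} (S : decaying_solution (V := V) E u v).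

(* Pairs [r] with [u] by AM-GM with weight [1 / d]. *)
Lemma wronskian_bound (a : R) : exists C, 0 <= C /\ forall f f' f'' (d : R) Q,
  0 < d -> (forall x, is_derive x 1 f (f' x)) -> (forall x, is_derive x 1 f' (f'' x)) ->
  compactly_supported f ->
  (forall x, is_derive x 1 Q ((- f'' x + V x * f x - E * f x) ^+ 2)) ->
  (forall x y, Q y - Q x <= d ^+ 2) ->
  forall x, - a <= x -> `|f x * v x - f' x * u x| <= C * d.
Proof.
have [du dv] : solves (fun x => V x - E) u v by case: S.
have [J [J0 dJ]] := sqr_primitive_exists du.
have [j Jj] := decaying_primitive_bounded PV S dJ.
have J_le s t : s <= t -> J s <= J t by exact: sqr_primitive_le.
exists ((1 + (j - J (- a))) / 2); split.
  by rewrite divr_ge0// addr_ge0// subr_ge0.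
move=> f f' f'' d Q d0 df df' [b fb] dQ Qd x ax.
pose y := Num.max x (`|b| + 1).
have [xy by_] : x <= y /\ `|b| + 1 <= y by rewrite !le_max !lexx orbT.
have by' : b < `|y| by have := ler_norm b; have := ler_norm y; lra.
have f'y := deriv_zero_outside (fun z bz => fb z (ltW bz)) df by'.
have fy := fb y (ltW by').
apply: norm_le_of_signs => s s1.
pose r t := - f'' t + V t * f t - E * f t.
have D t : is_derive t 1 (fun t => s * (f t * v t - f' t * u t) + (d^-1 * Q t + d * J t) / 2)
   (s * (r t * u t) + (d^-1 * r t ^+ 2 + d * u t ^+ 2) / 2).
  by rewrite /r; dsolve; ring.
have : s * (f x * v x - f' x * u x) + (d^-1 * Q x + d * J x) / 2 <=
    s * (f y * v y - f' y * u y) + (d^-1 * Q y + d * J y) / 2.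
  apply: (gderiv_ge0_le xy (fun t _ => D t)) => t _.
  have -> : s * (r t * u t) + (d^-1 * r t ^+ 2 + d * u t ^+ 2) / 2 = (r t + s * d * u t) ^+ 2 / (2 * d).
    by case: s1 => ->; field; rewrite gt_eqF.
  by rewrite divr_ge0 ?sqr_ge0// mulr_ge0// ltW.
rewrite fy f'y !mul0r subrr mulr0 add0r.
have h1 : d^-1 * (Q y - Q x) <= d.
  by rewrite ler_pdivrMl// -expr2.
have h2 : d * (J y - J x) <= d * (j - J (- a)).
  by rewrite ler_pM2l// lerB// J_le.
move: h1 h2; rewrite !mulrBr => h1 h2 h3.
rewrite [leRHS](_ : _ = (d + (d * j - d * J (- a))) / 2); last by ring.
by lra.
Qed.

End Half.

(** Variation of constants: the Wronskians of [f] with the two decaying solutions are controlled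
    from either end, and they determine [f] linearly with determinant the matching defect. The L^2
    norm of the residual appears as the total increment of a primitive [Q]. *)
Lemma green_bound K V E u v u' v' (a : R) : half_line_potential K V ->
  half_line_potential K (fun x => V (- x)) ->
  decaying_solution (V := V) E u v -> decaying_solution (V := fun x => V (- x)) E u' v' ->
  u 0 * v' 0 + v 0 * u' 0 != 0 ->
  exists C, 0 <= C /\ forall f f' f'' (d : R) Q,
  0 < d -> (forall x, is_derive x 1 f (f' x)) -> (forall x, is_derive x 1 f' (f'' x)) ->
  compactly_supported f ->
  (forall x, is_derive x 1 Q ((- f'' x + V x * f x - E * f x) ^+ 2)) ->
  (forall x y, Q y - Q x <= d ^+ 2) ->
  forall x, - a <= x <= a -> `|f x| <= C * d.
Proof.
move=> PV PW S S' w0.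
have [C1 [C10 H1]] := wronskian_bound PV S a.
have [C2 [C20 H2]] := wronskian_bound PW S' a.
have [du dv] : solves (fun x => V x - E) u v by case: S.
have [du' dv'] : solves (fun x => V (- x) - E) u' v' by case: S'.
have [M M0 uM] := continuous_bounded a (deriv_continuous du).
have [M' M'0 u'M] := continuous_bounded a (deriv_continuous du').
set w := u 0 * v' 0 + v 0 * u' 0 in w0.
exists ((M' * C1 + M * C2) / `|w|); split.
  by rewrite divr_ge0// addr_ge0// mulr_ge0// ltW.
move=> f f' f'' d Q d0 df df' cf dQ Qd x xa.
have h1 := H1 f f' f'' d Q d0 df df' cf dQ Qd x (andP xa).1.
have cf' : compactly_supported (fun x => f (- x)).
  by case: cf => b fb; exists b => y by_; apply: fb; rewrite normrN.
have df1 y : is_derive y 1 (fun y => f (- y)) (- f' (- y)) by exact: is_derive_reflect.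
have df2 y : is_derive y 1 (fun y => - f' (- y)) (f'' (- y)).
  by have h := is_deriveNf (is_derive_reflect (df' (- y))); apply: (is_derive_eq h); ring.
have dQ' y : is_derive y 1 (fun y => - Q (- y)) ((- f'' (- y) + V (- y) * f (- y) - E * f (- y)) ^+ 2).
  by have h := is_deriveNf (is_derive_reflect (dQ (- y))); apply: (is_derive_eq h); ring.
have := H2 (fun y => f (- y)) (fun y => - f' (- y)) (fun y => f'' (- y)) d (fun y => - Q (- y)) d0 df1 df2 cf' dQ'.
move=> /(_ _ (- x) _); rewrite !opprK => h2.
have {}h2 : `|f x * v' (- x) - - f' x * u' (- x)| <= C2 * d.
  by apply: h2 => [s t|]; [have := Qd (- t) (- s); lra|lra].
have Wc : u x * v' (- x) + v x * u' (- x) = w.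
  have := solves_reflect (conj du' dv') => S2.
  rewrite (_ : (fun _ => _) = (fun x => V x - E)) in S2; last by apply/funext => y; rewrite opprK.
  have := wronskian_const x 0 (conj du dv) S2; rewrite oppr0 /w => h; lra.
have -> : f x = (u' (- x) * (f x * v x - f' x * u x) + u x * (f x * v' (- x) - - f' x * u' (- x))) / w.
  by rewrite -Wc; field; rewrite Wc.
rewrite normrM normfV [leRHS]mulrAC ler_pM2r ?invr_gt0 ?normr_gt0//.
apply: le_trans (ler_normD _ _) _; rewrite !normrM [leRHS]mulrDl -!mulrA.
by apply: lerD; apply: ler_pM => //; [apply: u'M; lra|apply: uM; lra].
Qed.

End Green.

(** * From L^2 convergence to estimates on primitives *)

Section EigenvalueMatching.
Context {R : realType}.
Local Notation mu := (@lebesgue_measure R).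

Lemma Lnorm2_sqr (h : R -> R) :
  (Lnorm mu 2%:E (EFin \o h) `^ 2 = \int[mu]_x (h x ^+ 2)%:E)%E.
Proof.
rewrite powR_Lnorm ?gt_eqF//; apply: eq_integral => x _ /=.
by rewrite powR_mulrn// real_normK// num_real.
Qed.

Lemma normc_sqr (z : R[i]) : Normc.normc z ^+ 2 = complex.Re z ^+ 2 + complex.Im z ^+ 2.
Proof. by case: z => a b /=; rewrite sqr_sqrtr// addr_ge0 ?sqr_ge0. Qed.

Lemma cvgL2_integral (u : nat -> R -> R[i]) (f : R -> R[i]) : cvgL2 u f ->
  forall e : R, 0 < e -> \forall k \near \oo, (\int[mu]_x
    ((reF (u k) x - reF f x) ^+ 2 + (imF (u k) x - imF f x) ^+ 2)%:E <= e%:E)%E.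
Proof.
move=> /fine_cvgP[fin /cvgrPdist_lt H] e e0.
have s0 : 0 < Num.sqrt e by rewrite sqrtr_gt0.
near=> k.
have fk : (Lnorm mu 2%:E (fun x => (Normc.normc (u k x - f x))%:E) \is a fin_num)%E by near: k.
have hk : `|0 - fine (Lnorm mu 2%:E (fun x => (Normc.normc (u k x - f x))%:E))| < Num.sqrt e.
  by near: k; exact: H.
have -> : (\int[mu]_x ((reF (u k) x - reF f x) ^+ 2 + (imF (u k) x - imF f x) ^+ 2)%:E =
  \int[mu]_x (Normc.normc (u k x - f x) ^+ 2)%:E)%E.
  apply: eq_integral => x _; rewrite normc_sqr /reF /imF.
  by case: (u k x) => a b; case: (f x).
rewrite -Lnorm2_sqr /comp -(fineK fk) poweR_EFin lee_fin powR_mulrn ?fine_ge0 ?Lnorm_ge0//.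
rewrite -[leRHS](@sqr_sqrtr _ e) ?(ltW e0)// ler_pXn2r ?nnegrE ?fine_ge0 ?Lnorm_ge0 ?sqrtr_ge0//.
by move: hk; rewrite sub0r normrN => /ltW; apply: le_trans; exact: ler_norm.
Unshelve. all: by end_near. Qed.

(** Turns an L^2 bound on a residual into the bound on increments that the Green estimate takes. *)
Lemma primitive_integral_le (h Q : R -> R) (e : R) : continuous h ->
  (forall x : R, is_derive x 1 Q (h x ^+ 2)) -> 0 <= e ->
  (\int[mu]_x (h x ^+ 2)%:E <= e%:E)%E -> forall x y, Q y - Q x <= e.
Proof.
move=> hc dQ e0 he x y.
have h2c : continuous (fun x => h x ^+ 2).
  by move=> t; rewrite (_ : (fun _ => _) = fun x => h x * h x)//; apply: continuousM; exact: hc.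
have [xy|yx] := ltP x y; last first.
  apply: le_trans e0; rewrite subr_le0.
  exact: sqr_primitive_le dQ yx.
rewrite -lee_fin EFinB; apply: le_trans he.
rewrite -(@continuous_FTC2 _ (fun x => h x ^+ 2) Q x y xy).
- apply: ge0_subset_integral => //.
    by apply/measurable_EFinP; exact: continuous_measurable_fun.
  by move=> t _; rewrite lee_fin sqr_ge0.
- exact: continuous_subspaceT.
- split.
  + by move=> t _; case: (dQ t).
  + by apply: cvg_at_right_filter; exact: is_derive_cts (dQ x).
  + by apply: cvg_at_left_filter; exact: is_derive_cts (dQ y).
- by move=> t _; rewrite derive1E; case: (dQ t).
Qed.

Lemma ae_zero_of_small_integrals (g : R -> R) : measurable_fun setT g ->
  (forall a : R, 0 < a -> exists C : R, forall d : R, 0 < d ->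
    (\int[mu]_(x in `[(- a)%R, a]) (g x ^+ 2)%:E <= (C * d ^+ 2)%:E)%E) ->
  {ae mu, forall x, g x = 0}.
Proof.
move=> mg H.
have mg2 (D : set R) : measurable D -> measurable_fun D (fun x => (g x ^+ 2)%:E).
  move=> mD; apply: measurable_funTS; apply/measurable_EFinP.
  exact: measurable_funX.
have step (n : nat) : {ae mu, forall x, - n.+1%:R <= x <= n.+1%:R -> g x = 0}.
  have [//|C HC] := H n.+1%:R.
  have I0 : (\int[mu]_(x in `[(- n.+1%:R)%R, n.+1%:R]) `|(g x ^+ 2)%:E| = 0)%E.
    under eq_integral do rewrite gee0_abs ?lee_fin ?sqr_ge0//.
    apply/eqP; rewrite eq_le integral_ge0 ?andbT; last by move=> x _; rewrite lee_fin sqr_ge0.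
    apply/lee_addgt0Pr => e e0; rewrite add0e.
    have [C0|C0] := leP C 0.
      by apply: le_trans (HC 1 ltr01) _; rewrite lee_fin expr1n mulr1; lra.
    pose d := Num.sqrt (e / C).
    have d0 : 0 < d by rewrite sqrtr_gt0 divr_gt0.
    apply: le_trans (HC d d0) _; rewrite lee_fin sqr_sqrtr ?divr_ge0 ?(ltW e0) ?(ltW C0)//.
    by rewrite mulrCA divff ?gt_eqF// mulr1.
  have mD := @measurable_itv R `[(- n.+1%:R)%R, n.+1%:R].
  have := (ae_eq_integral_abs mu mD (mg2 _ mD)).1 I0.
  apply: filterS => x + xn; rewrite /= in_itv/= => /(_ xn)[] /eqP.
  by rewrite sqrf_eq0 => /eqP.
have := ae_foralln step.
apply: filterS => x /(_ (Num.bound `|x|)); apply.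
have := archi_boundP (normr_ge0 x); have : (Num.bound `|x|)%:R <= (Num.bound `|x|).+1%:R :> R by rewrite ler_nat.
by rewrite -ler_norml; lra.
Qed.

Definition C2_compact (f : R -> R) := [/\ forall x : R, is_derive x 1 f (derive1 f x),
  forall x : R, is_derive x 1 (derive1 f) (derive1n 2 f x), continuous (derive1n 2 f) & compactly_supported f].

(** [p] is the real or the imaginary part. *)
Lemma Cc_infty_component (phi : R -> R[i]) (p : R[i] -> R) : p 0 = 0 ->
  smooth (p \o phi) -> compact (closure [set x | phi x != 0]) ->
  C2_compact (p \o phi).
Proof.
move=> p0 sm cpt; split.
- by move=> x; have := sm 0%N x; rewrite derive1E => /derivableP.
- by move=> x; have := sm 1%N x; rewrite derive1n1 => h; rewrite derive1nS derive1n1 derive1E; apply/derivableP.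
- by move=> x; apply: differentiable_continuous; apply/derivable1_diffP; exact: (sm 2%N x).
have [M [Mr HM]] := compact_bounded cpt.
exists (`|M| + 2) => x Mx /=; have [->//|/eqP px] := eqVneq (phi x) 0.
have /HM/(_ x) : M < `|M| + 1 by have := ler_norm M; lra.
have cx : closure [set x | phi x != 0] x by apply: subset_closure; apply/eqP.
by move=> /(_ cx) /=; lra.
Qed.

End EigenvalueMatching.

(** * Every eigenvalue is a matching energy *)

Section EigenvalueImpliesMatching.
Context {R : realType}.
Local Notation mu := (@lebesgue_measure R).
Implicit Types (V g : R -> R) (f phi : R -> R[i]) (E : R) (K : nat).

Lemma inL2_measurable f : inL2 f -> measurable_fun setT (reF f) /\ measurable_fun setT (imF f).
Proof.
move=> [h1 h2]; split; apply: set_mem.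
- exact: (sub_Lfun_mfun h1).
- exact: (sub_Lfun_mfun h2).
Qed.

Lemma reF_schrodinger V phi : reF (schrodinger V phi) = fun x => - derive1n 2 (reF phi) x + V x * reF phi x.
Proof.
apply/funext => x; rewrite /reF /schrodinger /cderive2 /=.
by case: (phi x) => a b /=; rewrite mul0r subr0.
Qed.

Lemma imF_schrodinger V phi : imF (schrodinger V phi) = fun x => - derive1n 2 (imF phi) x + V x * imF phi x.
Proof.
apply/funext => x; rewrite /imF /schrodinger /cderive2 /=.
by case: (phi x) => a b /=; rewrite mul0r addr0.
Qed.

Lemma reF_scale E f : reF (fun x => real_complex R E * f x) = fun x => E * reF f x.
Proof. by apply/funext => x; rewrite /reF; case: (f x) => a b /=; rewrite mul0r subr0. Qed.

Lemma imF_scale E f : imF (fun x => real_complex R E * f x) = fun x => E * imF f x.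
Proof. by apply/funext => x; rewrite /imF; case: (f x) => a b /=; rewrite mul0r addr0. Qed.

Lemma sum_integral_le (h1 h2 h : R -> R) (D : set R) (c1 c2 e1 e2 : R) : measurable D ->
  measurable_fun setT h1 -> measurable_fun setT h2 -> measurable_fun setT h ->
  (forall x, 0 <= h1 x) -> (forall x, 0 <= h2 x) -> 0 <= c1 -> 0 <= c2 ->
  (forall x, D x -> 0 <= h x <= c1 * h1 x + c2 * h2 x) ->
  (\int[mu]_(x in D) (h1 x)%:E <= e1%:E)%E -> (\int[mu]_(x in D) (h2 x)%:E <= e2%:E)%E ->
  (\int[mu]_(x in D) (h x)%:E <= (c1 * e1 + c2 * e2)%:E)%E.
Proof.
move=> mD m1 m2 mh p1 p2 c10 c20 hle i1 i2.
have mE (k : R -> R) : measurable_fun setT k -> measurable_fun D (fun x => (k x)%:E).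
  by move=> mk; apply: measurable_funTS; apply/measurable_EFinP.
apply: (@le_trans _ _ (\int[mu]_(x in D) (c1%:E * (h1 x)%:E + c2%:E * (h2 x)%:E))%E).
  apply: ge0_le_integral => //.
  - by move=> x /hle/andP[]; rewrite lee_fin.
  - exact: mE.
  - by apply: emeasurable_funD; apply: measurable_funeM; exact: mE.
  - by move=> x /hle/andP[_]; rewrite -!EFinM -EFinD lee_fin.
rewrite ge0_integralD//; first last.
- by apply: measurable_funeM; exact: mE.
- by move=> x _; rewrite mule_ge0// lee_fin.
- by apply: measurable_funeM; exact: mE.
- by move=> x _; rewrite mule_ge0// lee_fin.
rewrite !ge0_integralZl_EFin//; first last.
- exact: mE.
- by move=> x _; rewrite lee_fin.
- exact: mE.
- by move=> x _; rewrite lee_fin.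
by rewrite EFinD !EFinM; apply: leeD; apply: lee_pmul => //; apply: integral_ge0 => x _; rewrite lee_fin.
Qed.

Lemma schrodinger_continuous V g : continuous (derive1n 2 g) -> continuous V -> continuous g ->
  continuous (fun x => - derive1n 2 g x + V x * g x).
Proof.
move=> c2 Vc gc x.
have h1 : {for x, continuous (fun x => - derive1n 2 g x)} by apply: continuousN; exact: c2.
have h2 : {for x, continuous (fun x => V x * g x)} by apply: continuousM; [exact: Vc|exact: gc].
exact: (@continuousD R R R _ _ _ h1 h2).
Qed.

(** Treats one real component [g] of an eigenfunction. [D1] and [D2] dominate the squared errors
    because L^2 convergence controls the sum over both components. The Green bound makes the
    approximants small on compact sets, so [g] is arbitrarily small there. *)
Lemma small_component K V E u v u' v' (g : R -> R) (psi : nat -> R -> R) (D1 D2 : nat -> R -> R) :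
  half_line_potential K V -> half_line_potential K (fun x => V (- x)) ->
  decaying_solution (V := V) E u v -> decaying_solution (V := fun x => V (- x)) E u' v' ->
  u 0 * v' 0 + v 0 * u' 0 != 0 -> measurable_fun setT g ->
  (forall k, C2_compact (psi k)) ->
  (forall k, measurable_fun setT (D1 k) /\ measurable_fun setT (D2 k)) ->
  (forall k x, (psi k x - g x) ^+ 2 <= D1 k x) ->
  (forall k x, (- derive1n 2 (psi k) x + V x * psi k x - E * g x) ^+ 2 <= D2 k x) ->
  (forall e : R, 0 < e -> \forall k \near \oo, (\int[mu]_x (D1 k x)%:E <= e%:E)%E) ->
  (forall e : R, 0 < e -> \forall k \near \oo, (\int[mu]_x (D2 k x)%:E <= e%:E)%E) ->
  {ae mu, forall x, g x = 0}.
Proof.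
move=> PV PW S S' w0 mg Hpsi mD Hg Hr I1 I2.
have Vc : continuous V by case: PV.
have D10 k x : 0 <= D1 k x by apply: le_trans (Hg k x); exact: sqr_ge0.
have D20 k x : 0 <= D2 k x by apply: le_trans (Hr k x); exact: sqr_ge0.
apply: ae_zero_of_small_integrals => // a a0.
have [C [C0 HC]] := green_bound a PV PW S S' w0.
(* From [g ^+ 2 <= 2 * D1 + 2 * psi ^+ 2], with [|psi| <= C * d] on an interval of length
   [2 * a]. *)
exists (2 + 2 * C ^+ 2 * (2 * a)) => d d0.
(* The residual of [psi] with [E * psi] in place of [E * g] has square at most
   [2 * D2 + 2 * E ^+ 2 * D1]; this [e] makes its integral at most [d ^+ 2]. *)
pose e := d ^+ 2 / (2 + 2 * E ^+ 2).
have E20 := sqr_ge0 E.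
have den : 0 < 2 + 2 * E ^+ 2 by lra.
have d20 : 0 < d ^+ 2 by rewrite exprn_gt0.
have e0 : 0 < e by rewrite divr_gt0.
have ed : e <= d ^+ 2 by rewrite ler_pdivrMr// ler_peMr ?(ltW d20)//; lra.
have [k [i1 i2]] := filter_ex (filterI (I1 e e0) (I2 e e0)).
have [dp dp' cp'' cs] := Hpsi k.
have [mD1 mD2] := mD k.
have pc : continuous (psi k) := deriv_continuous dp.
pose r : R -> R := fun x => - derive1n 2 (psi k) x + V x * psi k x - E * psi k x.
have rc : continuous r.
  move=> x.
  have h3 : {for x, continuous (fun x => E * psi k x)} by apply: continuousM; [exact: cst_continuous|exact: pc].
  have h4 : {for x, continuous (fun x => - derive1n 2 (psi k) x + V x * psi k x)}.
    exact: schrodinger_continuous.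
  exact: (@continuousB R R R _ _ _ h4 h3).
have r2c : continuous (fun x => r x ^+ 2).
  by move=> t; rewrite (_ : (fun _ => _) = fun x => r x * r x)//; apply: continuousM; exact: rc.
have ir : (\int[mu]_x (r x ^+ 2)%:E <= (d ^+ 2)%:E)%E.
  have -> : d ^+ 2 = 2 * e + 2 * E ^+ 2 * e by rewrite /e; field; rewrite gt_eqF.
  apply: (sum_integral_le (h1 := D2 k) (h2 := D1 k)) => //.
  - exact: continuous_measurable_fun.
  - by rewrite mulr_ge0.
  move=> x _; rewrite sqr_ge0/=.
  have h1 := Hr k x; have h2 := Hg k x.
  set A := - derive1n 2 (psi k) x + V x * psi k x - E * g x in h1.
  have -> : r x = A - E * (psi k x - g x) by rewrite /r /A; ring.
  have h3 : E ^+ 2 * (psi k x - g x) ^+ 2 <= E ^+ 2 * D1 k x by rewrite ler_wpM2l.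
  have := sqr_ge0 (A + E * (psi k x - g x)).
  by move: h3; rewrite -exprMn -mulrA; set B := E * (psi k x - g x) => h3 h4; nra.
have [Q [_ dQ]] := primitive_exists r2c.
have QQ := primitive_integral_le rc dQ (ltW d20) ir.
have Hp := HC (psi k) (derive1 (psi k)) (derive1n 2 (psi k)) d Q d0 dp dp' cs dQ QQ.
have mI : measurable `[(- a)%R, a] by exact: measurable_itv.
have -> : (2 + 2 * C ^+ 2 * (2 * a)) * d ^+ 2 = 2 * d ^+ 2 + 1 * (2 * (C * d) ^+ 2 * (2 * a)) by ring.
apply: (sum_integral_le (h1 := D1 k) (h2 := fun=> 2 * (C * d) ^+ 2)) => //.
- exact: measurable_funX.
- by move=> x; rewrite mulr_ge0 ?sqr_ge0.
- move=> x; rewrite /= in_itv/= => /Hp; rewrite sqr_ge0/= mul1r => hp.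
  have hp2 : psi k x ^+ 2 <= (C * d) ^+ 2.
    by rewrite -[leLHS]real_normK ?num_real// ler_pXn2r ?nnegrE ?mulr_ge0// ltW.
  have h2 := Hg k x; have := sqr_ge0 (g x - 2 * psi k x).
  by nra.
- apply: (@le_trans _ _ (\int[mu]_x (D1 k x)%:E)%E).
    apply: ge0_subset_integral => //; first exact/measurable_EFinP.
    by move=> x _; rewrite lee_fin.
  by apply: le_trans i1 _; rewrite lee_fin.
- have mu_a : mu `[(- a)%R, a] = (2 * a)%:E.
    have -> : 2 * a = a - - a by ring.
    rewrite lebesgue_measure_itv/= lte_fin ifT; last by lra.
    by rewrite -EFinB.
  have := integral_cst mu mI (2 * (C * d) ^+ 2)%:E; rewrite /cst => ->.
  by rewrite [X in (_ * X)%E]mu_a -EFinM.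
Qed.

Lemma eigenvalue_matching K V E : half_line_potential K V ->
  half_line_potential K (fun x => V (- x)) -> eigenvalue_of V E ->
  matching V (fun x => V (- x)) E.
Proof.
move=> PV PW [f [fnz [fL2 EfL2 [phi [cc cv1 cv2]]]]] u v u' v' S S'.
apply/eqP; apply: contrapT => /negP w0; apply: fnz.
have Vc : continuous V by case: PV.
have [mre mim] := inL2_measurable fL2.
have fst_ k : C2_compact (reF (phi k)).
  by have [h1 h2 h3] := cc k; exact: (Cc_infty_component (p := @complex.Re R)).
have snd_ k : C2_compact (imF (phi k)).
  by have [h1 h2 h3] := cc k; exact: (Cc_infty_component (p := @complex.Im R)).
pose D1 k x := (reF (phi k) x - reF f x) ^+ 2 + (imF (phi k) x - imF f x) ^+ 2.
pose D2 k x := (- derive1n 2 (reF (phi k)) x + V x * reF (phi k) x - E * reF f x) ^+ 2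
  + (- derive1n 2 (imF (phi k)) x + V x * imF (phi k) x - E * imF f x) ^+ 2.
have I1 : forall e : R, 0 < e -> \forall k \near \oo, (\int[mu]_x (D1 k x)%:E <= e%:E)%E.
  exact: cvgL2_integral cv1.
have I2 : forall e : R, 0 < e -> \forall k \near \oo, (\int[mu]_x (D2 k x)%:E <= e%:E)%E.
  move=> e e0; have := cvgL2_integral cv2 e0; apply: filterS => k.
  by rewrite reF_schrodinger imF_schrodinger reF_scale imF_scale.
have mH (g : R -> R) : continuous (derive1n 2 g) -> continuous g ->
    measurable_fun setT (fun x => - derive1n 2 g x + V x * g x).
  move=> c2 c0; apply: continuous_measurable_fun => x.
  exact: (schrodinger_continuous c2 Vc c0).
have mD k : measurable_fun setT (D1 k) /\ measurable_fun setT (D2 k).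
  have [a1 a2 a3 _] := fst_ k; have [b1 b2 b3 _] := snd_ k.
  have ca := deriv_continuous a1; have cb := deriv_continuous b1.
  split; apply: measurable_funD; apply: measurable_funX; apply: measurable_funB.
  - exact: continuous_measurable_fun.
  - exact: mre.
  - exact: continuous_measurable_fun.
  - exact: mim.
  - exact: mH.
  - by apply: measurable_funM => //; exact: measurable_cst.
  - exact: mH.
  - by apply: measurable_funM => //; exact: measurable_cst.
have z1 : {ae mu, forall x, reF f x = 0}.
  apply: (small_component PV PW S S' w0 mre fst_ mD _ _ I1 I2) => k x.
    by rewrite /D1 lerDl sqr_ge0.
  by rewrite /D2 lerDl sqr_ge0.
have z2 : {ae mu, forall x, imF f x = 0}.
  apply: (small_component PV PW S S' w0 mim snd_ mD _ _ I1 I2) => k x.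
    by rewrite /D1 lerDr sqr_ge0.
  by rewrite /D2 lerDr sqr_ge0.
apply: (@filterS2 _ _ (ae_filter_ringOfSetsType mu) _ _ _ _ z1 z2) => x; rewrite /reF /imF.
by case: (f x) => a b /= -> ->.
Qed.

End EigenvalueImpliesMatching.

(** * Weierstrass approximation by Bernstein polynomials *)

Section Weierstrass.
Context {R : realType}.
Implicit Types (f g : nat -> R) (x a : R) (n : nat).

(* [bernstein n f] is the mean of [f] under the binomial law, conditioned on
   the first trial. *)
Fixpoint bernstein n f : {poly R} :=
  if n is m.+1 then (1 - 'X) * bernstein m f + 'X * bernstein m (fun k => f k.+1)
  else (f 0%N)%:P.

Lemma bernsteinS n f x : (bernstein n.+1 f).[x] =
  (1 - x) * (bernstein n f).[x] + x * (bernstein n (fun k => f k.+1)).[x].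
Proof. by rewrite /= !hornerE. Qed.

Lemma bernstein_le n f g x : 0 <= x <= 1 -> (forall k, (k <= n)%N -> f k <= g k) ->
  (bernstein n f).[x] <= (bernstein n g).[x].
Proof.
move=> x01; elim: n f g => [|n IH] f g fg; first by rewrite /= !hornerE fg.
rewrite !bernsteinS; apply: lerD; rewrite ler_wpM2l//; try lra.
  by apply: IH => k kn; apply: fg; exact: leqW.
by apply: IH => k kn; exact: fg.
Qed.

Lemma bernstein_linear n f g a (c : R) x :
  (bernstein n (fun k => c * f k + a * g k)).[x] = c * (bernstein n f).[x] + a * (bernstein n g).[x].
Proof.
elim: n f g => [|n IH] f g; first by rewrite /= !hornerE.
by rewrite !bernsteinS IH (IH (fun k => f k.+1) (fun k => g k.+1)); ring.
Qed.

Lemma bernstein_cst n c x : (bernstein n (fun=> c)).[x] = c.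
Proof. by elim: n => [|n IH]; [rewrite /= hornerE|rewrite bernsteinS IH; ring]. Qed.

(** The free shift [a] lets the recursion close; [a = - n x] gives the binomial variance. *)
Lemma bernstein_moment n a x :
  (bernstein n (fun k => (k%:R + a) ^+ 2)).[x] = (n%:R * x + a) ^+ 2 + n%:R * x * (1 - x).
Proof.
elim: n a => [|n IH] a; first by rewrite /= hornerE !mul0r addr0 add0r.
rewrite bernsteinS IH (_ : (fun k => (k.+1%:R + a) ^+ 2) = (fun k => (k%:R + (1 + a)) ^+ 2)); last first.
  by apply/funext => k; rewrite -natr1 addrA.
by rewrite IH -natr1; ring.
Qed.

Lemma uniform_continuity (g : R -> R) (b e : R) : continuous g -> 0 < e ->
  exists2 d, 0 < d & forall x y, - b <= x <= b -> `|x - y| < d -> `|g x - g y| <= e.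
Proof.
move=> gc e0.
have cpt : compact `[- b, b] by exact: segment_compact.
pose P (d x : R) := forall y, `|x - y| < d -> `|g x - g y| <= e.
have loc x : [set` `[- b, b]] x -> \forall x' \near x & i \near 0^'+, P i x'.
  move=> _; have e2 : 0 < e / 2 by rewrite divr_gt0.
  have /cvgrPdist_lt/(_ _ e2)/nbhs_ballP[d /= d0 Hd] := gc x.
  have d2 : 0 < d / 2 by rewrite divr_gt0.
  exists (ball x (d / 2), [set i | 0 < i < d / 2]) => /=.
    split; first exact: nbhsx_ballx.
    near=> i; apply/andP; split; near: i; [exact: nbhs_right_gt|exact: nbhs_right_lt].
  move=> [x' i] /= [hx /andP[i0 id]] y hy.
  have h1 := Hd x' _; have h2 := Hd y _.
  move: hx; rewrite /ball/= ltr_norml => hx; move: hy; rewrite ltr_norml => hy.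
  have {}h1 : `|g x - g x'| < e / 2 by apply: h1; rewrite /ball/= ltr_norml; lra.
  have {}h2 : `|g x - g y| < e / 2 by apply: h2; rewrite /ball/= ltr_norml; lra.
  by move: h1 h2; rewrite !ltr_norml ler_norml; lra.
have H := (compact_near_coveringP _).1 cpt R (0 : R)^'+ P _ loc.
have {}H : \forall d \near (0 : R)^'+, [set` `[- b, b]] `<=` P d by exact: H.
near (0 : R)^'+ => d.
have d0 : 0 < d by near: d; exact: nbhs_right_gt.
have Hd : [set` `[- b, b]] `<=` P d by near: d.
by exists d => // x y xb; apply: (Hd x); rewrite /= in_itv.
Unshelve. all: by end_near. Qed.

(** Chebyshev's argument: [|g x - g (k / n)|] is at most [e / 2] plus a multiple of
    [(k - n x) ^+ 2], and the binomial mean of the latter is the variance. *)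
Lemma weierstrass01 (g : R -> R) (e : R) : continuous g -> 0 < e ->
  exists p : {poly R}, forall x, 0 <= x <= 1 -> `|g x - p.[x]| <= e.
Proof.
move=> gc e0; have e2 : 0 < e / 2 by rewrite divr_gt0.
have [d d0 gd] := uniform_continuity 1 gc e2.
have [M M0 gM] := continuous_bounded 1 gc.
(* The variance term is [2 x (1 - x) M / (d ^+ 2 n)], at most [e / 2] once [n >= M / (d ^+ 2 e)], as
   [x (1 - x) <= 1 / 4]. *)
pose n := (Num.bound (M / (d ^+ 2 * e))).+1.
have n0 : (0 : R) < n%:R by rewrite ltr0n.
have nb : M / (d ^+ 2 * e) <= n%:R.
  have d2 : 0 < d ^+ 2 * e by rewrite mulr_gt0// exprn_gt0.
  have := archi_boundP (ltW (divr_gt0 M0 d2)).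
  by move=> /ltW h; apply: le_trans h _; rewrite /n ler_nat.
exists (bernstein n (fun k => g (k%:R / n%:R))) => x x01.
have gb k : (k <= n)%N -> `|g x - g (k%:R / n%:R)| <= e / 2 + 2 * M / (d ^+ 2 * n%:R ^+ 2) * (k%:R - n%:R * x) ^+ 2.
  move=> kn.
  have k01 : 0 <= (k%:R / n%:R : R) <= 1.
    by rewrite divr_ge0//= ler_pdivrMr// mul1r ler_nat.
  have [xk|xk] := ltP `|x - k%:R / n%:R| d.
    apply: le_trans (gd x _ _ xk) _; first by lra.
    by rewrite lerDl mulr_ge0 ?sqr_ge0// divr_ge0 ?mulr_ge0 ?sqr_ge0// ltW.
  apply: (@le_trans _ _ (2 * M)).
    apply: le_trans (ler_normB _ _) _.
    by have := gM x ltac:(lra); have := gM (k%:R / n%:R) ltac:(lra); lra.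
  have h : 1 <= (k%:R - n%:R * x) ^+ 2 / (d ^+ 2 * n%:R ^+ 2).
    rewrite ler_pdivlMr ?mulr_gt0 ?exprn_gt0// mul1r -exprMn -[leRHS]real_normK ?num_real//.
    rewrite ler_pXn2r ?nnegrE ?mulr_ge0 ?(ltW d0) ?(ltW n0)//.
    have -> : k%:R - n%:R * x = - ((x - k%:R / n%:R) * n%:R) by field; rewrite gt_eqF.
    by rewrite normrN normrM (gtr0_norm n0) ler_pM2r.
  have h2 : 2 * M * 1 <= 2 * M * ((k%:R - n%:R * x) ^+ 2 / (d ^+ 2 * n%:R ^+ 2)).
    by rewrite ler_wpM2l// mulr_ge0// ltW.
  have -> : 2 * M / (d ^+ 2 * n%:R ^+ 2) * (k%:R - n%:R * x) ^+ 2 = 2 * M * ((k%:R - n%:R * x) ^+ 2 / (d ^+ 2 * n%:R ^+ 2)) by ring.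
  by lra.
pose c := 2 * M / (d ^+ 2 * n%:R ^+ 2).
apply: norm_le_of_signs => s s1.
have := @bernstein_le n (fun k => - s * g (k%:R / n%:R) + s * g x) (fun k => 1 * (e / 2) + c * (k%:R + (- (n%:R * x))) ^+ 2) x x01.
rewrite (bernstein_linear n (fun k => g (k%:R / n%:R)) (fun=> g x)) bernstein_cst.
rewrite (bernstein_linear n (fun=> e / 2) (fun k => (k%:R + (- (n%:R * x))) ^+ 2)) bernstein_cst bernstein_moment.
rewrite subrr expr0n/= add0r mul1r => H.
have : c * (n%:R * x * (1 - x)) <= e / 2.
  have x4 : x * (1 - x) <= 1 / 4 by have := sqr_ge0 (x - 1 / 2); nra.
  have -> : c * (n%:R * x * (1 - x)) = 2 * (x * (1 - x)) * (M / (d ^+ 2 * n%:R)).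
    by rewrite /c; field; rewrite !gt_eqF.
  have h : M / (d ^+ 2 * n%:R) <= e.
    move: nb; rewrite !ler_pdivrMr ?mulr_gt0 ?exprn_gt0//; lra.
  have Mp : 0 <= M / (d ^+ 2 * n%:R) by rewrite divr_ge0 ?mulr_ge0 ?sqr_ge0// ltW.
  have xp : 0 <= x * (1 - x) by apply: mulr_ge0; lra.
  have : 2 * (x * (1 - x)) * (M / (d ^+ 2 * n%:R)) <= 1 / 2 * e by apply: ler_pM; lra.
  by lra.
move=> h.
have {}H : - s * (bernstein n (fun k => g (k%:R / n%:R))).[x] + s * g x <= e / 2 + c * (n%:R * x * (1 - x)).
  apply: H => k kn; have := gb k kn; rewrite -/c ler_norml.
  by case: s1 => ->; lra.
by lra.
Qed.

Lemma weierstrass (g : R -> R) (b e : R) : continuous g -> 0 < b -> 0 < e ->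
  exists p : {poly R}, forall x, - b <= x <= b -> `|g x - p.[x]| <= e.
Proof.
move=> gc b0 e0.
have hc : continuous (fun t => g (2 * b * t - b)).
  have D (t : R) : is_derive t 1 (fun t => 2 * b * t - b) (2 * b) by dsolve; ring.
  move=> t; apply: (@continuous_comp _ _ _ (fun t => 2 * b * t - b) g); last exact: gc.
  exact: is_derive_cts (D t).
have [p Hp] := weierstrass01 hc e0.
exists (p \Po ((2 * b)^-1 *: 'X + (2^-1)%:P)) => x xb.
rewrite horner_comp !hornerE.
have h01 : 0 <= (2 * b)^-1 * x + 2^-1 <= 1.
  have -> : (2 * b)^-1 * x + 2^-1 = (x + b) / (2 * b) by field; rewrite gt_eqF.
  by rewrite divr_ge0/= ?ler_pdivrMr//; lra.
have := Hp _ h01; rewrite (_ : 2 * b * ((2 * b)^-1 * x + 2^-1) - b = x)//.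
by field; rewrite gt_eqF.
Qed.

End Weierstrass.

(** * Smooth functions and a bump function *)

Section SmoothFunctions.
Context {R : realType}.
Implicit Types (f g h : R -> R) (x t a b c : R) (p q : {poly R}).

(** Replaces formulas for n-th derivatives by a class of functions closed under differentiation. *)
Lemma smooth_of_class (P : (R -> R) -> Prop) f :
  (forall g, P g -> (forall x : R, derivable g x 1) /\ P (derive1 g)) -> P f -> smooth f.
Proof.
move=> HP Pf n; suff : P (derive1n n f) by move=> /HP[].
by elim: n => [//|n /HP[_]]; rewrite derive1nS.
Qed.

Lemma smooth_derive1 f : smooth f -> smooth (derive1 f).
Proof. by move=> sf n x; have := sf n.+1 x; rewrite derive1Sn. Qed.

Lemma smooth_is_derive f : smooth f -> forall x : R, is_derive x 1 f (derive1 f x).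
Proof. by move=> sf x; rewrite derive1E; apply/derivableP; exact: (sf 0%N x). Qed.

Lemma derive1_of_is_derive f g : (forall x : R, is_derive x 1 f (g x)) -> derive1 f = g.
Proof. by move=> H; apply/funext => x; rewrite derive1E; have [_ ->] := H x. Qed.

Lemma smooth_horner p : smooth (horner p).
Proof.
apply: (@smooth_of_class (fun g => exists p, g = horner p)); last by exists p.
move=> _ [q ->]; split; first exact: derivable_horner.
by exists q^`(); rewrite derivE.
Qed.

Lemma smooth_primitive f F : smooth f -> (forall x : R, is_derive x 1 F (f x)) -> smooth F.
Proof.
move=> sf dF [|n] x; first by case: (dF x).
by rewrite derive1Sn (derive1_of_is_derive dF).
Qed.

(** A class containing products of smooth functions and closed under differentiation by the Leibniz
    rule. *)
Inductive product_sums : (R -> R) -> Prop :=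
| product_sums_mul f g : smooth f -> smooth g -> product_sums (fun x => f x * g x)
| product_sums_add f g : product_sums f -> product_sums g -> product_sums (fun x => f x + g x).

Lemma product_sums_smooth f : product_sums f -> smooth f.
Proof.
apply: smooth_of_class => g; elim => {g} [g h sg sh|g h _ [dg pg] _ [dh ph]].
  have D x := is_deriveMf (smooth_is_derive sg x) (smooth_is_derive sh x).
  split; first by move=> x; case: (D x).
  rewrite (derive1_of_is_derive D); have sg' := smooth_derive1 sg; have sh' := smooth_derive1 sh.
  exact: (product_sums_add (product_sums_mul sg sh') (product_sums_mul sh sg')).
have D x : is_derive x 1 (fun x => g x + h x) (derive1 g x + derive1 h x).
  by apply: is_deriveDf; rewrite derive1E; apply/derivableP.
split; first by move=> x; case: (D x).
by rewrite (derive1_of_is_derive D); exact: product_sums_add.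
Qed.

Lemma smooth_mul f g : smooth f -> smooth g -> smooth (fun x => f x * g x).
Proof. by move=> sf sg; apply: product_sums_smooth; exact: product_sums_mul. Qed.

Lemma is_derive_affine f (f' : R) a b x : is_derive (a * x + b) 1 f f' ->
  is_derive x 1 (fun x => f (a * x + b)) (a * f').
Proof.
move=> df; have D : is_derive x 1 (fun x => a * x + b) a by dsolve; ring.
by have H := @is_derive_compf _ f (fun x => a * x + b) _ _ _ df D; apply: (is_derive_eq H); ring.
Qed.

Lemma smooth_affine f a b c : smooth f -> smooth (fun x => c * f (a * x + b)).
Proof.
move=> sf; apply: (@smooth_of_class (fun g => exists c f, smooth f /\ g = fun x => c * f (a * x + b))); last by exists c, f.
move=> _ [d [h [sh ->]]].
have D x : is_derive x 1 (fun x => d * h (a * x + b)) ((d * a) * derive1 h (a * x + b)).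
  have H1 := is_derive_affine (smooth_is_derive sh (a * x + b)).
  by have H := is_deriveMf (is_derive_cstf d x) H1; apply: (is_derive_eq H); ring.
split; first by move=> x; case: (D x).
by rewrite (derive1_of_is_derive D); exists (d * a), (derive1 h); split; first exact: smooth_derive1.
Qed.

(** By induction on the polynomial with half the rate; the other half of the exponential absorbs the
    extra factor [t]. *)
Lemma poly_le_expR p a : 0 < a -> exists2 M, 0 <= M & forall t, 0 <= t -> `|p.[t]| <= M * expR (a * t).
Proof.
elim/poly_ind: p a => [|p c IH] a a0.
  by exists 0 => // t t0; rewrite horner0 normr0 mul0r.
have a2 : 0 < a / 2 by rewrite divr_gt0.
have [M M0 HM] := IH _ a2; exists (M * (2 / a) + `|c|).
  by rewrite addr_ge0// mulr_ge0// divr_ge0// ltW.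
move=> t t0; rewrite hornerD hornerMX hornerC.
have e1 : 1 <= expR (a * t) by rewrite -expR0 ler_expR mulr_ge0// ltW.
have et : t <= 2 / a * expR (a / 2 * t).
  have := expR_ge1Dx (a / 2 * t) => h.
  rewrite [leLHS](_ : _ = 2 / a * (a / 2 * t)); last by field; rewrite gt_eqF.
  by rewrite ler_pM2l ?divr_gt0//; lra.
apply: le_trans (ler_normD _ _) _; rewrite mulrDl; apply: lerD; last by rewrite ler_peMr.
rewrite normrM (ger0_norm t0).
have -> : M * (2 / a) * expR (a * t) = (M * expR (a / 2 * t)) * (2 / a * expR (a / 2 * t)).
  have -> : a * t = a / 2 * t + a / 2 * t by field.
  by rewrite expRD; ring.
by apply: ler_pM => //; exact: HM.
Qed.

Definition flat p x := if 0 < x then p.[x^-1] * expR (- x^-1) else 0.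

Lemma flat_small p : exists2 M, 0 <= M & forall x, `|x| < 1 -> `|flat p x| <= M * x ^+ 2.
Proof.
have [M M0 HM] := poly_le_expR (p * 'X^2) ltr01; exists M => // x x1.
rewrite /flat; case: ifPn => [x0|_]; last by rewrite normr0 mulr_ge0// sqr_ge0.
have xi : 0 <= x^-1 by rewrite invr_ge0 ltW.
have := HM _ xi; rewrite hornerM hornerXn mul1r normrM normrX (ger0_norm xi) => h.
rewrite normrM (ger0_norm (expR_ge0 _)) expRN ler_pdivrMr ?expR_gt0//.
have x2 : 0 < x ^+ 2 by rewrite exprn_gt0.
rewrite mulrAC -ler_pdivrMr// (_ : `|p.[x^-1]| / x ^+ 2 = `|p.[x^-1]| * x^-1 ^+ 2)//.
by rewrite exprVn.
Qed.

Lemma is_derive_flat p x : is_derive x 1 (flat p) (flat ('X^2 * (p - p^`())) x).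
Proof.
have [x0|x0|<-] := ltgtP 0 x.
- have xn : x != 0 by rewrite gt_eqF.
  apply: (@near_eq_is_derive _ _ _ (fun x => p.[x^-1] * expR (- x^-1))) => //.
    near=> y; rewrite /flat ifT//.
    have : `|x - y| < x by near: y; have /cvgrPdist_lt := @cvg_id _ (nbhs x); apply.
    by rewrite ltr_norml; lra.
  have dV : is_derive x 1 (fun x : R => x^-1) (- 1 / x ^+ 2).
    exact: (is_deriveVf (f := fun x => x) xn (is_derive_idf x)).
  have d1 := @is_derive_compf _ (horner p) (fun x : R => x^-1) x _ _ (is_derive_poly p x^-1) dV.
  have d2 := @is_derive_compf _ expR (fun x : R => - x^-1) x _ _ (is_derive_expR _) (is_deriveNf dV).
  apply: (is_derive_eq (is_deriveMf d1 d2)); rewrite /flat x0 hornerM hornerXn hornerD hornerN exprVn.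
  by field.
- rewrite /flat ltNge (ltW x0)/=.
  apply: (@near_eq_is_derive _ _ _ (fun=> 0)) => //.
  near=> y; rewrite ifF//; apply/negbTE; rewrite -leNgt.
  have : `|x - y| < - x by near: y; have /cvgrPdist_lt := @cvg_id _ (nbhs x); apply; lra.
  by rewrite ltr_norml; lra.
- have [M M0 HM] := flat_small p.
  rewrite {2}/flat ltxx; apply: (is_derive_of_quadratic (M := M) ltr01) => h h1.
  by rewrite add0r mulr0 subr0 {2}/flat ltxx subr0 HM.
Unshelve. all: by end_near. Qed.

Lemma smooth_flat p : smooth (flat p).
Proof.
apply: (@smooth_of_class (fun g => exists p, g = flat p)); last by exists p.
move=> _ [q ->]; split; first by move=> x; case: (is_derive_flat q x).
by rewrite (derive1_of_is_derive (is_derive_flat q)); exists ('X^2 * (q - q^`())).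
Qed.

Lemma smooth_continuous_derive1n f n : smooth f -> continuous (derive1n n f).
Proof.
by move=> sf x; apply: differentiable_continuous; apply/derivable1_diffP; exact: sf.
Qed.

Lemma bump_exists : exists beta : R -> R, exists B, [/\ smooth beta, beta 0 = 1,
  forall x, 1 <= `|x| -> beta x = 0, 0 < B &
  forall x, [/\ `|beta x| <= B, `|derive1 beta x| <= B & `|derive1n 2 beta x| <= B]].
Proof.
(* Both flat factors equal [exp(-1)] at [x = 0], so [c] normalises the bump to 1 there. *)
pose c := expR 1 ^+ 2 : R.
pose beta x := c * (flat 1 (-1 * x + 1)) * (1 * flat 1 (1 * x + 1)).
have sb : smooth beta.
  by apply: smooth_mul; apply: smooth_affine; exact: smooth_flat.
have b0 : beta 0 = 1.
  rewrite /beta /flat !mulr0 add0r ltr01 invr1 hornerC !mul1r /c expRN expr2.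
  by field; rewrite gt_eqF// expR_gt0.
have bz x : 1 <= `|x| -> beta x = 0.
  rewrite ler_normr /beta /flat => /orP[h|h].
    by rewrite ifF ?mulr0 ?mul0r//; apply/negbTE; rewrite -leNgt; lra.
  by rewrite [X in 1 * X]ifF ?mulr0//; apply/negbTE; rewrite -leNgt; lra.
have d1 := smooth_is_derive sb; have d2 := smooth_is_derive (smooth_derive1 sb).
have z0 x : 1 < `|x| -> beta x = 0 by move=> /ltW/bz.
have z1 := deriv_zero_outside z0 d1; have z2 := deriv_zero_outside z1 d2.
have bnd n : (forall x, 1 < `|x| -> derive1n n beta x = 0) -> exists2 B, 0 < B & forall x, `|derive1n n beta x| <= B.
  move=> zn; have [B B0 HB] := continuous_bounded 1 (smooth_continuous_derive1n (n := n) sb).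
  exists B => // x; have [x1|x1] := leP `|x| 1; last by rewrite zn// normr0 ltW.
  by apply: HB; rewrite -ler_norml.
have [B0 B00 H0] := bnd 0%N z0; have [B1 B10 H1] := bnd 1%N z1; have [B2 B20 H2] := bnd 2%N z2.
exists beta, (B0 + B1 + B2); split => //; first by rewrite !addr_gt0.
by move=> x; split; [apply: le_trans (H0 x) _|apply: le_trans (H1 x) _|apply: le_trans (H2 x) _]; lra.
Qed.

End SmoothFunctions.

(** * A decaying solution is an eigenfunction *)

Section DecayingEigenfunction.
Context {R : realType}.
Local Notation mu := (@lebesgue_measure R).
Implicit Types (u v w f g h V : R -> R) (x t b c E : R) (K : nat).

(** A polynomial approximates the second derivative within [e / b ^+ 2] and is integrated twice with
    the data of [u] at 0; each integration costs a factor [b], and [b >= 1] lets [e] bound all three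
    errors. *)
Lemma smooth_C2_approximation u v w (b e : R) : (forall x, is_derive x 1 u (v x)) ->
  (forall x, is_derive x 1 v (w x)) -> continuous w -> 1 <= b -> 0 < e ->
  exists P P' P'', [/\ smooth P, forall x : R, is_derive x 1 P (P' x), forall x : R, is_derive x 1 P' (P'' x) &
   forall x : R, - b <= x <= b -> [/\ `|P x - u x| <= e, `|P' x - v x| <= e & `|P'' x - w x| <= e]].
Proof.
move=> du dv wc b1 e0; have b0 : 0 < b by lra.
have bb : 1 <= b ^+ 2 by rewrite exprn_ege1.
have bb' : b <= b ^+ 2 by rewrite expr2 ler_peMr//; lra.
have b20 : 0 < b ^+ 2 by rewrite exprn_gt0.
pose n := e / b ^+ 2; have n0 : 0 < n by rewrite divr_gt0.
have [p Hp] := weierstrass wc b0 n0.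
have pc : continuous (horner p) := @continuous_horner _ p.
have [F1 [F10 dF1]] := primitive_exists pc.
pose P' x := F1 x + v 0.
have dP' x : is_derive x 1 P' p.[x] by rewrite /P'; dsolve; ring.
have [F2 [F20 dF2]] := primitive_exists (deriv_continuous dP').
pose P x := F2 x + u 0.
have dP x : is_derive x 1 P (P' x) by rewrite /P; dsolve; ring.
exists P, P', (horner p); split => //.
  apply: (smooth_primitive _ dP); apply: (smooth_primitive _ dP'); exact: smooth_horner.
have h2 x : - b <= x <= b -> `|p.[x] - w x| <= n by move=> /Hp; rewrite distrC.
have d1 x : is_derive x 1 (fun x => P' x - v x) (p.[x] - w x) by dsolve.
have h1 x : - b <= x <= b -> `|P' x - v x| <= n * `|x|.
  by apply: (lipschitz_of_deriv _ d1 h2); rewrite /P' F10; ring.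
have nb0 : 0 <= n * b by rewrite mulr_ge0// ltW.
have h1' x : - b <= x <= b -> `|P' x - v x| <= n * b.
  move=> xb; apply: le_trans (h1 x xb) _; rewrite ler_wpM2l ?(ltW n0)//.
  by rewrite ler_norml; lra.
have d0 x : is_derive x 1 (fun x => P x - u x) (P' x - v x) by dsolve.
have h0 x : - b <= x <= b -> `|P x - u x| <= n * b * `|x|.
  by apply: (lipschitz_of_deriv _ d0 h1'); rewrite /P F20; ring.
have ne : n * b ^+ 2 = e by rewrite /n divfK// gt_eqF.
move=> x xb; have xb' : `|x| <= b by rewrite ler_norml.
split.
- apply: le_trans (h0 x xb) _; rewrite -ne -mulrA ler_pM2l// expr2 ler_pM2l//.
- by apply: le_trans (h1' x xb) _; rewrite -ne ler_pM2l.
- by apply: le_trans (h2 x xb) _; rewrite -ne ler_peMr// ltW.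
Qed.

Lemma integral_oneDsqr : (\int[mu]_x ((oneDsqr x)^-1)%:E = (pi : R)%:E)%E.
Proof.
rewrite ge0_symfun_integralT.
- have -> : [set x | (0 <= x :> R)%R] = [set` `[0%R, +oo[] by apply/seteqP; split => x; rewrite /= in_itv/= andbT.
  by rewrite integral0y_oneDsqr -EFinM; congr EFin; field.
- by move=> x; rewrite invr_ge0 addr_ge0// sqr_ge0.
- exact: continuous_oneDsqrV.
- by move=> x; rewrite /= /oneDsqr sqrrN.
Qed.

(** One majorant serves all L^2 estimates: [1 / (1 + x^2)] is at most 1, so its square also has
    integral at most [pi]. *)
Lemma Lnorm2_le h c : measurable_fun setT h -> 0 <= c ->
  (forall x, `|h x| <= c * (oneDsqr x)^-1) ->
  (Lnorm mu 2%:E (EFin \o h) <= (Num.sqrt (pi : R) * c)%:E)%E.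
Proof.
move=> mh c0 hc.
have pi0 : 0 <= pi :> R by exact: pi_ge0.
have G0 x : 0 <= (oneDsqr x)^-1 :> R by rewrite invr_ge0 addr_ge0// sqr_ge0.
have mG : measurable_fun setT (fun x : R => (oneDsqr x)^-1).
  by apply: continuous_measurable_fun; exact: continuous_oneDsqrV.
have I : (\int[mu]_x (h x ^+ 2)%:E <= ((Num.sqrt (pi : R) * c) ^+ 2)%:E)%E.
  have -> : (Num.sqrt (pi : R) * c) ^+ 2 = c ^+ 2 * pi + 0 * pi.
    by rewrite exprMn sqr_sqrtr// mulrC mul0r addr0.
  apply: (sum_integral_le (h1 := fun x => (oneDsqr x)^-1) (h2 := fun x => (oneDsqr x)^-1)) => //.
  - exact: measurable_funX.
  - exact: sqr_ge0.
  - move=> x _; rewrite sqr_ge0/= mul0r addr0.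
    have h1 : h x ^+ 2 <= (c * (oneDsqr x)^-1) ^+ 2.
      by rewrite -[leLHS]real_normK ?num_real// ler_pXn2r ?nnegrE ?mulr_ge0.
    apply: le_trans h1 _; rewrite exprMn ler_wpM2l ?sqr_ge0// expr2 ler_piMl//.
    exact: oneDsqrV_le1.
  - by rewrite integral_oneDsqr.
  - by rewrite integral_oneDsqr.
have s0 : 0 <= Num.sqrt (pi : R) * c by rewrite mulr_ge0// sqrtr_ge0.
rewrite -Lnorm2_sqr in I.
have -> : Lnorm mu 2%:E (EFin \o h) = ((Lnorm mu 2%:E (EFin \o h) `^ 2) `^ 2^-1)%E.
  by rewrite -poweRrM divff// poweRe1// Lnorm_ge0.
have -> : (Num.sqrt (pi : R) * c)%:E = (((Num.sqrt (pi : R) * c) ^+ 2)%:E `^ 2^-1)%E.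
  by rewrite poweR_EFin powR12_sqrt ?sqr_ge0// sqrtr_sqr ger0_norm.
apply: gt0_ler_poweR => //; rewrite in_itv/= leey andbT.
  exact: poweR_ge0.
by rewrite lee_fin sqr_ge0.
Qed.

Lemma Lfun_of_bound h c : measurable_fun setT h -> 0 <= c ->
  (forall x, `|h x| <= c * (oneDsqr x)^-1) -> h \in Lfun mu 2%:E.
Proof.
move=> mh c0 hc; apply/andP; split; rewrite inE//=.
by rewrite /finite_norm (le_lt_trans (Lnorm2_le mh c0 hc))// ltry.
Qed.

Lemma cvgL2_of_bound (phi : nat -> R -> R) h c : 0 <= c ->
  (forall k, measurable_fun setT (phi k)) -> measurable_fun setT h ->
  (forall k x, `|phi k x - h x| <= c / k.+1%:R * (oneDsqr x)^-1) ->
  cvgL2 (fun k x => real_complex R (phi k x)) (fun x => real_complex R (h x)).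
Proof.
move=> c0 mphi mh H; rewrite /cvgL2.
have E k : Lnorm mu 2%:E (fun x => (Normc.normc (real_complex R (phi k x) - real_complex R (h x)))%:E)
    = Lnorm mu 2%:E (EFin \o (fun x => `|phi k x - h x|)).
  by apply: eq_Lnorm => x /=; rewrite subr0 expr0n addr0 sqrtr_sqr.
apply: (@squeeze_cvge _ _ _ _ (fun=> 0%E) _ (fun k => (Num.sqrt (pi : R) * (c / k.+1%:R))%:E)).
- near=> k; rewrite Lnorm_ge0/= E; apply: Lnorm2_le.
  + by apply: measurableT_comp => //; apply: measurable_funB.
  + by rewrite divr_ge0.
  + by move=> x; rewrite normr_id; exact: H.
- exact: cvg_cst.
- apply: cvg_EFin; first by near=> k.
  rewrite -[X in _ --> X](mulr0 (Num.sqrt (pi : R) * c)).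
  under eq_fun do rewrite /= mulrA.
  by apply: cvgMr; exact: cvg_harmonic.
Unshelve. all: by end_near. Qed.

Lemma not_ae_zero f x0 : continuous f -> f x0 != 0 ->
  ~ {ae mu, forall x, real_complex R (f x) = 0}.
Proof.
move=> fc fx0 [N [mN N0 sub]].
have n0 : 0 < `|f x0| by rewrite normr_gt0.
have /cvgrPdist_lt/(_ _ n0)/nbhs_ballP[d /= d0 Hd] := fc x0.
have bN : ball x0 d `<=` N.
  move=> x /Hd h; apply: sub => /= -[fx]; move: h; rewrite /= fx subr0.
  by rewrite ltxx.
have : (mu (ball x0 d) <= mu N)%E.
  by apply: le_measure => //; rewrite inE//; exact: measurable_ball.
by rewrite N0 lebesgue_measure_ball ?(ltW d0)// lee_fin leNgt pmulrn_lgt0// d0.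
Qed.

Lemma dilated_bump : exists B : R, 0 < B /\ forall n, 1 <= n ->
  exists chi chi' chi'', [/\ smooth chi, forall x : R, is_derive x 1 chi (chi' x),
    forall x : R, is_derive x 1 chi' (chi'' x),
    forall x : R, n < `|x| -> [/\ chi x = 0, chi' x = 0 & chi'' x = 0] &
    forall x, [/\ `|chi x| <= B, `|chi' x| <= B / n, `|chi'' x| <= B / n & `|chi x - 1| <= B / n * `|x|]].
Proof.
have [beta [B [sb b0 bz B0 Bb]]] := bump_exists (R := R).
have db := smooth_is_derive sb.
have ddb := smooth_is_derive (smooth_derive1 sb).
have beta1 x : `|beta x - 1| <= B * `|x|.
  have d1 t : is_derive t 1 (fun t => beta t - 1) (derive1 beta t) by dsolve; ring.
  apply: (@lipschitz_of_deriv _ (fun t => beta t - 1) _ B `|x| _ d1).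
  - by rewrite b0 subrr.
  - by move=> t _; have [] := Bb t.
  - by rewrite -ler_norml.
exists B; split=> // n n1; have n0 : 0 < n := lt_le_trans ltr01 n1.
pose chi x := 1 * beta (n^-1 * x + 0).
pose chi' x := n^-1 * derive1 beta (n^-1 * x + 0).
pose chi'' x := n^-1 * (n^-1 * derive1n 2 beta (n^-1 * x + 0)).
have dchi x : is_derive x 1 chi (chi' x).
  have H := is_deriveMf (is_derive_cstf 1 x) (is_derive_affine (db (n^-1 * x + 0))).
  by apply: (is_derive_eq H); rewrite /chi'; ring.
have dchi' x : is_derive x 1 chi' (chi'' x).
  have H := is_deriveMf (is_derive_cstf n^-1 x) (is_derive_affine (ddb (n^-1 * x + 0))).
  by apply: (is_derive_eq H); rewrite /chi'' derive1nS derive1n1; ring.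
have arg x : `|n^-1 * x + 0| = `|x| / n.
  by rewrite addr0 normrM (gtr0_norm (_ : 0 < n^-1)) ?invr_gt0// mulrC.
have z0 x : n < `|x| -> chi x = 0.
  by move=> nx; rewrite /chi bz ?mulr0// arg ler_pdivlMr// mul1r ltW.
have z1 := deriv_zero_outside z0 dchi; have z2 := deriv_zero_outside z1 dchi'.
exists chi, chi', chi''; split=> [|//|//|x nx|x]; [exact: smooth_affine| by rewrite z0 ?z1 ?z2|].
have [h1 h2 h3] := Bb (n^-1 * x + 0).
have ni : 0 <= n^-1 by rewrite invr_ge0 ltW.
have ni1 : n^-1 <= 1 by rewrite invf_le1.
rewrite /chi mul1r; split => //.
- by rewrite /chi' normrM (ger0_norm ni) mulrC ler_wpM2r.
- rewrite /chi'' normrM (ger0_norm ni) mulrC ler_wpM2r// normrM (ger0_norm ni).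
  by rewrite -[leRHS]mul1r; apply: ler_pM.
- by apply: le_trans (beta1 _) _; rewrite arg mulrA mulrAC.
Qed.

(** Two of the three powers pay for the majorant; the third pays for the factor [|x|] that comes
    from [chi - 1]. *)
Lemma le_oneDsqrV (x y C : R) : (1 + `|x|) ^+ 3 * `|y| <= C ->
  `|y| <= C * (oneDsqr x)^-1 /\ `|x| * `|y| <= C * (oneDsqr x)^-1.
Proof.
move=> h; have x0 := normr_ge0 x; have y0 := normr_ge0 y.
have xy : 0 <= `|x| * `|y| by rewrite mulr_ge0.
have x2 : x ^+ 2 = `|x| ^+ 2 by rewrite real_normK ?num_real.
have h1 : (1 + `|x|) * `|y| <= C * (oneDsqr x)^-1.
  rewrite ler_pdivlMr; last by rewrite ltr_wpDr// sqr_ge0.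
  have h3 : 0 <= (1 + `|x|) * `|y| * `|x| by rewrite !mulr_ge0// addr_ge0.
  by apply: le_trans h; rewrite /oneDsqr x2; move: h3; clear; lra.
by move: h1 x0 y0 xy; clear; lra.
Qed.

(* [phi] is a smooth [C^2] approximation of [u] on [[- n, n]] times a cutoff at
   scale [n]; the cutoff costs [O(1 / n)] because it has small derivatives and
   differs from [1] by [O(|x| / n)]. *)
Lemma cutoff_approximation V E u v (C : R) : continuous V -> solves (fun x => V x - E) u v ->
  (forall x, (1 + `|x|) ^+ 3 * `|u x| <= C) -> (forall x, (1 + `|x|) ^+ 3 * `|v x| <= C) ->
  exists A, 0 <= A /\ forall n, 1 <= n -> exists phi, [/\ smooth phi, compactly_supported phi,
    forall x, `|phi x - u x| <= A / n * (oneDsqr x)^-1 &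
    forall x, `|- derive1n 2 phi x + V x * phi x - E * u x| <= A / n * (oneDsqr x)^-1].
Proof.
move=> Vc [du dv] uC vC.
have C0 : 0 <= C by apply: le_trans (uC 0); rewrite mulr_ge0// exprn_ge0// addr_ge0.
have uc : continuous u := deriv_continuous du.
have wc : continuous (fun x => (V x - E) * u x).
  move=> x; have h1 : {for x, continuous (fun x => V x - E)} by apply: continuousB; [exact: Vc|exact: cst_continuous].
  exact: (@continuousM R R _ _ _ h1 (uc x)).
have [B [B0 bump]] := dilated_bump.
have BC : 0 <= B * C by rewrite mulr_ge0// ltW.
exists ((3 + `|E|) * (B * C) + 1); split; first by rewrite addr_ge0// mulr_ge0// addr_ge0.
move=> n n1; have n0 : 0 < n := lt_le_trans ltr01 n1.
have [chi [chi' [chi'' [sc dchi dchi' out cb]]]] := bump n n1.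
have [M M0 VM] := continuous_bounded n Vc.
have B4 : 0 < B * (4 + M) by rewrite mulr_gt0// addr_gt0.
have n20 : 0 < 1 + n ^+ 2 by rewrite ltr_wpDr ?sqr_ge0.
(* [n] gives the rate, [1 + n ^+ 2] compares a constant with the majorant on [[- n, n]], and
   [B * (4 + M)] collects the error terms. *)
pose e := (n * (1 + n ^+ 2) * (B * (4 + M)))^-1.
have e0 : 0 < e by rewrite invr_gt0 mulr_gt0// mulr_gt0.
have [P [P' [P'' [sP dP dP' HP]]]] := smooth_C2_approximation du dv wc n1 e0.
pose phi x := chi x * P x.
pose phi'' x := chi'' x * P x + 2 * (chi' x * P' x) + chi x * P'' x.
have d1 x : is_derive x 1 phi (chi' x * P x + chi x * P' x) by rewrite /phi; dsolve; ring.
have d2 x : is_derive x 1 (fun x => chi' x * P x + chi x * P' x) (phi'' x).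
  by rewrite /phi''; dsolve; ring.
have err (x z : R) : (`|x| <= n -> `|z| <= e * (B * (4 + M))) -> (n < `|x| -> z = 0) ->
    `|z| <= n^-1 * (oneDsqr x)^-1.
  move=> h1 h2; have [xn|xn] := leP `|x| n; last first.
    by rewrite h2// normr0 mulr_ge0// ?invr_ge0 ?addr_ge0 ?sqr_ge0 ?ltW.
  apply: le_trans (h1 xn) _.
  rewrite /e invfM divfK ?gt_eqF// invfM ler_wpM2l ?invr_ge0 ?(ltW n0)//.
  rewrite lef_pV2 ?posrE ?ltr_wpDr ?sqr_ge0//.
  by rewrite /oneDsqr lerD2l -[x ^+ 2]real_normK ?num_real// ler_pXn2r ?nnegrE// ltW.
have split_bound (x z y : R) : `|z| <= (3 + `|E|) * (B / n * (C * (oneDsqr x)^-1)) ->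
    `|y| <= n^-1 * (oneDsqr x)^-1 -> `|z + y| <= ((3 + `|E|) * (B * C) + 1) / n * (oneDsqr x)^-1.
  move=> hz hy; apply: le_trans (ler_normD _ _) (le_trans (lerD hz hy) _).
  by rewrite le_eqVlt; apply/orP; left; apply/eqP; ring.
have Bn : 0 <= B / n by rewrite divr_ge0// ltW.
have BnB : B / n <= B by rewrite ler_pdivrMr// ler_peMr// ltW.
have BM : B <= B * (4 + M) by rewrite ler_peMr ?(ltW B0)// ler_wpDr ?ler1n// ltW.
have one_u x : `|(chi x - 1) * u x| <= B / n * (C * (oneDsqr x)^-1).
  have [_ _ _ c3] := cb x; have [_ u2] := le_oneDsqrV (uC x).
  rewrite normrM; apply: le_trans (_ : B / n * `|x| * `|u x| <= _); first by rewrite ler_wpM2r.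
  by rewrite -mulrA ler_wpM2l.
have CG x : 0 <= C * (oneDsqr x)^-1 by rewrite mulr_ge0// invr_ge0 addr_ge0 ?sqr_ge0.
exists phi; split.
- exact: smooth_mul.
- exists (n + 1) => x nx; have [|c0 _ _] := out x; first by apply: lt_le_trans nx; rewrite ltrDl.
  by rewrite /phi c0 mul0r.
- move=> x; have [c0 c1 c2 _] := cb x.
  have -> : phi x - u x = (chi x - 1) * u x + chi x * (P x - u x) by rewrite /phi; ring.
  apply: split_bound.
    apply: le_trans (one_u x) _; rewrite ler_peMl//; first exact: mulr_ge0.
    by have := normr_ge0 E; clear; lra.
  apply: err => [xn|/out[-> _ _]]; last by rewrite mul0r.
  have [p1 _ _] := HP x ltac:(rewrite -ler_norml//).
  by rewrite normrM mulrC; apply: ler_pM => //; exact: le_trans BM.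
move=> x; have [c0 c1 c2 _] := cb x.
have [u1 _] := le_oneDsqrV (uC x); have [v1 _] := le_oneDsqrV (vC x).
rewrite derive1nS derive1n1 (derive1_of_is_derive d1) (derive1_of_is_derive d2).
(* Error of the polynomial approximation, supported in [[- n, n]]. By [u'' = (V - E) u] the other
   terms carry only derivatives of [chi] or the factor [chi - 1]. *)
pose er := - (chi'' x * (P x - u x) + 2 * (chi' x * (P' x - v x)) + chi x * (P'' x - (V x - E) * u x)) + V x * (chi x * (P x - u x)).
have -> : - phi'' x + V x * phi x - E * u x =
   (- (chi'' x * u x) - 2 * (chi' x * v x) + E * ((chi x - 1) * u x)) + er.
  by rewrite /phi'' /phi /er; ring.
apply: split_bound.
  have w1 : `|chi'' x * u x| <= B / n * (C * (oneDsqr x)^-1) by rewrite normrM; apply: ler_pM.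
  have w2 : `|chi' x * v x| <= B / n * (C * (oneDsqr x)^-1) by rewrite normrM; apply: ler_pM.
  have w3 : `|E * ((chi x - 1) * u x)| <= `|E| * (B / n * (C * (oneDsqr x)^-1)).
    by rewrite normrM ler_wpM2l.
  by move: w1 w2 w3; rewrite !ler_norml; clear; lra.
apply: err => [xn|/out[z0 z1 z2]]; last by rewrite /er z0 z1 z2; ring.
have [p1 p2 p3] := HP x ltac:(rewrite -ler_norml//).
have q1 : `|chi'' x * (P x - u x)| <= B * e.
  by rewrite normrM; apply: ler_pM => //; exact: le_trans BnB.
have q2 : `|chi' x * (P' x - v x)| <= B * e.
  by rewrite normrM; apply: ler_pM => //; exact: le_trans BnB.
have q3 : `|chi x * (P'' x - (V x - E) * u x)| <= B * e.
  by rewrite normrM; apply: ler_pM.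
have q4 : `|V x * (chi x * (P x - u x))| <= M * (B * e).
  rewrite normrM; apply: ler_pM => //; first by apply: VM; rewrite -ler_norml.
  by rewrite normrM; apply: ler_pM.
rewrite [leRHS](_ : _ = 4 * (B * e) + M * (B * e)); last by ring.
by move: q1 q2 q3 q4; rewrite /er !ler_norml; clear; lra.
Qed.

Lemma eigenvalue_of_decay V E u v (C x0 : R) : continuous V ->
  solves (fun x => V x - E) u v ->
  (forall x, (1 + `|x|) ^+ 3 * `|u x| <= C) -> (forall x, (1 + `|x|) ^+ 3 * `|v x| <= C) ->
  u x0 != 0 -> eigenvalue_of V E.
Proof.
move=> Vc S uC vC ux0.
have [A [A0 HA]] := cutoff_approximation Vc S uC vC.
have C0 : 0 <= C by apply: le_trans (uC 0); rewrite mulr_ge0// exprn_ge0// addr_ge0.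
have uc : continuous u := deriv_continuous S.1.
have /choice[phi Hphi] k := HA k.+1%:R ltac:(rewrite ler1n//).
have phic k : continuous (phi k).
  by have [sk _ _ _] := Hphi k; exact: (smooth_continuous_derive1n (n := 0%N) sk).
have mu_u : measurable_fun setT u by exact: continuous_measurable_fun.
have mEu : measurable_fun setT (fun x => E * u x) by apply: measurable_funM => //; exact: measurable_cst.
have uG x : `|u x| <= C * (oneDsqr x)^-1 := (le_oneDsqrV (uC x)).1.
have z2 : (fun=> 0 : R) \in Lfun mu 2%:E.
  by apply: (@Lfun_of_bound _ 0) => // x; rewrite normr0 mul0r.
exists (fun x => real_complex R (u x)); split; first exact: not_ae_zero ux0.
split.
- by split; [exact: (Lfun_of_bound mu_u C0)|exact: z2].
- split.
    rewrite reF_scale; apply: (@Lfun_of_bound _ (`|E| * C)) => //; first by rewrite mulr_ge0.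
    by move=> x; rewrite /reF/= normrM -mulrA ler_wpM2l.
  rewrite imF_scale /imF/=; have -> : (fun x : R => E * 0) = (fun=> 0) by apply/funext => x; rewrite mulr0.
  exact: z2.
exists (fun k x => real_complex R (phi k x)).
have d0 : derive1 (fun=> 0 : R) = (fun=> 0) by apply: derive1_of_is_derive => y; exact: is_derive_cstf.
split.
- move=> k; have [sk [b kb] _ _] := Hphi k; split => //.
    by apply: (@smooth_of_class _ (fun g => g = fun=> 0)) => // _ ->.
  have sub : closure [set x | real_complex R (phi k x) != 0] `<=` `[- `|b|, `|b|].
    rewrite closureE; apply: smallest_sub; first exact: interval_closed.
    move=> x /= /eqP fx; rewrite in_itv/= -ler_norml leNgt; apply/negP => bx.
    by apply: fx; rewrite kb//; apply: le_trans (ltW bx); exact: ler_norm.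
  by apply: subclosed_compact sub; [exact: closed_closure|exact: segment_compact].
- apply: (cvgL2_of_bound A0) => // k; first exact: continuous_measurable_fun.
  by have [] := Hphi k.
- have -> : (fun k : nat => schrodinger V (fun x => real_complex R (phi k x))) =
     (fun k x => real_complex R (- derive1n 2 (phi k) x + V x * phi k x)).
    apply/funext => k; apply/funext => x; apply/eqP; rewrite eq_complex; apply/andP; split; apply/eqP.
      exact: (congr1 (fun f => f x) (reF_schrodinger V (fun x => real_complex R (phi k x)))).
    rewrite /schrodinger /= mul0r addr0.
    by rewrite (_ : imF _ = fun=> 0)// !d0; ring.
  have -> : (fun x => real_complex R E * real_complex R (u x)) = (fun x => real_complex R (E * u x)).
    by apply/funext => x; rewrite rmorphM.
  apply: (cvgL2_of_bound A0) => // k; have [sk _ _ H] := Hphi k; last exact: H.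
  apply: continuous_measurable_fun; apply: schrodinger_continuous => //.
  exact: smooth_continuous_derive1n.
Qed.

End DecayingEigenfunction.

(** * Polynomially weighted decay *)

Section MatchedEigenvalue.
Context {R : realType}.
Implicit Types (u v V W : R -> R) (x b E : R) (K : nat).

Lemma cube_exp_bound (x : R) : 0 <= x -> (1 + x) ^+ 3 <= 27 * expR x.
Proof.
move=> x0; have h := @expR_ge1Dx _ (x / 3).
have -> : expR x = expR (x / 3) ^+ 3 by rewrite -expRM_natl; congr expR; field.
have -> : 27 * expR (x / 3) ^+ 3 = (3 * expR (x / 3)) ^+ 3 by ring.
have e1 : 1 <= expR (x / 3) by rewrite -[leLHS]expR0 ler_expR; lra.
have h1 : x / 3 * 3 = x by field.
have h2 : 1 + x <= 3 * expR (x / 3) by lra.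
by rewrite ler_pXn2r ?nnegrE//; lra.
Qed.

Context {K : nat} {V : R -> R} (PV : half_line_potential K V).

Lemma decaying_solution_decay (E : R) u v : decaying_solution (V := V) E u v ->
  exists C, forall x, 0 <= x -> (1 + x) ^+ 3 * `|u x| <= C /\ (1 + x) ^+ 3 * `|v x| <= C.
Proof.
move=> S; have [b [b0 bE]] : exists b, 0 <= b /\ E + 1 <= V b.
  have [E0|E0] := leP (E + 1) 0; first by exists 0; case: PV => _ _ -> _.
  by have [X [X0 <-]] := turning_point_exists PV E0; exists X; split => //; exact: ltW.
have [u0 v0] : 0 < u b /\ v b < 0 by case: S => _; apply; lra.
have S1 := decaying_solution_scale (c := (u b)^-1) ltac:(by rewrite invr_gt0) S.
have u1 : (fun x => (u b)^-1 * u x) b = 1 by rewrite mulVf// gt_eqF.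
have [[du dv] _] := S1.
have cont (f : R -> R) : continuous f -> exists M, forall x, 0 <= x <= b + 1 -> (1 + x) ^+ 3 * `|f x| <= M.
  move=> fc; have [M M0 HM] := continuous_bounded (b + 1) fc.
  exists ((1 + (b + 1)) ^+ 3 * M) => x xb; apply: ler_pM => //.
  - by rewrite exprn_ge0//; lra.
  - by rewrite ler_pXn2r// ?nnegrE; lra.
  - by apply: HM; lra.
have [M1 HM1] := cont _ (deriv_continuous du).
have [M2 HM2] := cont _ (deriv_continuous dv).
have tail (y x c : R) : 0 <= x -> `|y| <= expR (- (x - c)) -> (1 + x) ^+ 3 * `|y| <= 27 * expR c.
  move=> x0 h; apply: le_trans (_ : 27 * expR x * expR (- (x - c)) <= _).
    by apply: ler_pM => //; [rewrite exprn_ge0//; lra|exact: cube_exp_bound].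
  by rewrite -mulrA -expRD; apply: eq_le_refl; congr (_ * expR _); ring.
pose D := `|M1| + `|M2| + 27 * expR (b + 1).
have M1' := ler_norm M1; have M2' := ler_norm M2.
have M1'' := normr_ge0 M1; have M2'' := normr_ge0 M2.
have e0 := expR_gt0 (b + 1).
have eb : expR b <= expR (b + 1) by rewrite ler_expR; lra.
have key x : 0 <= x -> (1 + x) ^+ 3 * `|(u b)^-1 * u x| <= D /\ (1 + x) ^+ 3 * `|(u b)^-1 * v x| <= D.
  move=> x0; have [xb|bx] := leP x (b + 1).
    have h1 := HM1 x ltac:(lra); have h2 := HM2 x ltac:(lra).
    by rewrite /D; split; [apply: le_trans h1 _|apply: le_trans h2 _]; lra.
  have bx' : b <= x by lra.
  have [su sv] := tail_sign PV b0 bE S1 bx'.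
  have t1 := tail_exp_bound PV b0 bE S1 u1 bx'.
  have t2 := tail_deriv_bound PV b0 bE S1 u1 (ltW bx).
  split; [apply: le_trans (tail _ _ b x0 _) _|apply: le_trans (tail _ _ (b + 1) x0 _) _].
  - by rewrite gtr0_norm.
  - by rewrite /D; lra.
  - by rewrite ltr0_norm.
  - by rewrite /D; lra.
have scale y : `|y| = u b * `|(u b)^-1 * y|.
  by rewrite normrM gtr0_norm ?invr_gt0// mulrA divff ?mul1r// gt_eqF.
exists (u b * D) => x /key[h1 h2].
by rewrite (scale (u x)) (scale (v x)); split; rewrite mulrCA ler_pM2l.
Qed.

Lemma decaying_solution_neq0 (E : R) u v : decaying_solution (V := V) E u v -> exists2 x, 0 <= x & u x != 0.
Proof.
move=> [_ uv]; have [E0|E0] := leP E 0.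
  have [h _] : 0 < u 0 /\ v 0 < 0 by apply: uv => //; case: PV => _ _ -> _.
  by exists 0 => //; rewrite gt_eqF.
have [X [X0 VX]] := turning_point_exists PV E0.
have [h _] : 0 < u X /\ v X < 0 by apply: uv; rewrite ?VX// ltW.
by exists X; [exact: ltW|rewrite gt_eqF].
Qed.

End MatchedEigenvalue.

(** * Every matched energy is an eigenvalue *)

Section Gluing.
Context {R : realType}.
Implicit Types (u v V W : R -> R) (x b E : R) (K : nat).

(** The matching condition is the vanishing of the Wronskian of [u] and the reflected [u'], so the
    two are proportional. The factor is nonzero because [u'] is, and [u] inherits the decay of both
    halves. *)
Lemma matched_eigenvalue K V E : half_line_potential K V ->
  half_line_potential K (fun x => V (- x)) -> matched (V := V) (W := fun x => V (- x)) E ->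
  eigenvalue_of V E.
Proof.
move=> PV PW [u [v [u' [v' [S S' m0]]]]].
have [S1 _] := S; have [S1' _] := S'.
have qc := shifted_potential_continuous (E := E) PV.
have [x0 x00 ux0] := decaying_solution_neq0 PV S.
have [y0 y00 uy0] := decaying_solution_neq0 PW S'.
have := solves_reflect S1'; set ur := (fun x => u' (- x)); set vr := (fun x => - v' (- x)).
rewrite (_ : (fun x => _ - E) = (fun x => V x - E)); last by apply/funext => x; rewrite opprK.
move=> Sr.
have W0 x : u x * vr x - v x * ur x = 0.
  by rewrite (wronskian_const x 0 S1 Sr) /ur /vr oppr0 mulrN -opprD m0 oppr0.
(* Read off at a point [x0] with [u x0 != 0], since [u 0] may vanish. *)
pose c := ur x0 / u x0.
have Hc x : ur x = c * u x /\ vr x = c * v x.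
  have [||z1 z2] := solves_unique qc (solves_lin (- c) 1 S1 Sr) (b := x0) _ _ x.
  - by rewrite /c; field.
  - rewrite (_ : _ + _ = (u x0 * vr x0 - v x0 * ur x0) / u x0); first by rewrite W0 mul0r.
    by rewrite /c; field.
  - by split; lra.
clearbody c.
have c0 : c != 0.
  apply: contraNneq uy0 => c0; have [] := Hc (- y0).
  by rewrite c0 !mul0r /ur opprK => ->.
have [C HC] := decaying_solution_decay PV S; have [C' HC'] := decaying_solution_decay PW S'.
have Vc : continuous V by case: PV.
have C0 : 0 <= C by have [h _] := HC 0 (lexx _); apply: le_trans h; rewrite mulr_ge0// exprn_ge0// addr_ge0.
have C'0 : 0 <= C' by have [h _] := HC' 0 (lexx _); apply: le_trans h; rewrite mulr_ge0// exprn_ge0// addr_ge0.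
have cC : 0 <= `|c|^-1 * C' by rewrite mulr_ge0// invr_ge0.
have both x : (1 + `|x|) ^+ 3 * `|u x| <= C + `|c|^-1 * C' /\ (1 + `|x|) ^+ 3 * `|v x| <= C + `|c|^-1 * C'.
  have [x1|x1] := leP 0 x.
    by rewrite (ger0_norm x1); have [h1 h2] := HC x x1; split; lra.
  rewrite (ltr0_norm x1); have [h1 h2] := HC' (- x) ltac:(lra).
  have [e1 e2] := Hc x.
  have -> : u x = c^-1 * u' (- x) by rewrite -/(ur x) e1 mulKf.
  have -> : v x = c^-1 * - v' (- x) by rewrite -/(vr x) e2 mulKf.
  have ci : 0 <= `|c|^-1 by rewrite invr_ge0.
  have k1 := ler_wpM2l ci h1; have k2 := ler_wpM2l ci h2.
  by rewrite !normrM normrN !normfV !(mulrCA _ `|c|^-1); split; lra.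
exact: (eigenvalue_of_decay Vc S1 (fun x => (both x).1) (fun x => (both x).2) ux0).
Qed.

End Gluing.

(** * From the class P1 to half-line potentials *)

Section PowerLike.
Context {R : realType}.
Implicit Types (V W : R -> R) (x E kappa : R) (K : nat).

Lemma power_like_pointwise kappa K W x : 0 < kappa -> kappa <= K%:R -> power_like kappa W -> 0 < x ->
  [/\ 0 < W x, is_derive x 1 W (derive1 W x),
    W x <= K%:R * (x * derive1 W x) & x * derive1 W x <= K%:R * W x].
Proof.
move=> k0 kK PW x0; have [Wx dW _ lo hi] := PW x x0; split => //.
- by rewrite derive1E; exact: derivableP.
- have h1 : W x <= kappa * (x * derive1 W x) by rewrite -ler_pdivrMl.
  have h2 : 0 < x * derive1 W x by apply: lt_le_trans lo; rewrite mulr_gt0// invr_gt0.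
  by apply: le_trans h1 _; rewrite ler_pM2r.
- by apply: le_trans hi _; rewrite ler_pM2r.
Qed.

(** The class imposes regularity only off 0. Continuity at 0 comes from [W x ^+ K <= x * W 1 ^+ K]
    for [x <= 1]. *)
Lemma power_like_small kappa K W (e : R) : 0 < kappa -> kappa <= K%:R -> power_like kappa W -> 0 < e ->
  exists2 d, 0 < d & forall x, 0 < x < d -> W x < e.
Proof.
move=> k0 kK PW e0; have WP x := @power_like_pointwise _ _ _ x k0 kK PW.
have K0 : (0 < K)%N by rewrite -(ltr_nat R); lra.
have [W1 _ _ _] := WP 1 ltr01.
pose c := W 1 ^+ K; have c0 : 0 < c by rewrite exprn_gt0.
have eK : 0 < e ^+ K by rewrite exprn_gt0.
exists (Num.min 1 (e ^+ K / c)); first by rewrite lt_min ltr01 divr_gt0.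
move=> x /andP[x0]; rewrite lt_min => /andP[x1 xe]; have [Wx _ _ _] := WP x x0.
have := power_ratio_le K0 WP x0 (ltW x1); rewrite divr1 ler_pdivrMr// => h.
have : W x ^+ K < e ^+ K by apply: (le_lt_trans h); rewrite mulrC -ltr_pdivlMr.
by rewrite ltr_pXn2r// ?nnegrE ltW.
Qed.

Lemma P1_continuous kappa V : 0 < kappa -> P1 kappa V -> continuous V.
Proof.
move=> k0 [V0 V00 _ PV PW].
have pos W x : power_like kappa W -> 0 < x -> {for x, continuous W}.
  by move=> PW' /PW'[_ dW _ _ _]; apply: differentiable_continuous; exact/derivable1_diffP.
move=> x; have [x0|x0|<-] := ltgtP 0 x.
- exact: pos PV x0.
- have h : {for - x, continuous (fun y => V (- y))} by apply: (pos _ _ PW); lra.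
  have E : V = (fun y => V (- y)) \o -%R by apply/funext => y /=; rewrite opprK.
  by rewrite E; apply: continuous_comp h; exact: opp_continuous.
have [K kK] : exists K, kappa <= K%:R.
  by exists (Num.truncn kappa).+1; apply: ltW; rewrite truncnS_gt.
apply/cvgrPdist_lt => e e0; rewrite V00.
have [d1 d10 H1] := power_like_small k0 kK PV e0.
have [d2 d20 H2] := power_like_small k0 kK PW e0.
near=> y; rewrite sub0r normrN ger0_norm//.
have y1 : `|0 - y| < d1 by near: y; have /cvgrPdist_lt := @cvg_id _ (nbhs (0 : R)); apply.
have y2 : `|0 - y| < d2 by near: y; have /cvgrPdist_lt := @cvg_id _ (nbhs (0 : R)); apply.
move: y1 y2; rewrite sub0r normrN => y1 y2.
have [y0|y0|<-] := ltgtP 0 y; last by rewrite V00.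
- by apply: H1; rewrite gtr0_norm// in y1; lra.
- by rewrite -[y]opprK; apply: H2; rewrite ltr0_norm// in y2; lra.
Unshelve. all: by end_near. Qed.

Lemma power_like_half_line kappa K W : 0 < kappa -> kappa <= K%:R -> continuous W -> W 0 = 0 ->
  power_like kappa W -> half_line_potential K W.
Proof.
move=> k0 kK Wc W0 PW; split => //; first by rewrite -(ltr_nat R); lra.
by move=> x; exact: power_like_pointwise PW.
Qed.

Lemma P1_half_line kappa K V : 0 < kappa -> kappa <= K%:R -> P1 kappa V ->
  [/\ half_line_potential K V, half_line_potential K (fun x => V (- x)),
   forall x, 0 <= x -> V x <= K%:R * V (- x) & forall x, 0 <= x -> V (- x) <= K%:R * V x].
Proof.
move=> k0 kK PV; have Vc := P1_continuous k0 PV; have [V0 V00 sym P1' P2'] := PV.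
split.
- exact: power_like_half_line P1'.
- apply: (power_like_half_line k0) P2' => //; last by rewrite oppr0.
  by move=> x; apply: continuous_comp; [exact: opp_continuous|exact: Vc].
- move=> x x0; rewrite -{1}[x]opprK; apply: le_trans (sym _) _.
  by rewrite ler_wpM2r.
- by move=> x x0; apply: le_trans (sym _) _; rewrite ler_wpM2r.
Qed.

Lemma sublevel_measureE K V E : half_line_potential K V -> half_line_potential K (fun x => V (- x)) ->
  0 < E -> sublevel_measure V E = (turning_point V E + turning_point (fun x => V (- x)) E)%:E.
Proof.
move=> PV PW E0; have [X0 VX] := turning_pointP PV E0; have [Y0 WY] := turning_pointP PW E0.
set X := turning_point V E in X0 VX *; set Y := turning_point _ E in Y0 WY *.
rewrite /sublevel_measure (_ : [set x | _] = [set` `[- Y, X]]).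
  rewrite lebesgue_measure_itv/= lte_fin ifT; last by lra.
  by rewrite -EFinD opprK.
apply/seteqP; split => x /=; rewrite in_itv/=.
- move=> Vx; have [x0|x0] := leP 0 x.
    by have := potential_le_inv PV x0 (ltW X0); rewrite VX => /(_ Vx); lra.
  have h := @potential_le_inv _ _ _ PW (- x) Y ltac:(lra) (ltW Y0).
  by move: h; rewrite WY opprK => /(_ Vx); lra.
- move=> /andP[h1 h2]; have [x0|x0] := leP 0 x.
    by rewrite -VX (potential_le PV).
  have h := @potential_le _ _ _ PW (- x) Y ltac:(lra) ltac:(lra).
  by move: h; rewrite WY opprK.
Qed.

End PowerLike.

Local Open Scope card_scope.

(** * Enumeration and asymptotics from phase gaps *)

Section Counting.
Context {R : realType}.
Implicit Types (S : set R) (F G : R -> R) (x E : R).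

Definition least_above S x : R :=
  xget 0 [set E | [/\ S E, x < E & forall E', S E' -> x < E' -> E <= E']].

(** Started at 0, which lies below [S], so that the n-th element is counted from 1 as eigenvalues
    are. *)
Definition nth_least S n : R := iter n (least_above S) 0.
Arguments nth_least : simpl never.

(** [G] models the half phase of one side and [F] the total phase: existence is quantified by [G],
    gaps by [F]. All of [S] lies above [e0], where [G] takes the value [c]. *)
Context {S : set R} {F G : R -> R} {K : nat} {c A B D e0 : R}.
Hypotheses (c0 : 0 < c) (Ac : 1 <= A * c) (B0 : 0 < B) (D0 : 0 < D) (e00 : 0 < e0) (Ge0 : G e0 = c).
Hypothesis GF : forall E, 0 < E -> G E <= F E.
Hypothesis FG : forall E, 0 < E -> F E <= D * G E.
Hypothesis G_le : forall E E', 0 < E -> E <= E' -> G E <= G E'.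
Hypothesis F_le : forall E E', 0 < E -> E <= E' -> F E <= F E'.
Hypothesis F_scale_le : forall E l, 0 < E -> 1 <= l -> F (l * E) <= l ^+ K * F E.
Hypothesis F_scale_ge : forall E l, 0 < E -> 1 <= l -> Num.sqrt l * F E <= F (l * E).
Hypothesis S_pos : forall E, S E -> 0 < E /\ c < G E.
Hypothesis S_gap : forall E E', S E -> S E' -> E < E' -> E <= A * F E * (E' - E).
Hypothesis S_exists : forall E, 0 < E -> c <= G E ->
  exists E', S E' /\ E <= E' <= E * expR (B / G E).

Let A0 : 0 < A. Proof. by rewrite -(pmulr_lgt0 _ c0); have := Ac; lra. Qed.

Let S_gt E : S E -> e0 < E.
Proof.
move=> /S_pos[E0 GE]; rewrite ltNge; apply/negP => Ee; have := G_le E0 Ee.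
by rewrite Ge0; lra.
Qed.

Let S_F E : S E -> c < F E.
Proof. by move=> /S_pos[E0 GE]; apply: lt_le_trans (GF E0). Qed.

(** The infimum is attained because gaps below [E] exceed [e0 / (A * F E)]: an element of the set
    closer than this to the infimum has none below it. *)
Lemma least_aboveP x : (exists2 E, S E & x < E) ->
  [/\ S (least_above S x), x < least_above S x &
    forall E', S E' -> x < E' -> least_above S x <= E'].
Proof.
move=> [E SE xE]; rewrite /least_above; case: xgetP => [_ -> //|none].
pose T := [set t | [/\ S t, x < t & t <= E]].
have TE : T E by split.
have hT : has_inf T by split; [exists E|exists x => t [_ /ltW]].
have d0 : 0 < e0 / (A * F E) by have := S_F SE; have := c0 => ? ?; rewrite divr_gt0// mulr_gt0//; lra.
have [t [St xt tE] ti] := inf_adherent d0 hT.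
have /= := none t; case; split => // t' St' xt'; rewrite leNgt; apply/negP => t't.
have Tt' : T t' by split => //; lra.
have it' : inf T <= t' by apply: ge_inf => //; case: hT.
have := S_gap St' St t't; have := S_gt St' => et'.
have [t'0 _] := S_pos St'.
have Ft' : F t' <= F E by apply: F_le => //; lra.
apply/negP; rewrite -ltNge; apply: (@le_lt_trans _ _ (A * F E * (t - t'))).
  by rewrite ler_wpM2r ?ler_pM2l//; lra.
have AF : 0 < A * F E by rewrite mulr_gt0//; have := S_F SE; have := c0; lra.
apply: lt_trans et'; rewrite mulrC -ltr_pdivlMr//; lra.
Qed.

(** Existence yields a point at or above its argument, so it is applied at [E * expR (1 / F E)],
    strictly above [E]; this is the 1 in [1 + B * D]. *)
Lemma next_exists E : S E -> exists E', [/\ S E', E < E' & E' <= E * expR ((1 + B * D) / F E)].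
Proof.
move=> SE; have [E0 GE] := S_pos SE; have FE := S_F SE; have c0' := c0.
have F0 : 0 < F E by lra.
have G0 : 0 < G E by lra.
have lt1 : 1 < expR (F E)^-1 by rewrite -[ltLHS]expR0 ltr_expR invr_gt0.
have Elt : E < E * expR (F E)^-1 by rewrite ltr_pMr.
have GE1 : G E <= G (E * expR (F E)^-1) by apply: G_le => //; exact: ltW.
have [||E' [SE' /andP[h1 h2]]] := @S_exists (E * expR (F E)^-1); [lra|lra|].
exists E'; split => //; first lra.
apply: (le_trans h2); rewrite -mulrA ler_pM2l// -expRD ler_expR mulrDl mul1r lerD2l.
apply: (@le_trans _ _ (B / G E)).
  by rewrite ler_pM2l// lef_pV2 ?posrE//; lra.
by rewrite -mulrA ler_pM2l// ler_pdivlMr// mulrC ler_pdivrMr// FG.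
Qed.

Lemma nth_leastP n : [/\ S (nth_least S n.+1), nth_least S n < nth_least S n.+1 &
  forall E', S E' -> nth_least S n < E' -> nth_least S n.+1 <= E'].
Proof.
elim: n => [|n [Sn _ _]]; rewrite [nth_least S _.+1]iterS; apply: least_aboveP.
  have ec : c <= G e0 by rewrite Ge0.
  have [E [SE _]] := S_exists e00 ec.
  by exists E => //; case: (S_pos SE).
by have [E [SE lt _]] := next_exists Sn; exists E.
Qed.

Lemma nth_least_lt n m : (n < m)%N -> nth_least S n < nth_least S m.
Proof.
elim: m => // m IH; rewrite ltnS leq_eqVlt => /predU1P[->|/IH h].
  by case: (nth_leastP m).
by apply: (lt_trans h); case: (nth_leastP m).
Qed.

Lemma below_nth_least n : [set E | S E /\ E < nth_least S n.+1] = (fun i => nth_least S i.+1) @` `I_n.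
Proof.
apply/seteqP; split => [E /= [SE En]|_ /= [i ni <-]]; last first.
  by split; [case: (nth_leastP i)|exact: nth_least_lt].
elim: n En => [|n IH] En.
  have [_ _ /(_ E SE (S_pos SE).1)] := nth_leastP 0.
  by rewrite leNgt En.
have [lt|gt|eq] := ltgtP E (nth_least S n.+1).
- by have [i /= ni iE] := IH lt; exists i => //=; rewrite ltnW.
- by have [_ _ /(_ E SE gt)] := nth_leastP n.+1; rewrite leNgt En.
- by exists n => //=.
Qed.

Lemma card_below_nth_least n : [set E | S E /\ E < nth_least S n.+1] #= `I_n.
Proof.
rewrite below_nth_least; apply: inj_card_eq => i j _ _ /= ij.
have [lt|gt|//] := ltngtP i j.
  by have := @nth_least_lt i.+1 j.+1 lt; rewrite ij ltxx.
by have := @nth_least_lt j.+1 i.+1 gt; rewrite ij ltxx.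
Qed.

Lemma nth_least_unique n E : S E -> [set E' | S E' /\ E' < E] #= `I_n -> E = nth_least S n.+1.
Proof.
move=> SE cE; have [lt|gt|//] := ltgtP E (nth_least S n.+1).
  have : [set E | S E /\ E < nth_least S n.+1] E by [].
  rewrite below_nth_least => -[i /= ni iE].
  have := card_below_nth_least i; rewrite iE => /(card_eq_trans (card_esym cE))/card_eq_II ni'.
  by rewrite ni' ltnn in ni.
have sub : [set E' | S E' /\ E' < nth_least S n.+2] `<=` [set E' | S E' /\ E' < E].
  by move=> E' /= [SE' E'n]; split => //; apply: (lt_le_trans E'n); case: (nth_leastP n.+1) => _ _; apply.
have := subset_card_le sub; rewrite (card_le_eql (card_below_nth_least n.+1)) (card_le_eqr cE) card_le_II.
by rewrite ltnn.
Qed.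

(** With [t = 1 + B * D], the next phase is at most [exp(K t / F) F], which exceeds [F] by at most
    [K t exp(K t / F)]; finally [F > c]. The first summand of [phase_scale] bounds the first
    phase. *)
Definition phase_step := K%:R * (1 + B * D) * expR (K%:R * (1 + B * D) / c).
Definition phase_scale := expR (K%:R * B / c) * D * c + phase_step.

Let phase_step_ge0 : 0 <= phase_step.
Proof. by rewrite mulr_ge0 ?expR_ge0// mulr_ge0// addr_ge0// mulr_ge0// ltW. Qed.
Let phase_scale_ge0 : 0 <= phase_scale.
Proof. by rewrite addr_ge0// !mulr_ge0 ?expR_ge0// ltW. Qed.
Let phase n := F (nth_least S n.+1).

Lemma nth_least_scale m n : (m <= n)%N -> exists2 l, 1 <= l & nth_least S n.+1 = l * nth_least S m.+1.
Proof.
move=> mn; have [Sm _ _] := nth_leastP m; have [e _] := S_pos Sm.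
exists (nth_least S n.+1 / nth_least S m.+1); last by rewrite divfK// gt_eqF.
rewrite ler_pdivlMr// mul1r; case: (ltngtP m n) mn => // [lt _|-> _ //].
by apply: ltW; exact: nth_least_lt.
Qed.

(** Lower bound: consecutive elements have ratio at least [1 + z] with [z = 1 / (A F) <= 1], and
    [sqrt (1 + z) >= 1 + z / 3], so [F] gains [z F / 3]. Upper bound: the next element is no further
    than the one from [next_exists]. *)
Lemma phase_increment n : (3 * A)^-1 <= phase n.+1 - phase n <= phase_step.
Proof.
have [S1 _ _] := nth_leastP n; have [S2 lt min] := nth_leastP n.+1; rewrite /phase.
set e1 := nth_least S n.+1 in S1 lt min *; set e2 := nth_least S n.+2 in S2 lt min *.
have [p1 _] := S_pos S1; have f1 := S_F S1; have c0' := c0; have A0' := A0.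
have F0 : 0 < F e1 by lra.
apply/andP; split.
- pose z := (A * F e1)^-1.
  have AF : 1 <= A * F e1 by apply: le_trans Ac _; rewrite ler_pM2l// ltW.
  have AF0 : 0 < A * F e1 by lra.
  have z0 : 0 < z by rewrite invr_gt0.
  have z1 : z <= 1 by rewrite invf_le1.
  have h : (1 + z) * e1 <= e2.
    have := S_gap S1 S2 lt; rewrite mulrC -ler_pdivrMr// -/z; lra.
  have s : 1 + z / 3 <= Num.sqrt (1 + z).
    rewrite -[leLHS]ger0_norm; last by lra.
    rewrite -sqrtr_sqr ler_wsqrtr//.
    have : z ^+ 2 <= z by rewrite expr2 ler_piMl// ltW.
    by lra.
  have h1 := F_scale_ge p1 (_ : 1 <= 1 + z); have {}h1 := h1 ltac:(lra).
  have h2 : F ((1 + z) * e1) <= F e2 by apply: F_le => //; rewrite mulr_gt0//; lra.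
  have h3 : (1 + z / 3) * F e1 <= Num.sqrt (1 + z) * F e1 by rewrite ler_pM2r.
  have -> : (3 * A)^-1 = z / 3 * F e1 by rewrite /z; field; rewrite !gt_eqF.
  by lra.
- have [E' [SE' E1 E2]] := next_exists S1.
  have e2E : e2 <= E' by exact: min.
  set t := 1 + B * D in E2; have t0 : 0 < t by rewrite addr_gt0// mulr_gt0.
  have k0 : 0 <= K%:R :> R by [].
  have e21 : 0 < e2 by lra.
  have h1 : F e2 <= F (expR (t / F e1) * e1) by apply: F_le => //; rewrite mulrC; lra.
  have h2 : F e2 <= expR (K%:R * t / F e1) * F e1.
    apply: (le_trans h1); apply: le_trans (F_scale_le p1 _) _.
      by rewrite -[leLHS]expR0 ler_expR divr_ge0// ltW.
    by rewrite -expRM_natl mulrA.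
  set y := K%:R * t in h2 *.
  have y0 : 0 <= y by rewrite mulr_ge0// ltW.
  have h3 : expR (y / F e1) * F e1 - F e1 <= y * expR (y / F e1).
    have := @expR_ge1Dx _ (- (y / F e1)); rewrite expRN -(ler_pM2r (expR_gt0 (y / F e1))) mulVf ?gt_eqF ?expR_gt0//.
    rewrite -(ler_pM2r F0) => h.
    have E : y / F e1 * F e1 = y by rewrite divfK// gt_eqF.
    have : (1 - y / F e1) * expR (y / F e1) * F e1 = expR (y / F e1) * F e1 - y / F e1 * F e1 * expR (y / F e1) by ring.
    by rewrite E; lra.
  have h4 : y * expR (y / F e1) <= phase_step.
    rewrite /phase_step -/t -/y ler_wpM2l// ler_expR ler_wpM2l// lef_pV2 ?posrE//; exact: ltW.
  by lra.
Qed.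

Lemma phase_diff m k : k%:R / (3 * A) <= phase (m + k) - phase m <= k%:R * phase_step.
Proof.
elim: k => [|k /andP[IH1 IH2]]; first by rewrite addn0 subrr !mul0r lexx.
have /andP[h1 h2] := phase_increment (m + k).
rewrite addnS -(natr1 k).
move: IH1 IH2 h1 h2; generalize phase_step (phase (m + k)) (phase (m + k).+1) (phase m) => i p1 p2 p3 IH1 IH2 h1 h2.
apply/andP; split; lra.
Qed.

Lemma phase0_le : c < phase 0 <= expR (K%:R * B / c) * D * c.
Proof.
have [S1 _ min] := nth_leastP 0; rewrite /phase S_F//=.
have c0' := c0; have ec : c <= G e0 by rewrite Ge0.
have [E [SE /andP[h1]]] := S_exists e00 ec; rewrite Ge0 => h2.
have [E0 _] := S_pos SE; have [E10 _] := S_pos S1.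
apply: le_trans (F_le E10 (min _ SE E0)) _.
apply: le_trans (F_le E0 h2) _.
rewrite mulrC; apply: le_trans (F_scale_le e00 _) _.
  by rewrite -[leLHS]expR0 ler_expR divr_ge0// ltW.
rewrite -expRM_natl mulrA -[leRHS]mulrA ler_pM2l ?expR_gt0//.
by have := FG e00; rewrite Ge0.
Qed.

Lemma phase_asymptotics n : n.+1%:R / (3 * A) <= phase n <= phase_scale * n.+1%:R.
Proof.
have /andP[h1 h2] := phase0_le; have /andP := phase_diff 0 n; rewrite add0n => -[h3 h4].
have c0' := c0; have A0' := A0.
(* The first phase exceeds [c], hence one increment; this turns [n] increments into the factor
   [n.+1]. *)
have Ai : (3 * A)^-1 <= c.
  rewrite -[leLHS]mul1r ler_pdivrMr; last by lra.
  by have := Ac; lra.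
have n0 : 0 <= n%:R :> R by [].
have p : 0 <= expR (K%:R * B / c) * D * c * n%:R by rewrite !mulr_ge0 ?expR_ge0// ltW.
have q := phase_step_ge0.
move: h1 h2 h3 h4 p q; rewrite /phase_scale -(natr1 n).
generalize phase_step (phase 0) (phase n) (expR (K%:R * B / c)) => i p0 pn e h1 h2 h3 h4 p q.
by apply/andP; split; lra.
Qed.

(** For [t] the ratio of the smaller element to the larger, scaling puts the ratio of phases between
    [t ^+ K] and [sqrt t]. Hence [g * (1 - t)] is comparable to the difference of phases, that is to
    [n - m], while [g] is comparable to [n.+1]. *)
Lemma nth_least_gap m n : (m <= n)%N ->
  nth_least S n.+1 - nth_least S m.+1 <= 6 * A * phase_step * (nth_least S n.+1 / n.+1%:R * (n%:R - m%:R)) /\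
  nth_least S n.+1 / n.+1%:R * (n%:R - m%:R) <= 3 * A * K%:R * phase_scale * (nth_least S n.+1 - nth_least S m.+1).
Proof.
move=> mn; have [l l1 El] := nth_least_scale mn.
have [S1 _ _] := nth_leastP m; have [S2 _ _] := nth_leastP n.
have [p1 _] := S_pos S1; have [p2 _] := S_pos S2.
have := S_F S1; have := S_F S2; have := F_scale_le p1 l1; have := F_scale_ge p1 l1.
have /andP := phase_asymptotics n; have /andP := phase_diff m (n - m); rewrite subnKC// natrB//.
rewrite -El -/(phase m) -/(phase n).
set N := n.+1%:R; set d := n%:R - m%:R; set f := phase m; set g := phase n => -[d1 d2] [g1 g2] lo hi cg cf.
have c0' := c0; have A0' := A0.
have N0 : 0 < N by rewrite ltr0n.
have d0 : 0 <= d by rewrite subr_ge0 ler_nat.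
have g0 : 0 < g by lra.
have f0 : 0 < f by lra.
have l0 : 0 < l by lra.
set e2 := nth_least S n.+1 in El p2 *; set e1 := nth_least S m.+1 in El p1 *.
pose t := l^-1; have t0 : 0 < t by rewrite invr_gt0.
have t1 : t <= 1 by rewrite invf_le1.
have e12 : e2 - e1 = e2 * (1 - t) by rewrite /t El; field; rewrite gt_eqF.
have q := phase_step_ge0.
have M0 := phase_scale_ge0.
have up : g * (1 - t) <= 2 * (d * phase_step).
  have s0 : 0 < Num.sqrt l by rewrite sqrtr_gt0.
  have s2 : Num.sqrt l ^+ 2 = l by rewrite sqr_sqrtr// ltW.
  pose r := (Num.sqrt l)^-1; have r0 : 0 < r by rewrite invr_gt0.
  have rt : r ^+ 2 = t by rewrite /r /t exprVn s2.
  have fr : f <= r * g by rewrite ler_pdivlMl.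
  have h : 0 <= g * (1 - r) ^+ 2 by rewrite mulr_ge0 ?sqr_ge0// ltW.
  have E : g * (1 - t) = 2 * (g - r * g) - g * (1 - r) ^+ 2 by rewrite -rt; ring.
  by lra.
have low : d / (3 * A) <= K%:R * (g * (1 - t)).
  have h1 : t ^+ K * g <= f.
    by rewrite /t exprVn ler_pdivrMl ?exprn_gt0.
  (* Bernoulli's inequality. *)
  have h2 : 1 - K%:R * (1 - t) <= t ^+ K.
    elim: (K) => [|k IH]; first by rewrite expr0; lra.
    have tk : t ^+ k <= 1 by rewrite exprn_ile1// ltW.
    have : 0 <= (1 - t ^+ k) * (1 - t) by rewrite mulr_ge0//; lra.
    by rewrite exprSr -natr1; lra.
  have : (1 - K%:R * (1 - t)) * g <= t ^+ K * g by rewrite ler_pM2r.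
  by lra.
have eN : 0 < e2 / N by rewrite divr_gt0.
have Ng : N <= 3 * A * g by rewrite mulrC -ler_pdivrMr//; lra.
rewrite e12; split.
- have -> : e2 * (1 - t) = e2 / N * (N * (1 - t)) by field; rewrite gt_eqF.
  rewrite [leRHS]mulrCA ler_pM2l//.
  have h : N * (1 - t) <= 3 * A * g * (1 - t) by rewrite ler_wpM2r//; lra.
  have h' : 3 * A * (g * (1 - t)) <= 3 * A * (2 * (d * phase_step)) by rewrite ler_pM2l//; lra.
  by lra.
- have -> : 3 * A * K%:R * phase_scale * (e2 * (1 - t)) = e2 / N * (3 * A * (K%:R * (phase_scale * N * (1 - t)))).
    by field; rewrite gt_eqF.
  rewrite ler_pM2l//.
  have A3 : 0 < 3 * A by lra.
  rewrite ler_pdivrMr// in low; apply: (le_trans low); rewrite [leLHS]mulrC ler_pM2l//.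
  rewrite ler_wpM2l// ler_wpM2r//; lra.
Qed.

Definition counting_constant := phase_scale + 3 * A + 6 * A * phase_step + 3 * A * K%:R * phase_scale.

Let counting_constant_ge : [/\ 0 < counting_constant, phase_scale <= counting_constant, 3 * A <= counting_constant,
  6 * A * phase_step <= counting_constant & 3 * A * K%:R * phase_scale <= counting_constant].
Proof.
have A0' := A0; have q := phase_step_ge0; have M0 := phase_scale_ge0.
have t1 : 0 <= 6 * A * phase_step by rewrite mulr_ge0//; lra.
have t2 : 0 <= 3 * A * K%:R * phase_scale by rewrite mulr_ge0// mulr_ge0//; lra.
by rewrite /counting_constant; split; lra.
Qed.

Lemma counting_constant_gt0 : 0 < counting_constant.
Proof. by case: counting_constant_ge. Qed.

Lemma nth_least_asymptotics : [/\ forall n, S (nth_least S n.+1) /\ [set E | S E /\ E < nth_least S n.+1] #= `I_n,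
  forall n E, S E -> [set E' | S E' /\ E' < E] #= `I_n -> E = nth_least S n.+1,
  forall n, counting_constant^-1 * n.+1%:R <= F (nth_least S n.+1) <= counting_constant * n.+1%:R &
  forall m n, (m <= n)%N ->
    counting_constant^-1 * (nth_least S n.+1 / n.+1%:R * (n%:R - m%:R)) <=
      nth_least S n.+1 - nth_least S m.+1 <=
    counting_constant * (nth_least S n.+1 / n.+1%:R * (n%:R - m%:R))].
Proof.
have [Q0 Q1 Q2 Q3 Q4] := counting_constant_ge; have A0' := A0.
split => //.
- by move=> n; split; [case: (nth_leastP n)|exact: card_below_nth_least].
- by move=> n E; exact: nth_least_unique.
- move=> n; have /andP[h1 h2] := phase_asymptotics n.
  have n0 : 0 < n.+1%:R :> R by rewrite ltr0n.
  rewrite ler_pdivrMr in h1; last lra.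
  have F0 : 0 < phase n by have [/S_F h _ _] := nth_leastP n; exact: lt_trans h.
  rewrite ler_pdivrMl//; apply/andP; split.
    by apply: (le_trans h1); rewrite mulrC ler_pM2r.
  by apply: (le_trans h2); rewrite ler_pM2r.
- move=> m n mn; have [h1 h2] := nth_least_gap mn.
  have [Sn _ _] := nth_leastP n; have [en _] := S_pos Sn.
  have d0 : 0 <= nth_least S n.+1 / n.+1%:R * (n%:R - m%:R).
    by rewrite mulr_ge0 ?subr_ge0 ?ler_nat// divr_ge0// ltW.
  have g0 : 0 <= nth_least S n.+1 - nth_least S m.+1.
    rewrite subr_ge0; case: (ltngtP m n) mn => // [lt _|-> _ //].
    by apply: ltW; exact: nth_least_lt.
  rewrite ler_pdivrMl//; apply/andP; split.
    by apply: (le_trans h2); rewrite ler_wpM2r.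
  by apply: (le_trans h1); rewrite ler_wpM2r.
Qed.

End Counting.

(** * Scaling of half phases and the final constants *)

Section Assembly.
Context {R : realType}.
Implicit Types (V W : R -> R) (x E : R) (K : nat).

Lemma half_phase_gt0 K V E : half_line_potential K V -> 0 < E -> 0 < half_phase V E.
Proof. by move=> PV E0; have [X0 _] := turning_pointP PV E0; rewrite mulr_gt0// sqrtr_gt0. Qed.

Lemma half_phase_scale_le K V E l : half_line_potential K V -> 0 < E -> 1 <= l ->
  half_phase V (l * E) <= l ^+ K.+1 * half_phase V E.
Proof.
move=> PV E0 l1; have l0 : 0 < l by lra.
have [X0 _] := turning_pointP PV E0.
have h := turning_point_scale PV E0 l1.
have s : Num.sqrt l <= l.
  rewrite -[leRHS]ger0_norm ?(ltW l0)// -sqrtr_sqr ler_wsqrtr// expr2 ler_peMr//; exact: ltW.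
have [Y0 _] := turning_pointP PV (mulr_gt0 l0 E0).
rewrite /half_phase sqrtrM ?(ltW l0)// exprS.
rewrite [leRHS](_ : _ = l * Num.sqrt E * (l ^+ K * turning_point V E)); last by ring.
by apply: ler_pM => //; rewrite ?mulr_ge0 ?sqrtr_ge0 ?(ltW Y0)// ler_wpM2r ?sqrtr_ge0.
Qed.

Lemma half_phase_scale_ge K V E l : half_line_potential K V -> 0 < E -> 1 <= l ->
  Num.sqrt l * half_phase V E <= half_phase V (l * E).
Proof.
move=> PV E0 l1; have l0 : 0 < l by lra.
rewrite /half_phase sqrtrM ?(ltW l0)// mulrA ler_wpM2l ?mulr_ge0 ?sqrtr_ge0//.
by apply: (turning_point_le PV E0); rewrite ler_peMl// ltW.
Qed.

(** In terms of the turning point [x] the half phase is [x sqrt (V x)], so the equation to solve is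
    [x ^+ 2 * V x = c ^+ 2], by the intermediate value theorem. *)
Lemma half_phase_surjective K V (c : R) : half_line_potential K V -> 0 < c ->
  exists2 E, 0 < E & half_phase V E = c.
Proof.
move=> PV c0; have Vc : continuous V by case: PV.
have c20 : 0 < c ^+ 2 by rewrite exprn_gt0.
have [X [X0 VX]] := turning_point_exists PV c20.
have gc : continuous (fun x => x ^+ 2 * V x).
  move=> x; have h : {for x, continuous (fun x : R => x ^+ 2)} by exact: exprn_continuous.
  exact: (@continuousM R R _ _ _ h (Vc x)).
have X1 : 0 <= 1 + X by lra.
have [|x] := @IVT _ (fun x => x ^+ 2 * V x) 0 (1 + X) (c ^+ 2) X1 (continuous_subspaceT gc).
  rewrite expr0n mul0r ge_min (ltW c20)/= le_max; apply/orP; right.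
  rewrite -[leLHS]mul1r; apply: ler_pM => //; first exact: ltW.
    by rewrite exprn_ege1//; lra.
  by rewrite -VX (potential_le PV); lra.
rewrite in_itv/= => /andP[x0 _] xV.
have x1 : 0 < x.
  by rewrite lt_neqAle x0 andbT; apply/eqP => x00; move: c20; rewrite -xV -x00 expr0n mul0r ltxx.
have Vx : 0 < V x by case: PV => _ _ _ /(_ x x1)[].
exists (V x) => //; have [Y0 VY] := turning_pointP PV Vx.
have xY : turning_point V (V x) = x.
  by apply/le_anti/andP; split; apply: (potential_le_inv PV); rewrite ?VY// ltW.
rewrite /half_phase xY mulrC -{1}[x]ger0_norm// -sqrtr_sqr -sqrtrM ?sqr_ge0// xV sqrtr_sqr.
by rewrite ger0_norm// ltW.
Qed.

End Assembly.

Theorem theorem7p6 (R : realType) (kappa : R) (hkappa : 1 <= kappa) :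
  exists C : R, 0 < C /\
    forall V : R -> R, P1 kappa V ->
      (forall n : nat, (1 <= n)%N ->
         simeq C ((Num.sqrt (eigen V n))%:E * sublevel_measure V (eigen V n))%E
                 (n%:R)%:E)
      /\
      (forall m n : nat, (1 <= m)%N -> (m <= n)%N ->
         simeq C (eigen V n - eigen V m)%:E
                 (eigen V n / n%:R * (n%:R - m%:R))%:E).
Proof.
have [K kK] : exists K, kappa <= K%:R by exists (Num.truncn kappa).+1; apply: ltW; rewrite truncnS_gt.
have k0 : 0 < kappa by lra.
have K1 : 1 <= K%:R :> R by lra.
have KK : 0 < K%:R ^+ K :> R by rewrite exprn_gt0//; lra.
have p2 : 0 < 2 ^+ K :> R by rewrite exprn_gt0.
(* The bound of [matching_phase_bound]; half of it, [c], makes the inequalities at eigenvalues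
   strict. *)
pose b : R := (4 * 2 ^+ K * K%:R ^+ K)^-1.
have b0 : 0 < b by rewrite invr_gt0 !mulr_gt0.
pose c := b / 2; have c0 : 0 < c by rewrite /c; lra.
have [M [M0 rate]] := @spectral_rate_bounds R K c c0.
pose D := 1 + K%:R ^+ K : R; have D0 : 0 < D by rewrite /D; lra.
(* The first summand is the constant of [matching_gap]; the second secures [A * c >= 1], which
   settles gaps longer than [E]. *)
have [A [Ac tA cA]] : exists A, [/\ 1 <= A * c, 4 * M * 2 ^+ K <= A & c^-1 <= A].
  have t0 : 0 < 4 * M * 2 ^+ K by rewrite !mulr_gt0.
  have c'0 : 0 < c^-1 by rewrite invr_gt0.
  exists (4 * M * 2 ^+ K + c^-1); split; [|lra|lra].
  by rewrite mulrDl mulVf ?gt_eqF// lerDr ltW// mulr_gt0.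
have A0 : 0 < A by apply: lt_le_trans cA; rewrite invr_gt0.
have B0 : 0 < pi * M by rewrite mulr_gt0// pi_gt0.
(* The exponent is [K.+1]: [K] from the turning point and 1 from [Num.sqrt l <= l]. *)
pose Q := @counting_constant R K.+1 c A (pi * M) D.
have Q0 : 0 < Q by exact: counting_constant_gt0.
exists Q; split => // V PV0.
have [PV PW VW WV] := P1_half_line k0 kK PV0.
pose W x := V (- x).
pose F (E : R) : R := half_phase V E + half_phase W E.
have [e0 e00 Ge0] := half_phase_surjective PV c0.
have bound E : eigenvalue_of V E -> [/\ matching V W E, 0 < E, c < half_phase V E & c < half_phase W E].
  move=> eE; have m := eigenvalue_matching PV PW eE.
  by have [E0 [h1 h2]] := matching_phase_bound PV PW VW WV m; rewrite -/b in h1 h2; split => //; rewrite /c; lra.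
have gap (E E' : R) : eigenvalue_of V E -> eigenvalue_of V E' -> E < E' -> E <= A * F E * (E' - E).
  move=> /bound[m E0 hV hW] /bound[m' _ _ _] EE'.
  have F0 : 0 < F E by rewrite /F; lra.
  have d0 : 0 < E' - E by lra.
  have [h|h] := leP E' (2 * E).
    apply: le_trans (matching_gap PV PW rate M0 c0 E0 (ltW hV) (ltW hW) EE' h m m') _.
    by rewrite -/(F E) ler_pM2r// ler_pM2r.
  have AF : 1 <= A * F E.
    by apply: le_trans Ac _; rewrite ler_pM2l// /F; lra.
  by apply: le_trans (_ : 1 * (E' - E) <= _); [lra|rewrite ler_pM2r].
have ex (E : R) : 0 < E -> c <= half_phase V E ->
    exists E', eigenvalue_of V E' /\ E <= E' <= E * expR (pi * M / half_phase V E).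
  move=> E0 cE; have [E' [hE' m]] := matched_exists PV PW rate M0 c0 E0 cE.
  by exists E'; split => //; exact: (matched_eigenvalue PV PW m).
have GF (E : R) : 0 < E -> half_phase V E <= F E by move=> E0; rewrite /F; have := half_phase_gt0 PW E0; lra.
have FG (E : R) : 0 < E -> F E <= D * half_phase V E.
  move=> E0; have [_ h] := turning_point_compare PV PW VW WV E0.
  rewrite /F /D mulrDl mul1r lerD2l /half_phase mulrCA ler_pM2l ?sqrtr_gt0//.
have F_le (E E' : R) : 0 < E -> E <= E' -> F E <= F E'.
  by move=> E0 EE'; apply: lerD; [exact: (half_phase_le PV)|exact: (half_phase_le PW)].
have F_up (E l : R) : 0 < E -> 1 <= l -> F (l * E) <= l ^+ K.+1 * F E.
  move=> E0 l1; have := half_phase_scale_le PV E0 l1; have := half_phase_scale_le PW E0 l1.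
  by rewrite /F mulrDr; lra.
have F_low (E l : R) : 0 < E -> 1 <= l -> Num.sqrt l * F E <= F (l * E).
  move=> E0 l1; have := half_phase_scale_ge PV E0 l1; have := half_phase_scale_ge PW E0 l1.
  by rewrite /F mulrDr; lra.
have S_pos E : eigenvalue_of V E -> 0 < E /\ c < half_phase V E by case/bound.
have [Se uniq phase diff] := nth_least_asymptotics c0 Ac B0 D0 e00 Ge0 GF FG
  (half_phase_le PV) F_le F_up F_low S_pos gap ex.
(* By existence and uniqueness the value chosen by [xget] is this element, so its default never
   occurs. *)
have eigenE n : eigen V n.+1 = nth_least (eigenvalue_of V) n.+1.
  by apply: xget_unique; [exact: Se|move=> E [SE cE]; exact: uniq].
split=> [[//|n] _|[//|m] [//|n] _ mn]; rewrite /simeq.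
  have [SE _] := Se n; have [E0 _] := S_pos _ SE.
  rewrite !eigenE (sublevel_measureE PV PW E0) -!EFinM !lee_fin mulrDr.
  exact/andP/phase.
rewrite !eigenE -!EFinM !lee_fin.
have := diff m n mn; rewrite -[in n.+1%:R - m.+1%:R]natr1 -[in _ - m.+1%:R]natr1.
have -> : n%:R + 1 - (m%:R + 1) = n%:R - m%:R :> R by ring.
by move/andP.
Qed.
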